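(* Let $\Lambda$ be a finite dimensional symmetric algebra over an algebraically closed field $k$ and let $C$ be an indecomposable perfect complex of $\Lambda$-modules with $\dim_k\operatorname{End}_{D^b(\Lambda)}(C)=2$. Then for every complex $D$ in the region of the Auslander-Reiten quiver component between $C$ and the rim, we have $\dim_k\operatorname{End}_{D^b(\Lambda)}(D)=2$. Furthermore, such a complex $C$ (an indecomposable perfect complex with $\dim_k\operatorname{End}_{D^b(\Lambda)}(C)=2$) exists at distance $m$ from the rim if and only if there is a perfect complex $C_0$ with $\dim_k\operatorname{End}_{D^b(\Lambda)}(C_0)=2$ and $\dim_k\operatorname{Hom}_{D^b(\Lambda)}(C_0,C_0[i])=0$ when $i\neq 0$, $-m\leq i\leq m$.
   Context: A perfect complex is a finite complex of finitely generated projective $\Lambda$-modules; $D^b(\Lambda\text{-proj})$ is the homotopy category of perfect complexes, a full triangulated subcategory of the bounded derived category $D^b(\Lambda)$ of finitely generated modules. $\Lambda$ is symmetric if $\Lambda\cong\operatorname{Hom}_k(\Lambda,k)$ as bimodules. An Auslander-Reiten triangle is a distinguished triangle $X\to Y\xrightarrow{\beta}Z\xrightarrow{\gamma}X[1]$ with $X,Z$ indecomposable, $\gamma\neq 0$, such that every morphism $W\to Z$ that is not a split epimorphism factors through $\beta$. It is known (Happel) that $D^b(\Lambda\text{-proj})$ has Auslander-Reiten triangles, and for $\Lambda$ symmetric they have the form $X\to Y\to X[1]\to X[1]$. It is known (Wheeler) that, provided $\Lambda$ has no semisimple summand, all components of the Auslander-Reiten quiver of $D^b(\Lambda\text{-proj})$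 have the form $\mathbb{Z}A_\infty$. An indecomposable $Z$ lies on the rim if in the Auslander-Reiten triangle $X\to Y\to Z\to X[1]$ the object $Y$ is indecomposable. In such a component the rim objects are the shifts of a single object $B_0$, and the objects at distance $n\ge 0$ from the rim are the shifts of an indecomposable $B_n$, chosen so that there is a chain of irreducible morphisms $B_0\to B_1\to\cdots\to B_n$. Thus the Auslander-Reiten triangles are $B_0[-1]\to B_1[-1]\to B_0\to B_0$ and, for $n\geq 1$, $B_n[-1]\to B_{n-1}\oplus B_{n+1}[-1]\to B_n\to B_n$, together with their shifts. If $C$ is at distance $m$ from the rim (a shift of $B_m$), the region between $C$ and the rim is the strip of objects in the component at distance at most $m$ from the rim, i.e. the objects $B_r[j]$ with $0\leq r\leq m$, $j\in\mathbb{Z}$.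
   Formalization: The equivalence is proved for C_0 indecomposable (any symmetric Λ) and for any perfect C_0 when Λ has no semisimple summand; without such a condition it fails, e.g. Λ = k, C_0 = k ⊕ k[5], m = 3. *)

(* Defs.v *)
From HB Require Import structures.
From mathcomp Require Import all_boot all_algebra falgebra.

Set Implicit Arguments.
Unset Strict Implicit.
Unset Printing Implicit Defensive.

Import GRing.Theory.
Local Open Scope ring_scope.

(* The bimodule structure on Hom_k(L, k) is (a . f . b)(y) = f (b * y * a). *)
Definition symmetric_algebra (k : fieldType) (L : falgType k) : Prop :=
  exists phi : 'Hom(L, 'Hom(L, k^o)),
    bijective phi /\
    forall a b x y : L, phi (a * x * b) y = phi x (b * y * a).

Definition left_ideal (k : fieldType) (L : falgType k) (U : {vspace L}) : Prop :=
  forall a u : L, u \in U -> a * u \in U.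

(* A block summand of L is L * e for a central idempotent e; it is a semisimple
   ring when each of its left ideals has a complementary left ideal. *)
Definition has_semisimple_summand (k : fieldType) (L : falgType k) : Prop :=
  exists e : L,
    [/\ e != 0, e * e = e, forall x : L, e * x = x * e
      & forall U : {vspace L}, left_ideal U -> (U <= fullv * <[e]>)%VS ->
          exists V : {vspace L},
            [/\ left_ideal V, (U + V = fullv * <[e]>)%VS & (U :&: V = 0)%VS]].

Section Modules.
Variable R : nzRingType.

Definition finitely_generated (P : lmodType R) : Prop :=
  exists (n : nat) (v : 'I_n -> P),
    forall x : P, exists c : 'I_n -> R, x = \sum_i c i *: v i.

Definition projective (P : lmodType R) : Prop :=
  forall (M N : lmodType R) (g : {linear M -> N}) (f : {linear P -> N}),
    (forall y : N, exists x : M, g x = y) ->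
    exists h : {linear P -> M}, forall x : P, g (h x) = f x.

End Modules.

(* Complexes are cohomologically graded: the differential raises degree. *)
Section Complexes.
Variable R : nzRingType.

Record complex := Complex {
  obj :> int -> lmodType R;
  diff : forall i : int, {linear obj i -> obj (i + 1)};
  diffK : forall (i : int) (x : obj i), diff (i + 1) (diff i x) = 0 }.

Arguments diff : clear implicits.

Definition perfect (X : complex) : Prop :=
  (forall i : int, finitely_generated (X i) /\ projective (X i)) /\
  (exists N : nat, forall i : int, (N < `|i|)%N -> forall x : X i, x = 0).

Record chain_map (X Y : complex) := ChainMap {
  cmap :> forall i : int, {linear X i -> Y i};
  cmapP : forall (i : int) (x : X i),
    diff Y i (cmap i x) = cmap (i + 1) (diff X i x) }.

(* Stated for raw families of functions so that it can be applied to pointwise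
   differences and linear combinations of chain maps.  As i ranges over int,
   i + 1 ranges over all degrees. *)
Definition null_homotopic (X Y : complex) (f : forall i : int, X i -> Y i) : Prop :=
  exists s : forall i : int, {linear X (i + 1) -> Y i},
    forall (i : int) (x : X (i + 1)),
      f (i + 1) x = diff Y i (s i x) + s (i + 1) (diff X (i + 1) x).

Definition homotopic (X Y : complex) (f g : chain_map X Y) : Prop :=
  null_homotopic (fun i x => f i x - g i x).

Definition id_map (X : complex) : chain_map X X :=
  @ChainMap X X (fun i => idfun) (fun i x => erefl).

Fact comp_mapP (X Y Z : complex) (g : chain_map Y Z) (f : chain_map X Y) (i : int) x :
  diff Z i ((g i \o f i) x) = (g (i + 1) \o f (i + 1)) (diff X i x).
Proof. by rewrite /= !cmapP. Qed.

Definition comp_map (X Y Z : complex) (g : chain_map Y Z) (f : chain_map X Y) :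
    chain_map X Z :=
  @ChainMap X Z (fun i => g i \o f i) (comp_mapP g f).

Definition homotopy_inverse (X Y : complex)
    (f : chain_map X Y) (g : chain_map Y X) : Prop :=
  homotopic (comp_map g f) (id_map X) /\ homotopic (comp_map f g) (id_map Y).

(* Isomorphisms of the homotopy category. *)
Definition homotopy_equivalence (X Y : complex) (f : chain_map X Y) : Prop :=
  exists g : chain_map Y X, homotopy_inverse f g.

Definition hiso (X Y : complex) : Prop :=
  exists f : chain_map X Y, homotopy_equivalence f.

Definition is_zero (X : complex) : Prop := null_homotopic (fun i (x : X i) => x).

Definition dsum_diff (X Y : complex) (i : int) (x : X i * Y i) :
  X (i + 1) * Y (i + 1) := (diff X i x.1, diff Y i x.2).

Fact dsum_diff_linear (X Y : complex) (i : int) : linear (@dsum_diff X Y i).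
Proof. by move=> a x y; rewrite /dsum_diff /= !linearP. Qed.

HB.instance Definition _ X Y i :=
  GRing.isLinear.Build R _ _ _ (@dsum_diff X Y i) (@dsum_diff_linear X Y i).

Fact dsum_diffK (X Y : complex) (i : int) (x : X i * Y i) : dsum_diff (dsum_diff x) = 0.
Proof. by rewrite /dsum_diff /= !diffK. Qed.

Definition dsum (X Y : complex) : complex :=
  @Complex (fun i => (X i * Y i)%type) (fun i => @dsum_diff X Y i) (@dsum_diffK X Y).

(* The shift X[n], with X[n]^i = X^(i + n) and differential (-1)^n d.  The
   transport identifies X^((i + n) + 1) with X^((i + 1) + n). *)
Definition transport (X : complex) (i j : int) (e : i = j) (x : X i) : X j :=
  ecast l (X l) e x.

Fact transport_linear (X : complex) (i j : int) (e : i = j) : linear (@transport X i j e).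
Proof. by case: j / e. Qed.

HB.instance Definition _ X i j (e : i = j) :=
  GRing.isLinear.Build R _ _ _ (@transport X i j e) (@transport_linear X i j e).

Fact diff_transport (X : complex) (i j : int) (e : i = j) (e1 : i + 1 = j + 1) (x : X i) :
  diff X j (transport e x) = transport e1 (diff X i x).
Proof. by case: j / e e1 => e1; rewrite (eq_irrelevance e1 erefl). Qed.

Definition shift_diff (X : complex) (n i : int) (x : X (i + n)) : X (i + 1 + n) :=
  (-1) ^+ `|n|%N *: transport (addrAC i n 1) (diff X (i + n) x).

Fact shift_diff_linear (X : complex) (n i : int) : linear (@shift_diff X n i).
Proof.
move=> a x y; rewrite /shift_diff !linearP /= !scalerDr !scalerA; congr (_ + _).
by rewrite (commr_sign a).
Qed.

HB.instance Definition _ X n i :=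
  GRing.isLinear.Build R _ _ _ (@shift_diff X n i) (@shift_diff_linear X n i).

Fact shift_diffK (X : complex) (n i : int) (x : X (i + n)) : shift_diff (shift_diff x) = 0.
Proof.
have e1 : i + n + 1 + 1 = i + 1 + n + 1 by rewrite (addrAC i n 1).
rewrite /shift_diff [X in transport _ X]linearZ_LR /= (diff_transport _ e1) diffK.
by rewrite linear0 scaler0 linear0 scaler0.
Qed.

Definition shift (n : int) (X : complex) : complex :=
  @Complex (fun i => X (i + n)) (fun i => @shift_diff X n i) (@shift_diffK X n).

Fact shift_mapP (n : int) (X Y : complex) (f : chain_map X Y) (i : int) (x : X (i + n)) :
  diff (shift n Y) i (f (i + n) x) = f (i + 1 + n) (diff (shift n X) i x).
Proof.
rewrite /= /shift_diff linearZ cmapP; congr (_ *: _).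
by case: (i + 1 + n) / (addrAC i n 1).
Qed.

Definition shift_map (n : int) (X Y : complex) (f : chain_map X Y) :
    chain_map (shift n X) (shift n Y) :=
  @ChainMap (shift n X) (shift n Y) (fun i => f (i + n)) (shift_mapP f).

(* The mapping cone of f : X -> Y, with cone^i = X^(i + 1) * Y^i. *)
Definition cone_diff (X Y : complex) (f : chain_map X Y) (i : int)
    (x : X (i + 1) * Y i) : X (i + 1 + 1) * Y (i + 1) :=
  (- diff X (i + 1) x.1, f (i + 1) x.1 + diff Y i x.2).

Fact cone_diff_linear (X Y : complex) (f : chain_map X Y) (i : int) : linear (@cone_diff X Y f i).
Proof.
move=> a x y; rewrite /cone_diff /= !linearP /=; congr pair.
by rewrite addrACA -scalerDr.
Qed.

HB.instance Definition _ X Y f i :=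
  GRing.isLinear.Build R _ _ _ (@cone_diff X Y f i) (@cone_diff_linear X Y f i).

Fact cone_diffK (X Y : complex) (f : chain_map X Y) (i : int) (x : X (i + 1) * Y i) :
  cone_diff f (cone_diff f x) = 0.
Proof.
rewrite /cone_diff /= linearN diffK opprK linearD diffK addr0 cmapP linearN.
by rewrite addNr.
Qed.

Definition cone (X Y : complex) (f : chain_map X Y) : complex :=
  @Complex (fun i => (X (i + 1)%R * Y i)%type) (fun i => @cone_diff X Y f i)
           (@cone_diffK X Y f).

Definition cone_in_fun (X Y : complex) (f : chain_map X Y) (i : int) (y : Y i) :
  cone f i := (0, y).

Fact cone_in_linear (X Y : complex) (f : chain_map X Y) (i : int) : linear (@cone_in_fun X Y f i).
Proof. by move=> a x y; congr pair; rewrite /= scaler0 addr0. Qed.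

HB.instance Definition _ X Y f i :=
  GRing.isLinear.Build R _ _ _ (@cone_in_fun X Y f i) (@cone_in_linear X Y f i).

Fact cone_inP (X Y : complex) (f : chain_map X Y) (i : int) (y : Y i) :
  diff (cone f) i (@cone_in_fun X Y f i y) = cone_in_fun f (diff Y i y).
Proof. by rewrite /= /cone_diff /= !linear0 add0r. Qed.

Definition cone_in (X Y : complex) (f : chain_map X Y) : chain_map Y (cone f) :=
  @ChainMap Y (cone f) (fun i => @cone_in_fun X Y f i) (@cone_inP X Y f).

Definition cone_out_fun (X Y : complex) (f : chain_map X Y) (i : int)
  (x : cone f i) : shift 1 X i := x.1.

Fact cone_out_linear (X Y : complex) (f : chain_map X Y) (i : int) : linear (@cone_out_fun X Y f i).
Proof. by []. Qed.

HB.instance Definition _ X Y f i :=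
  GRing.isLinear.Build R _ _ _ (@cone_out_fun X Y f i) (@cone_out_linear X Y f i).

Fact cone_outP (X Y : complex) (f : chain_map X Y) (i : int) (x : cone f i) :
  diff (shift 1 X) i (cone_out_fun x) = cone_out_fun (diff (@cone X Y f) i x).
Proof.
rewrite /= /shift_diff /cone_out_fun /= expr1 scaleN1r.
by rewrite (eq_irrelevance (addrAC i 1 1) erefl).
Qed.

Definition cone_out (X Y : complex) (f : chain_map X Y) :
    chain_map (cone f) (shift 1 X) :=
  @ChainMap (cone f) (shift 1 X) (fun i => @cone_out_fun X Y f i) (@cone_outP X Y f).

(* Distinguished triangles X -> Y -> Z -> X[1]: those isomorphic, in the
   homotopy category, to the triangle of some mapping cone. *)
Definition distinguished (X Y Z : complex) (f : chain_map X Y)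
    (g : chain_map Y Z) (h : chain_map Z (shift 1 X)) : Prop :=
  exists (A B : complex) (u : chain_map A B)
         (a : chain_map X A) (b : chain_map Y B) (c : chain_map Z (cone u)),
    [/\ homotopy_equivalence a, homotopy_equivalence b & homotopy_equivalence c] /\
    [/\ homotopic (comp_map b f) (comp_map u a),
        homotopic (comp_map c g) (comp_map (cone_in u) b)
      & homotopic (comp_map (shift_map 1 a) h) (comp_map (cone_out u) c)].

Definition indecomposable (X : complex) : Prop :=
  ~ is_zero X /\
  forall A B : complex, perfect A -> perfect B ->
    hiso X (dsum A B) -> is_zero A \/ is_zero B.

Definition split_epi (W Z : complex) (f : chain_map W Z) : Prop :=
  exists s : chain_map Z W, homotopic (comp_map f s) (id_map Z).

(* There is an Auslander-Reiten triangle X -> Y -> Z -> X[1] in the homotopy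
   category of perfect complexes. *)
Definition AR_triangle (X Y Z : complex) : Prop :=
  [/\ perfect X, perfect Y, perfect Z, indecomposable X & indecomposable Z] /\
  exists (f : chain_map X Y) (g : chain_map Y Z) (h : chain_map Z (shift 1 X)),
    [/\ distinguished f g h,
        ~ @null_homotopic Z (shift 1 X) (fun i => h i)
      & forall (W : complex) (w : chain_map W Z), perfect W -> ~ split_epi w ->
          exists v : chain_map W Y, homotopic (comp_map g v) w].

(* The objects B n, up to isomorphism and shift, are the vertices of a ZA_oo
   component of the Auslander-Reiten quiver, B n being at distance n from the
   rim; the normalisation of the shifts gives irreducible maps B n -> B n.+1. *)
Definition ZAoo_component (B : nat -> complex) : Prop :=
  [/\ forall n, perfect (B n),
      forall n, indecomposable (B n),
      AR_triangle (shift (-1) (B 0%N)) (shift (-1) (B 1%N)) (B 0%N)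
    & forall n, AR_triangle (shift (-1) (B n.+1))
                            (dsum (B n) (shift (-1) (B n.+2))) (B n.+1)].

Definition distance_from_rim (C : complex) (m : nat) : Prop :=
  exists (B : nat -> complex) (j : int),
    ZAoo_component B /\ hiso C (shift j (B m)).

Definition between_rim_and (C D : complex) : Prop :=
  exists (B : nat -> complex) (m r : nat) (i j : int),
    [/\ ZAoo_component B, hiso C (shift i (B m)),
        (r <= m)%N & hiso D (shift j (B r))].

End Complexes.

(* dim_k Hom(X, Y) = n in the homotopy category: there are n chain maps whose
   classes form a k-basis of chain maps modulo homotopy. *)
Definition hom_dim (k : fieldType) (L : falgType k) (X Y : complex L) (n : nat) : Prop :=
  exists b : 'I_n -> chain_map X Y,
    forall f : chain_map X Y, exists! c : 'rV[k]_n,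
      null_homotopic (fun i (x : X i) => f i x - \sum_j (c 0 j)%:A *: b j i x).

(* Main.v *)
(* The symmetrizing form of L gives a supertrace on perfect complexes, hence a
   nondegenerate pairing of Hom(X, Y) with Hom(Y, X); it produces Auslander-Reiten
   triangles Z[-1] -> Y -> Z -> Z. Applying Hom(W, -) to such a triangle is exact
   up to a one dimensional defect when W is a shift of Z, so h(m, n, i) =
   dim Hom(B_m, B_n[i]) satisfies a mesh recursion, which writes it as a sum of the
   numbers e(i) = h(0, 0, i) - 2 [i = 0] plus constants. In particular
   h(m, m, 0) = 2 + sum_(s, t <= m) e(t - s), which is 2 exactly when e vanishes on
   [-m, m]. Moreover h(m, m, 1) > 0 for m > 0, so an object with the vanishing
   property for m > 0 is on the rim.

   That C with dim End C >= 2 lies on a ZA_oo component is shown by the function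
   u(X) = sum_i dim Hom(C, X[i]). Following in Y the indecomposable summands that
   carry the top degree of Hom(C, -) gives a ray along which u is concave and
   positive, hence nondecreasing, and this bounds the middle terms; the other
   summand is followed towards the rim, where u decreases.

   A perfect complex with dim End = 2 that decomposes has a summand A with
   End A = k. A cycle of A that is not a boundary is a nonzero map L[i] -> A, a split
   epimorphism by duality, so A is a shift of L x for an idempotent x with
   x L x = k x; the Casimir element of L turns x into a central idempotent whose
   block is semisimple. *)
From HB Require Import structures.
Require Import Defs.
From mathcomp Require Import all_boot all_order all_algebra falgebra.
From mathcomp Require Import boolp zify.

Set Implicit Arguments.
Unset Strict Implicit.
Unset Printing Implicit Defensive.

Import GRing.Theory Num.Theory Order.TTheory.
Local Open Scope ring_scope.

(** Once triangles are available the argument is linear algebra: morphism spaces of the homotopy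
    category become finite dimensional vector spaces, and of a triangle only the exactness of its
    Hom sequences is kept. The trace form serves three times. It represents a functional killing the
    nonunits of End Z by the connecting map of an Auslander-Reiten triangle, it derives the left
    almost split property from the right one, and it gives h(m, n, i) = h(n, m, -i).

    The Krull-Schmidt theorem is bypassed. Locality comes from Fitting's lemma, applied to chain
    maps and not to their classes, so that the idempotent is strict and splits degreewise; summands
    are then extracted one at a time by induction on dim End.

    The mesh relation has defect 1 at Z = W and 1 at Z = W[1], hence 2 after summation over all
    degrees. If End Z = k, the connecting map of Z would be invertible and the middle term zero; so
    the rim has dim End >= 2 and the numbers e(i) are nonnegative. That the vertices of a component
    are distinct up to shift is not part of its definition; concavity of the summed dimensions
    excludes repetitions, and boundedness excludes periods. *)

Definition mklin (R : nzRingType) (U V : lmodType R) (f : U -> V) (H : linear f) :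
  {linear U -> V} := HB.pack f (GRing.isLinear.Build R U V *:%R f H).

(** * Morphisms of the homotopy category *)

Section StrictMaps.
Variables (k : fieldType) (L : falgType k).
Implicit Types X Y Z W A B : complex L.

(** Scalars [a%:A] are central in L, so multiplying an L-linear map by one of them keeps it
    L-linear. This is the source of the k-structure on chain maps and homotopies. *)
Lemma scaleA_comm (U : lmodType L) (a : k) (b : L) (u : U) :
  a%:A *: (b *: u) = b *: (a%:A *: u).
Proof. by rewrite !scalerA mulr_algl mulr_algr. Qed.

Fact zero_map_linear X Y i : linear (fun _ : X i => 0 : Y i).
Proof. by move=> a x y; rewrite scaler0 addr0. Qed.
Definition zero_map X Y : chain_map X Y.
Proof.
exists (fun i => mklin (@zero_map_linear X Y i)) => i x /=; exact: linear0.
Defined.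

Fact add_map_linear X Y (f g : chain_map X Y) i : linear (fun x => f i x + g i x).
Proof. by move=> a x y; rewrite !linearP scalerDr addrACA. Qed.
Definition add_map X Y (f g : chain_map X Y) : chain_map X Y.
Proof.
exists (fun i => mklin (@add_map_linear X Y f g i)) => i x /=.
by rewrite linearD !cmapP.
Defined.

Fact scale_map_linear X Y (a : k) (f : chain_map X Y) i :
  linear (fun x => a%:A *: f i x).
Proof. by move=> b x y; rewrite linearP scalerDr scaleA_comm. Qed.
Definition scale_map X Y (a : k) (f : chain_map X Y) : chain_map X Y.
Proof.
exists (fun i => mklin (@scale_map_linear X Y a f i)) => i x /=.
by rewrite linearZ cmapP.
Defined.

Section NullHomotopic.
Variables X Y : complex L.
Implicit Types f g : forall i : int, X i -> Y i.

Lemma nh_ext f g : (forall i x, f i x = g i x) ->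
  null_homotopic f -> null_homotopic g.
Proof. by move=> fg [s hs]; exists s => i x; rewrite -fg hs. Qed.

Lemma nh0 : @null_homotopic _ X Y (fun i x => 0).
Proof.
have H i : linear (fun _ : X (i + 1) => 0 : Y i).
  by move=> a x y; rewrite scaler0 addr0.
by exists (fun i => mklin (H i)) => i x /=; rewrite linear0 addr0.
Qed.

Lemma nh_add f g : null_homotopic f -> null_homotopic g ->
  null_homotopic (fun i x => f i x + g i x).
Proof.
move=> [s hs] [t ht].
have H i : linear (fun x => s i x + t i x).
  by move=> a x y; rewrite !linearP scalerDr addrACA.
exists (fun i => mklin (H i)) => i x /=.
by rewrite hs ht linearD addrACA.
Qed.

Lemma nh_scale (a : k) f : null_homotopic f ->
  null_homotopic (fun i x => a%:A *: f i x).
Proof.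
move=> [s hs].
have H i : linear (fun x => a%:A *: s i x).
  by move=> b x y; rewrite linearP scalerDr scaleA_comm.
exists (fun i => mklin (H i)) => i x /=.
by rewrite hs linearZ scalerDr.
Qed.

Lemma nh_opp f : null_homotopic f -> null_homotopic (fun i x => - f i x).
Proof.
by move/(nh_scale (-1)); apply: nh_ext => i x; rewrite scaleN1r scaleNr scale1r.
Qed.
End NullHomotopic.

Lemma nh_compl X Y Z (g : chain_map Y Z) (f : forall i : int, X i -> Y i) :
  null_homotopic f -> null_homotopic (fun i x => g i (f i x)).
Proof.
move=> [s hs]; exists (fun i => g i \o s i) => i x /=.
by rewrite hs linearD cmapP.
Qed.

Lemma nh_compr X Y Z (f : chain_map X Y) (g : forall i : int, Y i -> Z i) :
  null_homotopic g -> null_homotopic (fun i x => g i (f i x)).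
Proof.
move=> [s hs]; exists (fun i => s i \o f (i + 1)) => i x /=.
by rewrite hs cmapP.
Qed.

Lemma homotopic_refl X Y (f : chain_map X Y) : homotopic f f.
Proof. by apply: nh_ext (@nh0 X Y) => i x; rewrite subrr. Qed.

Lemma homotopic_sym X Y (f g : chain_map X Y) : homotopic f g -> homotopic g f.
Proof. by move/nh_opp; apply: nh_ext => i x; rewrite opprB. Qed.

Lemma homotopic_trans X Y (f g h : chain_map X Y) :
  homotopic f g -> homotopic g h -> homotopic f h.
Proof. by move=> H /(nh_add H); apply: nh_ext => i x; rewrite addrA subrK. Qed.

Lemma homotopic_eq X Y (f g : chain_map X Y) :
  (forall i x, f i x = g i x) -> homotopic f g.
Proof. by move=> fg; apply: nh_ext (@nh0 X Y) => i x; rewrite fg subrr. Qed.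
End StrictMaps.

(* A morphism of the homotopy category is encoded by the set of chain maps in its class. *)
Record khom (k : fieldType) (L : falgType k) (X Y : complex L) := KHom {
  hom_class : chain_map X Y -> Prop;
  hom_classP : exists f, hom_class = homotopic f }.

HB.instance Definition _ k L X Y := gen_eqMixin (@khom k L X Y).
HB.instance Definition _ k L X Y := gen_choiceMixin (@khom k L X Y).

Section HomTheory.
Variables (k : fieldType) (L : falgType k).
Implicit Types X Y Z W A B : complex L.

Definition cls X Y (f : chain_map X Y) : khom X Y :=
  KHom (ex_intro _ f (erefl (homotopic f))).

Definition krep X Y (a : khom X Y) : chain_map X Y := projT1 (cid (hom_classP a)).

(** Homotopic maps have the same class as predicates, by functional and propositional
    extensionality, so homotopies become equations to rewrite with. *)
Lemma cls_eqP X Y (f g : chain_map X Y) : cls f = cls g <-> homotopic f g.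
Proof.
split=> [[->] | fg]; first exact: homotopic_refl.
have E : homotopic f = homotopic g.
  apply: funext => h; apply: propext; split; apply: homotopic_trans => //.
  exact: homotopic_sym.
rewrite /cls; move: (ex_intro _ f _) (ex_intro _ g _); rewrite E => p q.
by congr KHom; apply: Prop_irrelevance.
Qed.

Lemma krepK X Y (a : khom X Y) : cls (krep a) = a.
Proof.
rewrite /krep; case: a => c p /=; case: (cid p) => f /= E; rewrite /cls.
move: (ex_intro _ f _); rewrite -E => q; by congr KHom; apply: Prop_irrelevance.
Qed.

Lemma homW X Y (P : khom X Y -> Prop) : (forall f, P (cls f)) -> forall a, P a.
Proof. by move=> H a; rewrite -(krepK a). Qed.

Lemma repr_cls X Y (f : chain_map X Y) : homotopic (krep (cls f)) f.
Proof. by apply/cls_eqP; rewrite krepK. Qed.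

Definition add_hom X Y (a b : khom X Y) := cls (add_map (krep a) (krep b)).
Definition opp_hom X Y (a : khom X Y) := cls (scale_map (-1) (krep a)).
Definition scale_hom X Y (c : k) (a : khom X Y) := cls (scale_map c (krep a)).
Definition zero_hom X Y : khom X Y := cls (zero_map X Y).

Lemma add_homE X Y (f g : chain_map X Y) : add_hom (cls f) (cls g) = cls (add_map f g).
Proof.
apply/cls_eqP; move: (nh_add (repr_cls f) (repr_cls g)).
by apply: nh_ext => i x /=; rewrite opprD addrACA.
Qed.

Lemma scale_homE X Y c (f : chain_map X Y) : scale_hom c (cls f) = cls (scale_map c f).
Proof.
apply/cls_eqP; move: (nh_scale c (repr_cls f)).
by apply: nh_ext => i x /=; rewrite scalerBr.
Qed.

Lemma opp_homE X Y (f : chain_map X Y) : opp_hom (cls f) = cls (scale_map (-1) f).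
Proof. exact: scale_homE. Qed.

Lemma clsE X Y (f g : chain_map X Y) : (forall i x, f i x = g i x) -> cls f = cls g.
Proof. by move=> fg; apply/cls_eqP/homotopic_eq. Qed.

Fact add_homA X Y : associative (@add_hom X Y).
Proof.
elim/homW=> f; elim/homW=> g; elim/homW=> h; rewrite !add_homE.
by apply: clsE => i x /=; rewrite addrA.
Qed.
Fact add_homC X Y : commutative (@add_hom X Y).
Proof.
elim/homW=> f; elim/homW=> g; rewrite !add_homE.
by apply: clsE => i x /=; rewrite addrC.
Qed.
Fact add_hom0 X Y : left_id (zero_hom X Y) (@add_hom X Y).
Proof. by elim/homW=> f; rewrite add_homE; apply: clsE => i x /=; rewrite add0r. Qed.
Fact add_homN X Y : left_inverse (zero_hom X Y) (@opp_hom X Y) (@add_hom X Y).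
Proof.
elim/homW=> f; rewrite opp_homE add_homE; apply: clsE => i x /=.
by rewrite scaleNr !scale1r scaleNr scale1r addNr.
Qed.

HB.instance Definition _ X Y := GRing.isZmodule.Build (khom X Y)
  (@add_homA X Y) (@add_homC X Y) (@add_hom0 X Y) (@add_homN X Y).

Fact scale_homA X Y a b (f : khom X Y) : scale_hom a (scale_hom b f) = scale_hom (a * b) f.
Proof.
elim/homW: f => f; rewrite !scale_homE; apply: clsE => i x /=.
by rewrite scalerA mulr_algl scalerA.
Qed.
Fact scale_hom1 X Y : left_id 1 (@scale_hom X Y).
Proof. by elim/homW=> f; rewrite scale_homE; apply: clsE => i x /=; rewrite !scale1r. Qed.
Fact scale_homDr X Y : right_distributive (@scale_hom X Y) +%R.
Proof.
move=> c; elim/homW=> f; elim/homW=> g.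
rewrite -[cls f + cls g]/(add_hom _ _) -[RHS]/(add_hom _ _).
rewrite add_homE !scale_homE add_homE.
by apply: clsE => i x /=; rewrite scalerDr.
Qed.
Fact scale_homDl X Y (f : khom X Y) : {morph (@scale_hom X Y)^~ f : a b / a + b}.
Proof.
move=> a b; elim/homW: f => f.
rewrite -[RHS]/(add_hom _ _) !scale_homE add_homE.
by apply: clsE => i x /=; rewrite scalerDl scalerDl.
Qed.
HB.instance Definition _ X Y := GRing.Zmodule_isLmodule.Build k (khom X Y)
  (@scale_homA X Y) (@scale_hom1 X Y) (@scale_homDr X Y) (@scale_homDl X Y).

Lemma clsD X Y (f g : chain_map X Y) : cls f + cls g = cls (add_map f g).
Proof. exact: add_homE. Qed.
Lemma clsZ X Y c (f : chain_map X Y) : c *: cls f = cls (scale_map c f).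
Proof. exact: scale_homE. Qed.
Lemma cls_eq0 X Y (f : chain_map X Y) : cls f = 0 <-> null_homotopic (fun i x => f i x).
Proof.
rewrite -[0]/(cls (zero_map X Y)); split=> [/cls_eqP|H].
  by apply: nh_ext => i x /=; rewrite subr0.
by apply/cls_eqP; apply: nh_ext H => i x /=; rewrite subr0.
Qed.

Definition hcomp X Y Z (b : khom Y Z) (a : khom X Y) : khom X Z :=
  cls (comp_map (krep b) (krep a)).
Notation "b \c a" := (hcomp b a) (at level 40, left associativity).
Definition id_hom X : khom X X := cls (id_map X).

Lemma hcompE X Y Z (g : chain_map Y Z) (f : chain_map X Y) :
  cls g \c cls f = cls (comp_map g f).
Proof.
apply/cls_eqP.
have H1 : homotopic (comp_map (krep (cls g)) (krep (cls f)))
                    (comp_map g (krep (cls f))).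
  exact: (nh_compr (krep (cls f)) (repr_cls g)).
apply: homotopic_trans H1 _.
apply: nh_ext (nh_compl g (repr_cls f)) => i x /=; exact: linearB.
Qed.

Lemma hcompA X Y Z W (c : khom Z W) (b : khom Y Z) (a : khom X Y) :
  c \c (b \c a) = c \c b \c a.
Proof.
elim/homW: a => a; elim/homW: b => b; elim/homW: c => c.
by rewrite !hcompE; apply: clsE.
Qed.
Lemma hcomp1l X Y (a : khom X Y) : id_hom Y \c a = a.
Proof. by elim/homW: a => a; rewrite hcompE; apply: clsE. Qed.
Lemma hcomp1r X Y (a : khom X Y) : a \c id_hom X = a.
Proof. by elim/homW: a => a; rewrite hcompE; apply: clsE. Qed.

Fact hcomp_linear X Y Z (b : khom Y Z) : linear (@hcomp X Y Z b).
Proof.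
move=> c; elim/homW=> f; elim/homW=> g; elim/homW: b => b.
rewrite clsZ clsD !hcompE clsZ clsD; apply: clsE => i x /=.
by rewrite linearD linearZ.
Qed.
HB.instance Definition _ X Y Z b :=
  GRing.isLinear.Build k _ _ _ (@hcomp X Y Z b) (@hcomp_linear X Y Z b).

Definition hcompr X Y Z (a : khom X Y) (b : khom Y Z) := b \c a.
Fact hcompr_linear X Y Z (a : khom X Y) : linear (@hcompr X Y Z a).
Proof.
move=> c; elim/homW=> f; elim/homW=> g; elim/homW: a => a.
rewrite /hcompr clsZ clsD !hcompE clsZ clsD; exact: clsE.
Qed.
HB.instance Definition _ X Y Z a :=
  GRing.isLinear.Build k _ _ _ (@hcompr X Y Z a) (@hcompr_linear X Y Z a).

Lemma hcompDl X Y Z (b c : khom Y Z) (a : khom X Y) : (b + c) \c a = b \c a + c \c a.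
Proof. exact: (linearD (hcompr a)). Qed.
Lemma hcompDr X Y Z (c : khom Y Z) (a b : khom X Y) : c \c (a + b) = c \c a + c \c b.
Proof. exact: linearD. Qed.
Lemma hcompBl X Y Z (b c : khom Y Z) (a : khom X Y) : (b - c) \c a = b \c a - c \c a.
Proof. exact: (linearB (hcompr a)). Qed.
Lemma hcompBr X Y Z (c : khom Y Z) (a b : khom X Y) : c \c (a - b) = c \c a - c \c b.
Proof. exact: linearB. Qed.
Lemma hcomp0l X Y Z (a : khom X Y) : (0 : khom Y Z) \c a = 0.
Proof. exact: (linear0 (hcompr a)). Qed.
Lemma hcomp0r X Y Z (c : khom Y Z) : c \c (0 : khom X Y) = 0.
Proof. exact: linear0. Qed.
Lemma hcompZl X Y Z t (b : khom Y Z) (a : khom X Y) : (t *: b) \c a = t *: (b \c a).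
Proof. exact: (linearZZ (hcompr a)). Qed.
Lemma hcompZr X Y Z t (c : khom Y Z) (a : khom X Y) : c \c (t *: a) = t *: (c \c a).
Proof. exact: linearZZ. Qed.

Definition kiso X Y (a : khom X Y) := exists b, b \c a = id_hom X /\ a \c b = id_hom Y.
Definition iso X Y := exists a : khom X Y, kiso a.
Definition sepi X Y (a : khom X Y) := exists b, a \c b = id_hom Y.
Definition smono X Y (a : khom X Y) := exists b, b \c a = id_hom X.

Lemma homotopy_equivalenceE X Y (f : chain_map X Y) :
  homotopy_equivalence f <-> kiso (cls f).
Proof.
split=> [[g [h1 h2]]|[b]].
  by exists (cls g); rewrite !hcompE; split; apply/cls_eqP.
by elim/homW: b => g []; rewrite !hcompE => /cls_eqP ? /cls_eqP ?; exists g.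
Qed.

Lemma hisoE X Y : hiso X Y <-> iso X Y.
Proof.
split=> [[f /homotopy_equivalenceE fP]|[a]]; first by exists (cls f).
by elim/homW: a => f /homotopy_equivalenceE; exists f.
Qed.

Lemma split_epiE X Y (f : chain_map X Y) : split_epi f <-> sepi (cls f).
Proof.
split=> [[g h]|[b]]; first by exists (cls g); rewrite !hcompE; apply/cls_eqP.
by elim/homW: b => g; rewrite !hcompE => /cls_eqP ?; exists g.
Qed.

Lemma is_zeroE X : is_zero X <-> id_hom X = 0.
Proof. by rewrite cls_eq0. Qed.

Lemma iso_refl X : iso X X.
Proof. by exists (id_hom X), (id_hom X); rewrite hcomp1l. Qed.
Lemma iso_sym X Y : iso X Y -> iso Y X.
Proof. by move=> [a [b [? ?]]]; exists b, a. Qed.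

Lemma kiso_comp X Y Z (b : khom Y Z) (a : khom X Y) : kiso b -> kiso a -> kiso (b \c a).
Proof.
move=> [b' [h1 h2]] [a' [h3 h4]]; exists (a' \c b'); split.
  by rewrite -hcompA (hcompA b') h1 hcomp1l.
by rewrite -hcompA (hcompA a) h4 hcomp1l.
Qed.
Lemma iso_trans X Y Z : iso X Y -> iso Y Z -> iso X Z.
Proof. by move=> [a aP] [b bP]; exists (b \c a); apply: kiso_comp. Qed.

(** A biproduct decomposition given by structure maps and equations instead of an isomorphism with
    [dsum]: it is carried along isomorphisms and shifts by computation alone. *)
Definition bip X A B := exists (iA : khom A X) (iB : khom B X) (pA : khom X A) (pB : khom X B),
  [/\ pA \c iA = id_hom A, pB \c iB = id_hom B, pA \c iB = 0, pB \c iA = 0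
    & iA \c pA + iB \c pB = id_hom X].

Lemma bip_isoX X X' A B : iso X X' -> bip X A B -> bip X' A B.
Proof.
move=> [a [b [ba ab]]] [iA [iB [pA [pB [h1 h2 h3 h4 h5]]]]].
exists (a \c iA), (a \c iB), (pA \c b), (pB \c b).
split; rewrite -?hcompA ?(hcompA b) ?ba ?hcomp1l //.
by rewrite !hcompA -hcompDl -!hcompA -hcompDr h5 hcomp1r.
Qed.

Lemma bip_isol X A A' B : iso A A' -> bip X A B -> bip X A' B.
Proof.
move=> [a [b [ba ab]]] [iA [iB [pA [pB [h1 h2 h3 h4 h5]]]]].
exists (iA \c b), iB, (a \c pA), pB; split=> //.
- by rewrite -hcompA (hcompA pA) h1 hcomp1l.
- by rewrite -hcompA h3 hcomp0r.
- by rewrite hcompA h4 hcomp0l.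
by rewrite -hcompA (hcompA b) ba hcomp1l.
Qed.

Lemma bip_sym X A B : bip X A B -> bip X B A.
Proof.
move=> [iA [iB [pA [pB [h1 h2 h3 h4 h5]]]]]; exists iB, iA, pB, pA.
by split=> //; rewrite addrC.
Qed.

Lemma bip_uniq X X' A B : bip X A B -> bip X' A B -> iso X X'.
Proof.
move=> [i1 [i2 [p1 [p2 [h1 h2 h3 h4 h5]]]]] [j1 [j2 [q1 [q2 [g1 g2 g3 g4 g5]]]]].
exists (j1 \c p1 + j2 \c p2), (i1 \c q1 + i2 \c q2).
split; rewrite !hcompDl !hcompDr -!hcompA.
  rewrite (hcompA q1 j1) (hcompA q1 j2) (hcompA q2 j1) (hcompA q2 j2).
  by rewrite g1 g2 g3 g4 !hcomp0l !hcomp0r !hcomp1l addr0 add0r.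
rewrite (hcompA p1 i1) (hcompA p1 i2) (hcompA p2 i1) (hcompA p2 i2).
by rewrite h1 h2 h3 h4 !hcomp0l !hcomp0r !hcomp1l addr0 add0r.
Qed.

Fact inl_linear A B i : linear (fun x : A i => (x, 0) : dsum A B i).
Proof. by move=> a x y; congr pair; rewrite /= ?scaler0 ?addr0. Qed.
Definition inl_map A B : chain_map A (dsum A B).
Proof.
exists (fun i => mklin (@inl_linear A B i)) => i x /=; by rewrite /dsum_diff /= linear0.
Defined.
Fact inr_linear A B i : linear (fun x : B i => (0, x) : dsum A B i).
Proof. by move=> a x y; congr pair; rewrite /= ?scaler0 ?addr0. Qed.
Definition inr_map A B : chain_map B (dsum A B).
Proof.
exists (fun i => mklin (@inr_linear A B i)) => i x /=; by rewrite /dsum_diff /= linear0.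
Defined.
Fact fst_linear A B i : linear (fun x : dsum A B i => x.1).
Proof. by []. Qed.
Definition fst_map A B : chain_map (dsum A B) A :=
  @ChainMap _ (dsum A B) A (fun i => mklin (@fst_linear A B i)) (fun i x => erefl).
Fact snd_linear A B i : linear (fun x : dsum A B i => x.2).
Proof. by []. Qed.
Definition snd_map A B : chain_map (dsum A B) B :=
  @ChainMap _ (dsum A B) B (fun i => mklin (@snd_linear A B i)) (fun i x => erefl).

Lemma bip_dsum A B : bip (dsum A B) A B.
Proof.
exists (cls (inl_map A B)), (cls (inr_map A B)), (cls (fst_map A B)), (cls (snd_map A B)).
rewrite !hcompE clsD; split.
- exact: clsE.
- exact: clsE.
- by apply: (@clsE _ _ _ (zero_map _ _)).
- by apply: (@clsE _ _ _ (zero_map _ _)).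
by apply: clsE => i [x y]; congr pair; rewrite /= ?addr0 ?add0r.
Qed.

Lemma bipE X A B : bip X A B <-> iso X (dsum A B).
Proof.
split=> [H|H]; first exact: bip_uniq H (bip_dsum A B).
by apply: bip_isoX (bip_dsum A B); apply: iso_sym.
Qed.

Lemma iso_zero X Y : iso X Y -> id_hom X = 0 -> id_hom Y = 0.
Proof. by move=> [a [b [_ ab]]] X0; rewrite -ab -(hcomp1r a) X0 hcomp0r hcomp0l. Qed.

Lemma bip_zero X A B : bip X A B -> id_hom B = 0 -> iso X A.
Proof.
move=> [iA [iB [pA [pB [h1 h2 h3 h4 h5]]]]] B0; exists pA, iA; split=> //.
by rewrite -[RHS]h5 -(hcomp1r iB) B0 hcomp0r hcomp0l addr0.
Qed.
End HomTheory.
Notation "b \c a" := (hcomp b a) (at level 40, left associativity).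

(** * The shift functor *)

Section Transport.
Variable R : nzRingType.
Implicit Types X Y : complex R.

Lemma tp_id X i (e : i = i) (x : X i) : transport e x = x.
Proof. by rewrite (eq_irrelevance e erefl). Qed.

Lemma tp_comp X i j l (e1 : i = j) (e2 : j = l) (x : X i) :
  transport e2 (transport e1 x) = transport (etrans e1 e2) x.
Proof. by case: l / e2. Qed.

Lemma tp_irr X i j (e1 e2 : i = j) (x : X i) : transport e1 x = transport e2 x.
Proof. by rewrite (eq_irrelevance e1 e2). Qed.

Lemma tpK X i j (e1 : i = j) (e2 : j = i) (x : X i) : transport e2 (transport e1 x) = x.
Proof. by rewrite tp_comp tp_id. Qed.

Lemma tpZ X i j (e : i = j) a (x : X i) : transport e (a *: x) = a *: transport e x.
Proof. by case: j / e. Qed.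

Lemma tpD X i j (e : i = j) (x y : X i) : transport e (x + y) = transport e x + transport e y.
Proof. by case: j / e. Qed.

Lemma tp_inj X i j (e : i = j) : injective (@transport R X i j e).
Proof. by case: j / e. Qed.

Lemma fam_tp X Y (F : forall i, X i -> Y i) i j (e : i = j) (x : X i) :
  F j (transport e x) = transport e (F i x).
Proof. by case: j / e. Qed.

Lemma homotopy_tp X Y (s : forall i, {linear X (i + 1) -> Y i}) i j (e : i = j)
    (e1 : i + 1 = j + 1) (x : X (i + 1)) :
  s j (transport e1 x) = transport e (s i x).
Proof. by case: j / e e1 => e1; rewrite !tp_id. Qed.

Lemma tp_shift X n i j (e : i = j) (e1 : i + n = j + n) (x : shift n X i) :
  @transport R (shift n X) i j e x = @transport R X (i + n) (j + n) e1 x.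
Proof. by case: j / e e1 => e1; rewrite [RHS]tp_id. Qed.

(** Every degree has the form i + n; checking an identity there lets the transports along
    [i - n + n = i] cancel. *)
Lemma deg_shift n (P : int -> Prop) : (forall i, P (i + n)) -> forall i, P i.
Proof. by move=> H i; rewrite -(subrK n i). Qed.

Lemma sgn_shift (n m : int) :
  (-1) ^+ `|n|%N * (-1) ^+ `|m|%N = (-1) ^+ `|(n + m)%R|%N :> R.
Proof.
rewrite -signr_odd -[X in _ * X]signr_odd -[RHS]signr_odd -signr_addb.
congr (_ ^+ nat_of_bool _).
lia.
Qed.

Lemma sgnS (n : int) : (-1) ^+ `|(n + 1)%R|%N = - (-1) ^+ `|n|%N :> R.
Proof. by rewrite -sgn_shift expr1 mulrN1. Qed.

Lemma sgnK (n : int) : (-1) ^+ `|n|%N * (-1) ^+ `|n|%N = 1 :> R.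
Proof. by rewrite -expr2 sqrr_sign. Qed.

Definition tplin X i j (e : i = j) : {linear X i -> X j} := @transport R X i j e.
End Transport.

Section Shift.
Variables (k : fieldType) (L : falgType k).
Implicit Types X Y Z W A B : complex L.

Fact unshift_linear n X Y (g : chain_map (shift n X) (shift n Y)) i :
  linear (fun x : X i => transport (subrK n i) (g (i - n) (transport (esym (subrK n i)) x)) : Y i).
Proof. by move=> a x y; rewrite !linearP. Qed.

Lemma unshiftE n X Y (g : forall i, X (i + n) -> Y (i + n)) j (x : X (j + n)) :
  transport (subrK n (j + n)) (g (j + n - n) (transport (esym (subrK n (j + n))) x)) = g j x.
Proof.
move: (subrK n (j + n)); have : j = j + n - n by rewrite addrK.
by move: (j + n - n) => i e; case: i / e => e; rewrite !tp_id.
Qed.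

Fact unshiftP n X Y (g : chain_map (shift n X) (shift n Y)) i (x : X i) :
  diff Y i (mklin (@unshift_linear n X Y g i) x)
  = mklin (@unshift_linear n X Y g (i + 1)) (diff X i x).
Proof.
pose F i (x : X i) := mklin (@unshift_linear n X Y g i) x.
rewrite -[LHS]/(diff Y i (F i x)) -[RHS]/(F (i + 1) (diff X i x)).
have FE j (y : X (j + n)) : F (j + n) y = g j y by exact: (@unshiftE n X Y (fun i => g i)).
move: i x; apply: (@deg_shift n) => j x; rewrite FE.
apply: (@tp_inj _ Y _ _ (addrAC j n 1)); rewrite -(fam_tp F) FE.
have := cmapP g x; rewrite /= /shift_diff [RHS]linearZ_LR /=.
move/(congr1 ( *:%R ((-1) ^+ `|n|%N))).
by rewrite !scalerA sgnK !scale1r.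
Qed.

Definition unshift n X Y (g : chain_map (shift n X) (shift n Y)) : chain_map X Y :=
  @ChainMap _ X Y (fun i => mklin (@unshift_linear n X Y g i)) (@unshiftP n X Y g).

(** The differentials of both shifts carry the sign (-1)^n, so the homotopy is given the same sign
    and the products of signs are 1. *)
Lemma nh_shift n X Y (f : forall i : int, X i -> Y i) :
  null_homotopic f -> @null_homotopic _ (shift n X) (shift n Y) (fun i => f (i + n)).
Proof.
move=> [s hs].
have e1 (i : int) : i + 1 + n = i + n + 1 by rewrite addrAC.
have H i : linear (fun x : X (i + 1 + n) => (-1) ^+ `|n|%N *: s (i + n) (transport (e1 i) x)).
  by move=> a x y; rewrite !linearP scalerDr !scalerA (commr_sign a).
exists (fun i => mklin (H i)) => i x /=; rewrite /shift_diff /=.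
rewrite [diff Y _ _]linearZ tpZ scalerA sgnK scale1r.
rewrite tpZ [s _ (_ *: _)]linearZ_LR scalerA sgnK scale1r.
apply: (@tp_inj _ Y _ _ (e1 i)).
rewrite linearD /= tpK -(fam_tp f) hs; congr (_ + _).
rewrite tp_comp -(homotopy_tp s _ (congr1 (+%R^~ 1) (e1 i))) tp_comp.
by rewrite (diff_transport _ (congr1 (+%R^~ 1) (e1 i))); congr (s _ _); apply: tp_irr.
Qed.

Lemma nh_unshift n X Y (f : forall i : int, X i -> Y i) :
  @null_homotopic _ (shift n X) (shift n Y) (fun i => f (i + n)) -> null_homotopic f.
Proof.
move=> [s hs].
have e1 (i : int) : i + 1 = i - n + 1 + n by rewrite addrAC subrK.
have H i : linear (fun x : X (i + 1) =>
    (-1) ^+ `|n|%N *: transport (subrK n i) (s (i - n) (transport (e1 i) x))).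
  by move=> a x y; rewrite !linearP scalerDr !scalerA (commr_sign a).
pose t i : {linear X (i + 1) -> Y i} := mklin (H i).
have tE i (x : X (i + n + 1)) (e : i + n + 1 = i + 1 + n) :
    t (i + n) x = (-1) ^+ `|n|%N *: s i (transport e x).
  rewrite /t /=; congr (_ *: _).
  move: (subrK n (i + n)) (e1 (i + n)); have : i = i + n - n by rewrite addrK.
  move: (i + n - n) => j e2; case: j / e2 => e2 e3.
  by rewrite tp_id; congr (s _ _); apply: (@tp_irr _ X).
exists t; apply: (@deg_shift n) => i x.
have e : i + n + 1 = i + 1 + n by rewrite addrAC.
rewrite (tE _ _ e) linearZ_LR.
apply: (@tp_inj _ Y _ _ e); rewrite -(fam_tp f) hs tpD; congr (_ + _).
  by rewrite /= /shift_diff tpZ; congr (_ *: _); apply: tp_irr.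
have ee := congr1 (+%R^~ 1) e.
rewrite -(homotopy_tp t e ee) (tE _ _ (addrAC _ _ _)) /= /shift_diff.
rewrite linearZ_LR /=; congr (_ *: s _ _).
by rewrite (diff_transport e ee).
Qed.

Definition Sh n X Y (a : khom X Y) : khom (shift n X) (shift n Y) :=
  cls (shift_map n (krep a)).

Lemma ShE n X Y (f : chain_map X Y) : Sh n (cls f) = cls (shift_map n f).
Proof.
apply/cls_eqP; exact: (nh_shift n (repr_cls f)).
Qed.

Fact Sh_linear n X Y : linear (@Sh n X Y).
Proof.
move=> c; elim/homW=> f; elim/homW=> g.
by rewrite clsZ clsD !ShE clsZ clsD; apply: clsE.
Qed.
HB.instance Definition _ n X Y :=
  GRing.isLinear.Build k _ _ _ (@Sh n X Y) (@Sh_linear n X Y).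

Lemma Sh_inj n X Y : injective (@Sh n X Y).
Proof.
move=> a b /eqP; rewrite -subr_eq0 -linearB => /eqP.
suff H (c : khom X Y) : Sh n c = 0 -> c = 0 by move/H/eqP; rewrite subr_eq0 => /eqP.
by elim/homW: c => f; rewrite ShE => /cls_eq0/(@nh_unshift n X Y (fun i => f i))/cls_eq0.
Qed.

Lemma Sh_surj n X Y (b : khom (shift n X) (shift n Y)) : exists a, Sh n a = b.
Proof.
elim/homW: b => g; exists (cls (unshift g)); rewrite ShE.
by apply: clsE => i x; apply: (@unshiftE n X Y (fun i => g i)).
Qed.

Lemma Sh_comp n X Y Z (b : khom Y Z) (a : khom X Y) : Sh n (b \c a) = Sh n b \c Sh n a.
Proof.
elim/homW: a => f; elim/homW: b => g; by rewrite (hcompE g f) (ShE n g) (ShE n f) (ShE n (comp_map g f)) hcompE; apply: clsE.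
Qed.
Lemma Sh_id n X : Sh n (id_hom X) = id_hom (shift n X).
Proof. by rewrite ShE; apply: clsE. Qed.

Lemma iso_shift n X Y : iso X Y -> iso (shift n X) (shift n Y).
Proof.
by move=> [a [b [ba ab]]]; exists (Sh n a), (Sh n b); rewrite -!Sh_comp ba ab !Sh_id.
Qed.

Lemma bip_shift n X A B : bip X A B -> bip (shift n X) (shift n A) (shift n B).
Proof.
move=> [iA [iB [pA [pB [h1 h2 h3 h4 h5]]]]].
exists (Sh n iA), (Sh n iB), (Sh n pA), (Sh n pB).
split; rewrite -!Sh_comp.
- by rewrite h1 Sh_id.
- by rewrite h2 Sh_id.
- by rewrite h3 linear0.
- by rewrite h4 linear0.
by rewrite -(linearD (@Sh n X X)) h5 /= Sh_id.
Qed.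

Lemma zero_shift n X : id_hom X = 0 -> id_hom (shift n X) = 0.
Proof. by rewrite -Sh_id => ->; rewrite linear0. Qed.

Lemma unzero_shift n X : id_hom (shift n X) = 0 -> id_hom X = 0.
Proof. by rewrite -Sh_id => H; apply: (@Sh_inj n X X); rewrite H linear0. Qed.

Lemma iso_transport X Y (F : forall i, {linear X i -> Y i}) (G : forall i, {linear Y i -> X i}) :
  (forall i x, diff Y i (F i x) = F (i + 1) (diff X i x)) ->
  (forall i x, G i (F i x) = x) -> (forall i y, F i (G i y) = y) -> iso X Y.
Proof.
move=> HF FK GK; have HG i x : diff X i (G i x) = G (i + 1) (diff Y i x).
  by rewrite -{2}(GK i x) HF FK.
exists (cls (ChainMap HF)), (cls (ChainMap HG)); rewrite !hcompE.
by split; apply: clsE => i x /=; [exact: FK | exact: GK].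
Qed.

Lemma shift_shift i j X : iso (shift i (shift j X)) (shift (i + j) X).
Proof.
have e (l : int) : l + i + j = l + (i + j) by rewrite addrA.
apply: (@iso_transport (shift i (shift j X)) (shift (i + j) X) (fun l => @tplin _ X _ _ (e l))
  (fun l => @tplin _ X _ _ (esym (e l)))) => l x; [|exact: (@tpK _ X)|exact: (@tpK _ X)].
rewrite /= /shift_diff (tp_shift _ (congr1 (+%R^~ j) (addrAC _ _ _))).
rewrite -[diff (shift j X) (l + i) x]/((-1) ^+ `|j|%N *: transport (addrAC (l + i) j 1) (diff X (l + i + j) x)).
rewrite !(@tpZ _ X) scalerA sgn_shift !(@tp_comp _ X); congr (_ *: _).
rewrite (diff_transport _ (congr1 (+%R^~ 1) (e l))) (@tp_comp _ X); exact: (@tp_irr _ X).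
Qed.

Lemma shift0 X : iso (shift 0 X) X.
Proof.
apply: (@iso_transport (shift 0 X) X (fun l => @tplin _ X _ _ (addr0 l))
  (fun l => @tplin _ X _ _ (esym (addr0 l)))) => l x; [|exact: (@tpK _ X)|exact: (@tpK _ X)].
rewrite /= /shift_diff expr0 scale1r.
rewrite (diff_transport _ (congr1 (+%R^~ 1) (addr0 l))) (@tp_comp _ X); exact: (@tp_irr _ X).
Qed.

Lemma shiftK i j X : i + j = 0 -> iso (shift i (shift j X)) X.
Proof.
move=> ij; apply: iso_trans (shift_shift _ _ _) _; rewrite ij; exact: shift0.
Qed.
End Shift.

Lemma eq_opp_add (V : zmodType) (a b : V) : 0 = - a + b -> a = b.
Proof. by move/(congr1 (+%R a)); rewrite addr0 addrA subrr add0r. Qed.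
Lemma add3_subl (V : zmodType) (a b c : V) : a + b + c - a = b + c.
Proof. by rewrite -addrA addrC addrA subrK addrC. Qed.

Lemma sub_oppD (V : zmodType) (a b c : V) : a - (- b + (a - c)) = b + c.
Proof. by rewrite opprD opprK opprB addrCA addrC [a + _]addrC subrK addrC. Qed.

Lemma sub_sub_sub (V : zmodType) (a b c : V) : a - b = c - (b + (c - a)).
Proof. by rewrite opprD opprB addrCA (addrC c) subrK [RHS]addrC. Qed.

(** * Exact sequences of a triangle *)

Section Low.
Variables (R : nzRingType) (P Q : int -> lmodType R).
(* The index shift that turns the degrees [i + 1] into all degrees. *)
Definition low (s : forall i : int, {linear P (i + 1) -> Q (i + 1)}) i : {linear P i -> Q i} :=
  ecast j {linear P j -> Q j} (subrK 1 i) (s (i - 1)).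
Lemma lowE s i : low s (i + 1) = s i.
Proof.
rewrite /low; move: (subrK 1 (i + 1)); have : i = i + 1 - 1 by rewrite addrK.
by move: (i + 1 - 1) => j e; case: j / e => e; rewrite (eq_irrelevance e erefl).
Qed.
End Low.

Section Exactness.
Variables (k : fieldType) (L : falgType k).
Implicit Types X Y Z W A B V : complex L.

Lemma shift1_diff X i (x : shift 1 X i) : diff (shift 1 X) i x = - diff X (i + 1) x.
Proof. by rewrite /= /shift_diff expr1 scaleN1r tp_id. Qed.

(** Here and in the next four lemmas the given null homotopy is read componentwise: its parts are
    the chain map sought, a missing component of it, or the homotopy proving the equation. In this
    one a homotopy into A[1] is a degree zero family [t : W -> A], along which f is deformed until
    its first component vanishes. *)
Lemma cone_ex1 W A B (u : chain_map A B) (f : khom W (cone u)) :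
  cls (cone_out u) \c f = 0 -> exists g, f = cls (cone_in u) \c g.
Proof.
elim/homW: f => f; rewrite hcompE => /cls_eq0 [s hs].
pose t := @low _ W A s.
have ht i (w : W i) : (f i w).1 = t (i + 1) (diff W i w) - diff A i (t i w).
  move: i w; apply: (@deg_shift 1) => i w.
  by rewrite /t !lowE [RHS]addrC -shift1_diff; apply: hs.
have fP i (w : W i) : diff (cone u) i (f i w) = f (i + 1) (diff W i w) by exact: cmapP.
have H i : linear (fun w : W i => (f i w).2 - u i (t i w)).
  by move=> a x y; rewrite !linearP /= scalerDr addrACA.
have HP i (w : W i) : diff B i (mklin (H i) w) = mklin (H (i + 1)) (diff W i w).
  rewrite /= linearB cmapP -(fP i w) /= (ht i w) linearB.
  by rewrite -[RHS]addrA [RHS]addrC addrA subrK.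
exists (cls (ChainMap HP)); rewrite hcompE; apply/cls_eqP/homotopic_sym.
have H2 i : linear (fun w : W (i + 1) => (- t (i + 1) w, 0) : cone u i).
  by move=> a x y; rewrite linearP; congr pair; rewrite /= ?scaler0 ?addr0 // opprD scalerN.
exists (fun i => mklin (H2 i)) => i w; rewrite /= /cone_diff /=.
congr pair => /=; first by rewrite ht linearN !opprK sub0r opprB.
by rewrite !linearN linear0 !addr0 [LHS]addrC addKr.
Qed.

Lemma cone_ex2 W A B (u : chain_map A B) (f : khom W B) :
  cls (cone_in u) \c f = 0 -> exists g, f = cls u \c g.
Proof.
elim/homW: f => f; rewrite hcompE => /cls_eq0 [s hs].
have H1 i : linear (fun w : W (i + 1) => (s i w).1) by move=> a x y; rewrite linearP.
have H2 i : linear (fun w : W (i + 1) => (s i w).2) by move=> a x y; rewrite linearP.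
pose t := @low _ W A (fun i => mklin (H1 i)).
have tP i (w : W i) : diff A i (t i w) = t (i + 1) (diff W i w).
  move: i w; apply: (@deg_shift 1) => i w; rewrite /t !lowE.
  by have [/eq_opp_add] := hs i w.
exists (cls (ChainMap tP)); rewrite hcompE; apply/cls_eqP.
exists (fun i => mklin (H2 i)) => i w; rewrite /= /t lowE.
by have [_ /= ->] := hs i w; rewrite add3_subl.
Qed.

Lemma cone_ex3 W A B (u : chain_map A B) (f : khom W A) :
  cls u \c f = 0 -> exists g, Sh 1 f = cls (cone_out u) \c g.
Proof.
elim/homW: f => f; rewrite hcompE => /cls_eq0 [s hs].
have H i : linear (fun w : shift 1 W i => (f (i + 1) w, - s i w) : cone u i).
  by move=> a x y; rewrite !linearP; congr pair; rewrite /= opprD scalerN.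
have HP i (w : shift 1 W i) :
    diff (cone u) i (mklin (H i) w) = mklin (H (i + 1)) (diff (shift 1 W) i w).
  rewrite shift1_diff /= /cone_diff /= cmapP; congr pair; first by rewrite linearN.
  by have /= -> := hs i w; rewrite !linearN opprK [LHS]addrC addKr.
by exists (cls (ChainMap HP)); rewrite hcompE ShE; apply: clsE.
Qed.

Lemma cone_coex1 V A B (u : chain_map A B) (f : khom B V) :
  f \c cls u = 0 -> exists g, f = g \c cls (cone_in u).
Proof.
elim/homW: f => f; rewrite hcompE => /cls_eq0 [s hs].
have H i : linear (fun w : cone u i => f i w.2 + s i w.1).
  by move=> a x y; rewrite /= !linearP scalerDr addrACA.
have HP i (w : cone u i) : diff V i (mklin (H i) w) = mklin (H (i + 1)) (diff (cone u) i w).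
  rewrite /= /cone_diff /= !linearD !cmapP; have /= -> := hs i w.1.
  by rewrite linearN addrAC addrK addrC.
exists (cls (ChainMap HP)); rewrite hcompE; apply: clsE => i x /=.
by rewrite linear0 addr0.
Qed.

Lemma cone_coex3 V A B (u : chain_map A B) (f : khom A V) :
  Sh 1 f \c cls (cone_out u) = 0 -> exists g, f = g \c cls u.
Proof.
elim/homW: f => f; rewrite ShE hcompE => /cls_eq0 [s hs].
have H1 i : linear (fun b : B (i + 1) => s i ((0, b) : cone u (i + 1)) : V (i + 1)).
  move=> a x y; rewrite -linearP; congr (s i (_, _)).
  by rewrite /= scaler0 addr0.
have H2 i : linear (fun a : A (i + 1 + 1) => s i ((a, 0) : cone u (i + 1)) : V (i + 1)).
  move=> a x y; rewrite -linearP; congr (s i (_, _)).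
  by rewrite /= scaler0 addr0.
pose t := @low _ B V (fun i => mklin (H1 i)).
pose r := @low _ (fun i => A (i + 1)) V (fun i => mklin (H2 i)).
have hs1 i (b : B (i + 1)) : diff V (i + 1) (s i (0, b)) = s (i + 1) (0, diff B (i + 1) b).
  have := hs i (0, b); rewrite shift1_diff /= /cone_diff /= !linear0 ?oppr0 ?add0r.
  by move/eq_opp_add.
have hs2 i (a : A (i + 1 + 1)) :
    f (i + 1 + 1) a = - diff V (i + 1) (s i (a, 0)) + s (i + 1) (- diff A (i + 1 + 1) a, u _ a).
  by have := hs i (a, 0); rewrite shift1_diff /= /cone_diff /= !linear0 addr0.
have tP i (w : B i) : diff V i (t i w) = t (i + 1) (diff B i w).
  by move: i w; apply: (@deg_shift 1) => i w; rewrite /t !lowE; apply: hs1.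
exists (cls (ChainMap tP)); rewrite hcompE; apply/cls_eqP/homotopic_sym.
exists r; apply: (@deg_shift 1) => i a; rewrite /= /r /t !lowE /= hs2.
have -> : s (i + 1) (- diff A (i + 1 + 1) a, u (i + 1 + 1) a) =
   s (i + 1) (0, u (i + 1 + 1) a) - s (i + 1) (diff A (i + 1 + 1) a, 0).
  rewrite -linearB; congr (s _ (_, _)); first by rewrite /= sub0r.
  by rewrite /= subr0.
exact: sub_oppD.
Qed.

(* What is used of a distinguished triangle: the exactness of the covariant and
   contravariant long Hom sequences. *)
Record tri X Y Z (f : khom X Y) (g : khom Y Z) (h : khom Z (shift 1 X)) := Tri {
  tri_fg : g \c f = 0;
  tri_gh : h \c g = 0;
  tri_hf : Sh 1 f \c h = 0;
  tri_ex1 : forall W (a : khom W Z), h \c a = 0 -> exists b, a = g \c b;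
  tri_ex2 : forall W (a : khom W Y), g \c a = 0 -> exists b, a = f \c b;
  tri_ex3 : forall W (a : khom W X), f \c a = 0 -> exists b, Sh 1 a = h \c b;
  tri_coex1 : forall V (a : khom Y V), a \c f = 0 -> exists b, a = b \c g;
  tri_coex3 : forall V (a : khom X V), Sh 1 a \c h = 0 -> exists b, a = b \c f }.

Lemma cone_tri A B (u : chain_map A B) : tri (cls u) (cls (cone_in u)) (cls (cone_out u)).
Proof.
split; try by [move=> W a; apply: cone_ex1 | move=> W a; apply: cone_ex2
  | move=> W a; apply: cone_ex3 | move=> W a; apply: cone_coex1
  | move=> W a; apply: cone_coex3].
- rewrite hcompE; apply/cls_eq0.
  have H i : linear (fun a : A (i + 1) => (a, 0) : cone u i).
    by move=> a x y; congr pair; rewrite /= scaler0 addr0.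
  exists (fun i => mklin (H i)) => i a; rewrite /= /cone_diff /=.
  congr pair => /=; first by rewrite addNr.
  by rewrite linear0 !addr0.
- by rewrite hcompE; apply: (@clsE _ _ _ _ _ (zero_map _ _)).
rewrite ShE hcompE; apply/cls_eq0.
have H i : linear (fun a : cone u (i + 1) => a.2 : shift 1 B i) by [].
exists (fun i => mklin (H i)) => i a; rewrite shift1_diff /= /cone_diff /=.
by rewrite addrCA addNr addr0.
Qed.

Lemma dist_tri X Y Z (f : chain_map X Y) (g : chain_map Y Z) (h : chain_map Z (shift 1 X)) :
  distinguished f g h -> tri (cls f) (cls g) (cls h).
Proof.
move=> [A [B [u [a [b [c [[/homotopy_equivalenceE [a' [a1 a2]]
  /homotopy_equivalenceE [b' [b1 b2]] /homotopy_equivalenceE [c' [c1 c2]]]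
  [/cls_eqP e1 /cls_eqP e2 /cls_eqP e3]]]]]]]].
move: e1 e2 e3; rewrite -!hcompE -(ShE 1 a).
move: (cone_tri u) a1 a2 b1 b2 c1 c2 => [].
move: (cls f) (cls g) (cls h) (cls u) (cls (cone_in u)) (cls (cone_out u)) (cls a) (cls b) (cls c).
move=> {}f {}g {}h v i o {}a {}b {}c iv oi vo ex1 ex2 ex3 coex1 coex3.
move=> a1 a2 b1 b2 c1 c2 e1 e2 e3.
have Sa : Sh 1 a' \c Sh 1 a = id_hom _ by rewrite -Sh_comp a1 Sh_id.
have ef : f = b' \c v \c a by rewrite -hcompA -e1 hcompA b1 hcomp1l.
have eg : g = c' \c i \c b by rewrite -hcompA -e2 hcompA c1 hcomp1l.
have eh : h = Sh 1 a' \c o \c c by rewrite -hcompA -e3 hcompA Sa hcomp1l.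
split.
- by rewrite ef eg -!hcompA (hcompA b) b2 hcomp1l (hcompA i) iv hcomp0l hcomp0r.
- by rewrite eg eh -!hcompA (hcompA c) c2 hcomp1l (hcompA o) oi hcomp0l !hcomp0r.
- rewrite ef !Sh_comp -(hcomp1r h) -c1 !hcompA -(hcompA _ _ h) e3.
  by rewrite -!hcompA (hcompA (Sh 1 v)) vo hcomp0l !hcomp0r.
- move=> W x hx; have /ex1 [y yP] : o \c (c \c x) = 0 by rewrite hcompA -e3 -hcompA hx hcomp0r.
  exists (b' \c y); rewrite eg -!hcompA (hcompA b) b2 hcomp1l -yP hcompA c1 hcomp1l //.
- move=> W x hx; have /ex2 [y yP] : i \c (b \c x) = 0 by rewrite hcompA -e2 -hcompA hx hcomp0r.
  exists (a' \c y); rewrite ef -!hcompA (hcompA a) a2 hcomp1l -yP hcompA b1 hcomp1l //.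
- move=> W x hx; have /ex3 [y yP] : v \c (a \c x) = 0 by rewrite hcompA -e1 -hcompA hx hcomp0r.
  exists (c' \c y); rewrite eh -!hcompA (hcompA c) c2 hcomp1l -yP Sh_comp hcompA Sa hcomp1l //.
- move=> W x hx; have /coex1 [y yP] : (x \c b') \c v = 0.
    by rewrite -(hcomp1r v) -a2 !hcompA -(hcompA x) -(hcompA x) -ef hx hcomp0l.
  exists (y \c c); rewrite eg -!hcompA (hcompA c) c2 hcomp1l hcompA -yP -hcompA b1 hcomp1r //.
- move=> W x hx; have /coex3 [y yP] : Sh 1 (x \c a') \c o = 0.
    rewrite -(hcomp1r o) -c2 !hcompA Sh_comp -(hcompA (Sh 1 x)) -(hcompA (Sh 1 x)) -eh hx.
    by rewrite hcomp0l.
  by exists (y \c b); rewrite -hcompA e1 hcompA -yP -hcompA a1 hcomp1r.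
Qed.

Section Cocone.
Variables (X Z : complex L) (h : chain_map Z (shift 1 X)).

(** Middle term of a triangle whose third map h is prescribed. With this sign, z |-> (h z, (0, z))
    is a chain map from Z to the cone of [cocone_in], and the projection of the cone pulls back to h
    exactly. *)
Definition cocone_diff i (w : X i * Z i) : X (i + 1) * Z (i + 1) :=
  (diff X i w.1 - h i w.2, diff Z i w.2).
Fact cocone_diff_linear i : linear (@cocone_diff i).
Proof.
move=> a x y; rewrite /cocone_diff /= !linearP; congr pair.
by rewrite /= scalerDr addrACA.
Qed.
Fact cocone_diffK i (w : X i * Z i) :
  mklin (@cocone_diff_linear (i + 1)) (mklin (@cocone_diff_linear i) w) = 0.
Proof.
rewrite /= /cocone_diff /= !diffK; congr pair.
rewrite linearB diffK sub0r /= -(cmapP h) shift1_diff opprK; exact: addNr.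
Qed.
Definition cocone : complex L :=
  @Complex _ (fun i => (X i * Z i)%type) (fun i => mklin (@cocone_diff_linear i)) cocone_diffK.

Fact cocone_in_linear i : linear (fun x : X i => (x, 0) : cocone i).
Proof. by move=> a x y; congr pair; rewrite /= ?scaler0 ?addr0. Qed.
Fact cocone_inP i (x : X i) :
  diff cocone i (mklin (@cocone_in_linear i) x) = mklin (@cocone_in_linear (i + 1)) (diff X i x).
Proof. by rewrite /= /cocone_diff /= !linear0 ?oppr0 addr0. Qed.
Definition cocone_in : chain_map X cocone := ChainMap cocone_inP.

Fact cocone_out_linear i : linear (fun x : cocone i => x.2).
Proof. by []. Qed.
Definition cocone_out : chain_map cocone Z :=
  @ChainMap _ cocone Z (fun i => mklin (@cocone_out_linear i)) (fun i x => erefl).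

Lemma cocone_dist : distinguished cocone_in cocone_out h.
Proof.
have Hc i : linear (fun z : Z i => (h i z, (0, z)) : cone cocone_in i).
  by move=> a x y; rewrite linearP; congr (_, (_, _)); rewrite /= scaler0 addr0.
have HcP i (z : Z i) :
    diff (cone cocone_in) i (mklin (Hc i) z) = mklin (Hc (i + 1)) (diff Z i z).
  rewrite /= /cone_diff /= /cocone_diff /=; congr (_, (_, _)).
  - by rewrite -(cmapP h) shift1_diff.
  - by rewrite /= linear0 sub0r subrr.
  by rewrite /= add0r.
pose c : chain_map Z (cone cocone_in) := ChainMap HcP.
have Hr i : linear (fun w : cone cocone_in i => w.2.2) by [].
have HrP i (w : cone cocone_in i) :
    diff Z i (mklin (Hr i) w) = mklin (Hr (i + 1)) (diff (cone cocone_in) i w).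
  by rewrite /= add0r.
pose r : chain_map (cone cocone_in) Z := ChainMap HrP.
have Hs i : linear (fun w : cone cocone_in (i + 1) => (- w.2.1, 0) : cone cocone_in i).
  move=> a x y; congr pair; first by rewrite /= opprD scalerN.
  by rewrite /= scaler0 addr0.
exists X, cocone, cocone_in, (id_map X), (id_map cocone), c; split; split.
- by apply/homotopy_equivalenceE; exists (id_hom _); rewrite !hcomp1l.
- by apply/homotopy_equivalenceE; exists (id_hom _); rewrite !hcomp1l.
- exists r; split; first by apply: homotopic_eq.
  exists (fun i => mklin (Hs i)) => i w; rewrite /= /cone_diff /= /cocone_diff /=.
  case: w => x' [x z] /=; congr (_, (_, _)).
  + by rewrite /= linearN opprK -sub_sub_sub.
  + by rewrite /= !linear0 ?subr0 !addr0 sub0r.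
  by rewrite /= linear0 !addr0 subrr.
- by apply: homotopic_eq.
- have Hs' i : linear (fun w : cocone (i + 1) => (- w.1, 0) : cone cocone_in i).
    move=> a x y; congr pair; first by rewrite /= opprD scalerN.
    by rewrite /= scaler0 addr0.
  exists (fun i => mklin (Hs' i)) => i w; rewrite /= /cone_diff /= /cocone_diff /=.
  case: w => x z /=; congr (_, (_, _)).
  + by rewrite /= linearN opprK opprB [RHS]addrC subrK; apply: subr0.
  + by rewrite /= !linear0 ?subr0 !addr0 sub0r.
  by rewrite /= linear0 !addr0 subrr.
by apply: homotopic_eq.
Qed.
End Cocone.
End Exactness.

(** * Trace duality *)

Section VectorFacts.
Variables (k : fieldType) (V : vectType k).

(** A subspace of maximal dimension inside P is all of P, since adjoining a further vector of P
    would enlarge it. This turns linear conditions stated in [Prop] into subspaces. *)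
Lemma vspace_of_closed (P : V -> Prop) :
  P 0 -> (forall a u v, P u -> P v -> P (a *: u + v)) ->
  exists U : {vspace V}, forall v, v \in U <-> P v.
Proof.
move=> P0 PD.
pose Q d := `[< exists U : {vspace V}, \dim U = d /\ forall v, v \in U -> P v >].
have Qex : exists d, Q d.
  exists 0%N; apply/asboolP; exists 0%VS; split=> [|v]; first exact: dimv0.
  by rewrite memv0 => /eqP ->.
have Qle d : Q d -> (d <= \dim {: V})%N.
  by move=> /asboolP [U [<- _]]; apply/dimvS/subvf.
case: (ex_maxnP Qex Qle) => d /asboolP [U [dU UP]] dmax.
exists U => v; split=> [/UP //|Pv]; apply/negPn/negP => vU.
have : Q (\dim (U + <[v]>)%VS).
  apply/asboolP; exists (U + <[v]>)%VS; split=> // _ /memv_addP[u uU [_ /vlineP[a ->] ->]].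
  by rewrite addrC; apply: PD => //; apply: UP.
move/dmax; rewrite -dU => le.
have /eqP E : U == (U + <[v]>)%VS by rewrite eqEdim addvSl le.
by case/negP: vU; rewrite E memvE addvSr.
Qed.

Lemma nonzero_coord (u : V) : u != 0 -> exists l : {linear V -> k^o}, l u != 0.
Proof.
move=> /eqP u0; apply: contrapT => N; apply: u0.
rewrite (coord_vbasis (memvf u)); apply: big1 => i _.
have -> : coord (vbasis fullv) i u = 0; last exact: scale0r.
by apply/eqP/negPn/negP => hi; apply: N; exists (coord (vbasis fullv) i).
Qed.

Lemma complement_projection (U : {vspace V}) : exists p : 'End(V),
  [/\ forall v, v \in U -> p v = 0, forall v, v - p v \in U,
      forall v, p v \in (U^C)%VS & forall v, v \in (U^C)%VS -> p v = v].
Proof.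
have UC0 : (U^C :&: U = 0)%VS by rewrite capvC capv_compl.
have pE v : daddv_pi (U^C)%VS U v + projv U v = v.
  by apply: daddv_pi_add => //; rewrite addvC addv_complf memvf.
exists (daddv_pi (U^C)%VS U); split=> v.
- by move=> vU; move/eqP: (pE v); rewrite projv_id // -subr_eq0 addrK => /eqP.
- by rewrite -{1}(pE v) addrAC subrr add0r memv_proj.
- exact: memv_pi.
exact: daddv_pi_id.
Qed.

Lemma separating_functional (P : V -> Prop) f :
  P 0 -> (forall a u v, P u -> P v -> P (a *: u + v)) -> ~ P f ->
  exists l : {linear V -> k^o}, l f != 0 /\ forall v, P v -> l v = 0.
Proof.
move=> P0 PD nP; have [U hU] := vspace_of_closed P0 PD.
have [p [pU pC _ _]] := complement_projection U.
have pf : p f != 0.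
  by apply/eqP => pf0; apply/nP/hU; move: (pC f); rewrite pf0 subr0.
have [l hl] := nonzero_coord pf.
have Hl : linear (fun v => l (p v)) by move=> a x y; rewrite !linearP.
by exists (mklin Hl); split=> // v /hU /pU /= ->; exact: linear0.
Qed.
End VectorFacts.

(** V is a quotient of ['rV_d]; a complement of the space of relations maps isomorphically onto it,
    and a basis of the complement provides coordinates. *)
Lemma spanned_axiom (k : fieldType) (V : lmodType k) d (e : 'I_d -> V) :
  (forall v, exists c : 'rV[k]_d, v = \sum_j c 0 j *: e j) ->
  exists n, inhabited (Vector.axiom n V).
Proof.
move=> span.
have Hp : linear (fun c : 'rV[k]_d => \sum_j c 0 j *: e j).
  move=> a x y; rewrite scaler_sumr -big_split; apply: eq_bigr => j _.
  by rewrite !mxE scalerDl scalerA.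
pose p := mklin Hp.
have [|a u v|U hU] := @vspace_of_closed k 'rV[k]_d (fun c => p c = 0).
- exact: linear0.
- by rewrite linearP => -> ->; rewrite scaler0 addr0.
have [r [rU rC rM rid]] := complement_projection U.
have pr c : p (r c) = p c.
  by have /hU/eqP := rC c; rewrite linearB subr_eq0 => /eqP.
have r_eq c c' : p c = p c' -> r c = r c'.
  move=> E; apply/eqP; rewrite -subr_eq0 -linearB; apply/eqP/rU/hU.
  by rewrite linearB E subrr.
have [v|s sP] := @boolp.choice _ _ (fun v c => p c = v).
  by have [c ->] := span v; exists c.
pose b := vbasis (U^C)%VS.
pose f v := \row_i coord b i (r (s v)).
exists (\dim (U^C)%VS); constructor; exists f.
  move=> a u v; apply/rowP => i; rewrite !mxE -linearP; congr (coord b i _).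
  by rewrite -linearP; apply: r_eq; rewrite linearP !sP.
exists (fun c : 'rV[k]_(\dim (U^C)%VS) => p (\sum_i c 0 i *: b`_i)) => [v|c].
  rewrite -[RHS]sP -[in RHS]pr; congr (p _); rewrite [RHS](coord_vbasis (rM _)).
  by apply: eq_bigr => i _; rewrite mxE.
apply/rowP => i; rewrite mxE.
have -> : r (s (p (\sum_i c 0 i *: b`_i))) = \sum_i c 0 i *: b`_i.
  rewrite -[RHS]rid; first by apply: r_eq; rewrite sP.
  by apply: rpred_sum => j _; apply/rpredZ/vbasis_mem/mem_nth; rewrite size_tuple.
rewrite linear_sum (bigD1 i) //= linearZ /= coord_free ?(basis_free (vbasisP _)) // eqxx mulr1.
rewrite big1 ?addr0 // => j ji; rewrite linearZ /= coord_free ?(basis_free (vbasisP _)) //.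
by rewrite (negbTE ji) mulr0.
Qed.

Section IntSums.
Variable V : nmodType.
Implicit Types F G : int -> V.

(** The window -N <= i <= N. It replaces the sum over all integers for F supported in it; by
    [zsum_wide] the choice of N is then immaterial. *)
Definition zsum N F := \sum_(0 <= a < N.*2.+1) F (a%:Z - N%:Z).

Lemma zsum_eq N F G : (forall i, (`|i| <= N)%N -> F i = G i) -> zsum N F = zsum N G.
Proof. by move=> FG; apply: eq_big_nat => a aN; apply: FG; lia. Qed.

Lemma zsum_split N F G : zsum N (fun i => F i + G i) = zsum N F + zsum N G.
Proof. exact: big_split. Qed.

Lemma zsum0 N F : (forall i, (`|i| <= N)%N -> F i = 0) -> zsum N F = 0.
Proof. by move=> F0; rewrite (zsum_eq F0); exact: big1. Qed.

Lemma zsum_wide N M F : (forall i, (N < `|i|)%N -> F i = 0) -> (N <= M)%N ->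
  zsum M F = zsum N F.
Proof.
move=> F0 /subnK <-; elim: (M - N)%N => // n IH; rewrite addSn -IH /zsum.
rewrite doubleS big_nat_recr //= big_nat_recl //=.
rewrite F0 ?F0 ?add0r ?addr0; try lia.
by apply: eq_bigr => a _; congr F; lia.
Qed.

Lemma zsum_shift N F : (forall i, (N < `|i|)%N -> F i = 0) ->
  zsum N.+1 (fun i => F (i + 1)) = zsum N F.
Proof.
move=> F0; rewrite /zsum doubleS [LHS]big_nat_recr //= [X in X + _]big_nat_recr //=.
rewrite [X in _ + X]F0 ?addr0; last lia.
rewrite [X in _ + X]F0 ?addr0; last lia.
by apply: eq_big_nat => a _; congr F; lia.
Qed.

Lemma zsum_single N F i0 : (`|i0| <= N)%N -> (forall i, i != i0 -> F i = 0) ->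
  zsum N F = F i0.
Proof.
move=> iN F0; pose a0 := `|(i0 + N%:Z)%R|%N.
have aE : (a0 : int) = i0 + N%:Z by rewrite /a0; lia.
rewrite /zsum (bigD1_seq a0); [| by rewrite mem_index_iota; lia | exact: iota_uniq].
rewrite [X in F X](_ : _ = i0); last lia.
by rewrite big1 /= ?addr0 // => a /eqP aa; apply: F0; apply/eqP; lia.
Qed.
End IntSums.

(** * Symmetrizing forms and traces on projective modules *)

Record symform (k : fieldType) (L : falgType k) := SymForm {
  sform :> {linear L -> k^o};
  sformC : forall a b : L, sform (a * b) = sform (b * a);
  sformP : forall l : {linear L -> k^o}, exists a, forall y, l y = sform (y * a) }.

(** The form is [phi 1]. Bimodule linearity gives [phi a y = phi 1 (y * a)] and
    [phi a y = phi 1 (a * y)], hence symmetry; surjectivity of phi represents every functional. *)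
Lemma symform_exists (k : fieldType) (L : falgType k) :
  symmetric_algebra L -> inhabited (symform L).
Proof.
move=> [phi [phi_bij phiE]].
have E1 a y : phi a y = phi 1 (y * a) by have := phiE a 1 1 y; rewrite !mulr1 mul1r.
have E2 a y : phi a y = phi 1 (a * y) by have := phiE 1 a 1 y; rewrite !mul1r mulr1.
constructor; apply: (@SymForm _ _ (phi 1)) => [a b|l]; first exact: (etrans (esym (E1 b a)) (E2 b a)).
have [psi _ phiK] := phi_bij.
exists (psi (linfun l)) => y.
by have := E1 (psi (linfun l)) y; rewrite phiK lfunE.
Qed.

Lemma sformN (k : fieldType) (L : falgType k) (t : symform L) (a : L) :
  a != 0 -> exists b, t (a * b) != 0.
Proof.
by move=> /nonzero_coord[l la]; have [b lE] := sformP t l; exists b; rewrite -lE.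
Qed.

Section DualBasis.
Variables (k : fieldType) (L : falgType k).

(** The coordinate system of the dual basis lemma for projective modules; v need not be independent.
    Indexing by [nat] allows padding with zeros to a larger length. *)
Definition dual_basis (P : lmodType L) n (v : nat -> P) (f : nat -> {linear P -> L^o}) :=
  forall x, x = \sum_(j < n) f j x *: v j.

Lemma dual_basis_exists (P : lmodType L) :
  finitely_generated P -> projective P -> exists n v f, @dual_basis P n v f.
Proof.
move=> [n [v hv]] pr.
have Hg : linear (fun c : 'rV[L]_n => \sum_j c 0 j *: v j).
  move=> a x y; rewrite scaler_sumr -big_split; apply: eq_bigr => j _.
  by rewrite !mxE scalerDl scalerA.
have [|h hP] := pr 'rV[L]_n P (mklin Hg) idfun.
  move=> y; have [c ->] := hv y; exists (\row_j c j) => /=.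
  by apply: eq_bigr => j _; rewrite mxE.
have Hf (j : nat) : linear (fun x => (if insub j is Some i then h x 0 i : L^o else 0 : L^o)).
  move=> a x y; case: insub => [i|]; last by rewrite scaler0 addr0.
  by rewrite linearP !mxE.
exists n, (fun j => if insub j is Some i then v i else 0 : P), (fun j => mklin (Hf j)) => x.
by rewrite -[LHS]hP /=; apply: eq_bigr => j _; rewrite /= valK.
Qed.

Lemma dual_basis_widen (P : lmodType L) n v f m : @dual_basis P n v f -> (n <= m)%N ->
  dual_basis m (fun j => if (j < n)%N then v j else 0) f.
Proof.
move=> db le x; rewrite {1}(db x) (big_ord_widen m (fun j => f j x *: v j) le).
rewrite big_mkcond; apply: eq_bigr => j _; case: ifP => // _; by rewrite scaler0.
Qed.

(** One length [fM] for all degrees and one bound [fN] for the support, so that a degreewise family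
    of maps is determined by a finite table of elements of L. *)
Record frame (X : complex L) := Frame {
  fM : nat; fN : nat;
  fv : forall i, nat -> X i;
  ff : forall i, nat -> {linear X i -> L^o};
  fE : forall i, dual_basis fM (fv i) (ff i);
  fZ : forall i, (fN < `|i|)%N -> forall x : X i, x = 0 }.

Lemma perfect_frame (X : complex L) : perfect X -> inhabited (frame X).
Proof.
move=> [fgp [N hN]].
have H i : exists t : nat * (nat -> X i) * (nat -> {linear X i -> L^o}),
    dual_basis t.1.1 t.1.2 t.2.
  by have [[n [v [f fP]]]] := (dual_basis_exists (fgp i).1 (fgp i).2, I); exists (n, v, f).
pose t i := projT1 (cid (H i)).
have tP i : dual_basis (t i).1.1 (t i).1.2 (t i).2 by exact: (projT2 (cid (H i))).
pose M := (\sum_(a < N.*2.+1) (t (a%:Z - N%:Z)%R).1.1)%N.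
constructor; exists M N
  (fun i j => if (`|i| <= N)%N then if (j < (t i).1.1)%N then (t i).1.2 j else 0 else 0)
  (fun i => (t i).2) => // i.
case: leqP => iN; last by move=> x; rewrite (hN i iN x) big1 // => j _; rewrite scaler0.
apply: dual_basis_widen (tP i) _.
have aN : (`|(i + N%:Z)%R|%N < N.*2.+1)%N by lia.
rewrite /M (bigD1 (Ordinal aN)) //=.
by rewrite (_ : (`|(i + N%:Z)%R|%N)%:Z - N%:Z = i) ?leq_addr //; lia.
Qed.

Lemma linear_L1 (P : lmodType L) (f : {linear P -> L^o}) (a : L) x :
  f (a *: x) = a * f x.
Proof. by rewrite linearZ. Qed.

Variable t : symform L.

(** The Hattori-Stallings trace followed by the symmetrizing form. By [mtraceC] its value on a
    linear h does not depend on the coordinate system. *)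
Definition mtrace (P : lmodType L) n (v : nat -> P) (f : nat -> {linear P -> L^o})
    (h : P -> P) : k :=
  \sum_(j < n) t (f j (h (v j))).

Lemma mtraceC (P Q : lmodType L) n v f m w g (a : {linear P -> Q}) (b : {linear Q -> P}) :
  @dual_basis P n v f -> @dual_basis Q m w g ->
  mtrace n v f (fun x => b (a x)) = mtrace m w g (fun x => a (b x)).
Proof.
move=> dP dQ; rewrite /mtrace.
have E1 (j : 'I_n) : t (f j (b (a (v j)))) = \sum_(l < m) t (g l (a (v j)) * f j (b (w l))).
  rewrite {1}(dQ (a (v j))) !linear_sum; apply: eq_bigr => l _.
  by rewrite (linearZ_LR b) linear_L1.
have E2 (l : 'I_m) : t (g l (a (b (w l)))) = \sum_(j < n) t (f j (b (w l)) * g l (a (v j))).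
  rewrite {1}(dP (b (w l))) !linear_sum; apply: eq_bigr => j _.
  by rewrite (linearZ_LR a) linear_L1.
rewrite (eq_bigr _ (fun j _ => E1 j)) (eq_bigr _ (fun j _ => E2 j)) exchange_big /=.
by apply: eq_bigr => j _; apply: eq_bigr => l _; rewrite sformC.
Qed.

Lemma mtraceD (P : lmodType L) n (v : nat -> P) f (a b : P -> P) :
  mtrace n v f (fun x => a x + b x) = mtrace n v f a + mtrace n v f b.
Proof.
by rewrite /mtrace -big_split; apply: eq_bigr => j _; rewrite !linearD.
Qed.

Lemma mtraceZ (P : lmodType L) n (v : nat -> P) f c (a : P -> P) :
  mtrace n v f (fun x => c%:A *: a x) = c * mtrace n v f a.
Proof.
rewrite /mtrace mulr_sumr; apply: eq_bigr => j _.
by rewrite linear_L1 mulr_algl linearZ.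
Qed.

Lemma mtrace0 (P : lmodType L) n (v : nat -> P) f (a : P -> P) : (forall x, a x = 0) ->
  mtrace n v f a = 0.
Proof. by move=> a0; apply: big1 => j _; rewrite a0 !linear0. Qed.

(* Testing against the rank one maps [x |-> g l x * c *: v]. *)
Lemma mtrace_nondeg (P Q : lmodType L) n v f m w g (a : {linear P -> Q}) :
  @dual_basis P n v f -> @dual_basis Q m w g ->
  (exists x, a x != 0) ->
  exists b : {linear Q -> P}, mtrace n v f (fun x => b (a x)) != 0.
Proof.
move=> dP dQ [x ax].
have [l hl] : exists l, g l (a x) != 0.
  apply: contrapT => N; move/eqP: ax; apply; rewrite (dQ (a x)); apply: big1 => l _.
  suff -> : g l (a x) = 0 by rewrite scale0r.
  by apply/eqP/negPn/negP => H; apply: N; exists (nat_of_ord l).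
have [c hc] := sformN t hl.
have Hb : linear (fun y => g l y *: (c *: x)).
  by move=> r y z; rewrite linearD linear_L1 scalerDl -scalerA.
exists (mklin Hb); rewrite /mtrace /=.
rewrite (_ : \sum_(j < n) _ = t (g l (a x) * c)) //.
rewrite sformC -linear_L1 -(linearZ_LR a) {2}(dP (c *: x)) !linear_sum.
apply: eq_bigr => j _.
rewrite (linear_L1 (f j) (g l (a (v j))) (c *: x)) sformC -(linear_L1 (g l)).
by rewrite -(linearZ_LR a).
Qed.
End DualBasis.

Definition the (A : Type) (h : inhabited A) : A :=
  projT1 (cid (let: inhabits x := h in ex_intro (fun=> True) x I)).

Record pc (k : fieldType) (L : falgType k) := PC { pcx :> complex L; pcP : perfect pcx }.

Section Homotopies.
Variables (k : fieldType) (L : falgType k).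
Implicit Types X Y : complex L.

Lemma nh_low X Y (s : forall i : int, {linear X (i + 1) -> Y i}) (f : forall i : int, X i -> Y i) :
  (forall (i : int) (x : X (i + 1)),
      f (i + 1) x = diff Y i (s i x) + s (i + 1) (diff X (i + 1) x)) ->
  forall i x, f i x = @low _ X Y (fun i => diff Y i \o s i) i x + s i (diff X i x).
Proof. by move=> hs; apply: (@deg_shift 1) => i x; rewrite lowE hs. Qed.

Section HMap.
Variables (X Y : complex L) (s : forall i : int, {linear X (i + 1) -> Y i}).
Fact hmap_linear i :
  linear (fun x => @low _ X Y (fun i => diff Y i \o s i) i x + s i (diff X i x)).
Proof. by move=> a x y; rewrite !linearP scalerDr addrACA. Qed.
Fact hmapP i x :
  diff Y i (mklin (@hmap_linear i) x) = mklin (@hmap_linear (i + 1)) (diff X i x).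
Proof.
move: i x; apply: (@deg_shift 1) => i x; rewrite /= !lowE /= !linearD !diffK add0r.
by rewrite linear0 addr0.
Qed.
Definition hmap : chain_map X Y := ChainMap hmapP.
Lemma hmap_null : null_homotopic (fun i => hmap i).
Proof. by exists s => i x /=; rewrite lowE. Qed.
End HMap.

Lemma single_homotopy X Y i0 (c : {linear X (i0 + 1) -> Y i0}) :
  exists s : forall i : int, {linear X (i + 1) -> Y i},
    (forall x, s i0 x = c x) /\ forall i, i != i0 -> forall x, s i x = 0.
Proof.
have H0 i : linear (fun _ : X (i + 1) => 0 : Y i).
  by move=> a x y; rewrite scaler0 addr0.
exists (fun i => match pselect (i0 = i) with
  | left e => ecast j {linear X (j + 1) -> Y j} e c | right _ => mklin (H0 i) end).
split=> [x|i ii x].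
  by case: pselect => // e; rewrite (eq_irrelevance e erefl).
by case: pselect => // e; case/eqP: ii.
Qed.
End Homotopies.

(** * The supertrace of a family of endomorphisms *)

Section Trace.
Variables (k : fieldType) (L : falgType k) (t : symform L).

Lemma mtrace_rank1 (P : lmodType L) n v f (q : {linear P -> L^o}) (y : P) :
  @dual_basis k L P n v f -> mtrace t n v f (fun x => q x *: y) = t (q y).
Proof.
move=> dP; rewrite /mtrace {2}(dP y) !linear_sum; apply: eq_bigr => j _.
by rewrite linear_L1 sformC -linear_L1.
Qed.

Lemma mtrace_sum (P : lmodType L) n (v : nat -> P) f (I : finType) (h : I -> P -> P) :
  mtrace t n v f (fun x => \sum_e h e x) = \sum_e mtrace t n v f (h e).
Proof.
rewrite /mtrace exchange_big; apply: eq_bigr => j _; by rewrite !linear_sum.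
Qed.

Definition sg (i : int) : k := (-1) ^+ `|i|%N.
Lemma sgS i : sg (i + 1) = - sg i.
Proof. exact: sgnS. Qed.
Lemma sg2 i : sg i * sg i = 1.
Proof. exact: sgnK. Qed.

Section Frame.
Variables (X : complex L) (F : frame X).
Definition dtrace i (h : X i -> X i) : k := mtrace t (fM F) (@fv _ _ _ F i) (@ff _ _ _ F i) h.
(* The supertrace; on homotopy classes it is a trace form making Hom(X, Y) dual
   to Hom(Y, X). *)
Definition str (h : forall i, X i -> X i) : k := zsum (fN F) (fun i => sg i * dtrace (h i)).

Lemma dtrace0 i h : (fN F < `|i|)%N -> @dtrace i h = 0.
Proof. by move=> iN; apply: mtrace0 => x; apply: fZ iN _. Qed.

Lemma strE M (h : forall i, X i -> X i) : (fN F <= M)%N ->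
  str h = zsum M (fun i => sg i * dtrace (h i)).
Proof.
by move=> le; rewrite (zsum_wide _ le) // => i iN; rewrite dtrace0 ?mulr0.
Qed.

Lemma eq_str (g h : forall i, X i -> X i) : (forall i x, g i x = h i x) -> str g = str h.
Proof.
move=> gh; apply: zsum_eq => i _; congr (_ * _); apply: eq_bigr => j _; by rewrite gh.
Qed.

Lemma strD (g h : forall i, X i -> X i) : str (fun i x => g i x + h i x) = str g + str h.
Proof.
by rewrite /str -zsum_split; apply: zsum_eq => i _; rewrite /dtrace mtraceD mulrDr.
Qed.

Lemma strZ c (h : forall i, X i -> X i) : str (fun i x => c%:A *: h i x) = c * str h.
Proof.
rewrite /str /zsum mulr_sumr; apply: eq_bigr => a _.
by rewrite /dtrace mtraceZ mulrCA.
Qed.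
End Frame.

Lemma strC (X Y : complex L) (F : frame X) (G : frame Y)
    (f : forall i, {linear X i -> Y i}) (g : forall i, {linear Y i -> X i}) :
  str F (fun i x => g i (f i x)) = str G (fun i x => f i (g i x)).
Proof.
rewrite (strE _ (leq_addr (fN G) (fN F))) (strE _ (leq_addl (fN F) (fN G))).
apply: zsum_eq => i _; congr (_ * _); apply: mtraceC; exact: fE.
Qed.

(** Cyclicity moves the differential of X around the trace, and the change of sign between adjacent
    degrees leaves the pairing of s with g d - d g. So null homotopic maps are orthogonal to chain
    maps, and a family orthogonal to all of them has to be a chain map. *)
Lemma str_hmap (X Y : complex L) (F : frame X) (G : frame Y)
    (g : forall i, {linear Y i -> X i}) (s : forall i : int, {linear X (i + 1) -> Y i}) :
  str F (fun i x => g i (hmap s i x)) =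
  zsum (fN F).+1 (fun i => sg (i + 1) *
    dtrace F (fun x : X (i + 1) => g (i + 1) (diff Y i (s i x)) - diff X i (g i (s i x)))).
Proof.
pose A i := dtrace F (fun x : X i => g i (@low _ X Y (fun i => diff Y i \o s i) i x)).
pose B i := dtrace F (fun x : X i => g i (s i (diff X i x))).
have E1 : str F (fun i x => g i (hmap s i x)) =
    zsum (fN F) (fun i => sg i * A i) + zsum (fN F) (fun i => sg i * B i).
  rewrite -zsum_split; apply: zsum_eq => i _; rewrite -mulrDr -mtraceD; congr (_ * _).
  by apply: eq_bigr => j _; rewrite /= linearD.
rewrite {}E1 -(zsum_shift (F := fun i => sg i * A i)); last first.
  by move=> i iN; rewrite /A dtrace0 ?mulr0.
rewrite -[X in _ + X](zsum_wide (M := (fN F).+1)) //; last first.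
  by move=> i iN; rewrite /B dtrace0 ?mulr0.
rewrite -zsum_split; apply: zsum_eq => i _.
have -> : B i = dtrace F (fun x : X (i + 1) => diff X i (g i (s i x))).
  exact: (mtraceC t (diff X i) (g i \o s i) (@fE _ _ _ F i) (@fE _ _ _ F (i + 1))). 
have -> (a b : X (i + 1) -> X (i + 1)) :
    dtrace F (fun x => a x - b x) = dtrace F a - dtrace F b.
  rewrite /dtrace -[X in _ - X]mul1r -mulNr -mtraceZ -mtraceD.
  by apply: eq_bigr => j _; rewrite scaleNr scale1r scaleN1r.
rewrite sgS mulrBr !mulNr opprK; congr (- (_ * _) + _).
by apply: eq_bigr => j _; rewrite lowE.
Qed.

Lemma str_null (X : complex L) (F : frame X) (h : forall i, X i -> X i) :
  null_homotopic h -> str F h = 0.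
Proof.
move=> [s /nh_low hs].
have -> : str F h = str F (fun i x => (idfun : {linear X i -> X i}) (hmap s i x)).
  exact: eq_str.
rewrite str_hmap //; apply: zsum0 => i _; rewrite /dtrace mtrace0 ?mulr0 //= => x.
by rewrite subrr.
Qed.
End Trace.

Section Coordinates.
Variables (k : fieldType) (L : falgType k).
Variables (X Y : complex L) (F : frame X) (G : frame Y).

Let N := (fN F + fN G)%N.
Definition cidx : finType := ('I_(N.*2.+1) * 'I_(fM F) * 'I_(fM G))%type.
Let dg (e : cidx) : int := (e.1.1 : nat)%:Z - N%:Z.

Definition coords (f : forall i, X i -> Y i) : {ffun cidx -> L} :=
  [ffun e => @ff _ _ _ G (dg e) e.2 (f (dg e) (@fv _ _ _ F (dg e) e.1.2)) : L].

Lemma coords_inj (f g : forall i, {linear X i -> Y i}) :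
  coords (fun i => f i) = coords (fun i => g i) -> forall i x, f i x = g i x.
Proof.
move=> fg i x; have [iN|iN] := leqP `|i|%N N; last first.
  have -> : x = 0 by apply: (fZ (f := F)); apply: leq_ltn_trans iN; apply: leq_addr.
  by rewrite !linear0.
have aN : (`|(i + N%:Z)%R|%N < N.*2.+1)%N by lia.
have ei : i = (Ordinal aN : nat)%:Z - N%:Z by rewrite /=; lia.
move: (Ordinal aN) ei => a ei; move: x; rewrite ei => x {i iN aN ei}.
rewrite (@fE _ _ _ F _ x) !linear_sum; apply: eq_bigr => j _; rewrite !linearZ; congr (_ *: _).
rewrite [LHS](@fE _ _ _ G) [RHS](@fE _ _ _ G); apply: eq_bigr => l _; congr (_ *: _).
by have /ffunP/(_ (a, j, l)) := fg; rewrite !ffunE.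
Qed.

Lemma eq_coords (f g : forall i, X i -> Y i) : (forall i x, f i x = g i x) ->
  coords f = coords g.
Proof. by move=> fg; apply/ffunP => e; rewrite !ffunE fg. Qed.

Lemma coordsP a (f g : forall i, X i -> Y i) :
  coords (fun i x => a%:A *: f i x + g i x) = a *: coords f + coords g.
Proof.
by apply/ffunP => e; rewrite !ffunE linearD linear_L1 mulr_algl.
Qed.

Lemma functional_coords (t : symform L) (l : {linear {ffun cidx -> L} -> k^o}) :
  exists n : cidx -> L, forall w, l w = \sum_e t (w e * n e).
Proof.
have H e : linear (fun b : L => l [ffun e' => if e' == e then b else 0]).
  move=> a x y; rewrite -linearP; congr (l _); apply/ffunP => e'.
  by rewrite !ffunE; case: ifP => // _; rewrite scaler0 addr0.
have [e|n nP] := @boolp.choice _ _ (fun e a => forall y, mklin (H e) y = t (y * a)).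
  exact: sformP.
exists n => w; transitivity (\sum_e mklin (H e) (w e)); last by apply: eq_bigr => e _.
rewrite /= -linear_sum; congr (l _); apply/ffunP => e; rewrite sum_ffunE (bigD1 e) //=.
rewrite ffunE eqxx big1 ?addr0 // => e' ee; rewrite ffunE eq_sym.
by rewrite (negbTE ee).
Qed.

(** The form t represents each coordinate of l by an element of L, and these elements are assembled
    into sums of rank one maps. The factor [sg k i] cancels the sign in [str]. Nothing yet makes g
    commute with the differentials. *)
Lemma functional_str (t : symform L) (l : {linear {ffun cidx -> L} -> k^o}) :
  exists g : forall i, {linear Y i -> X i}, forall f : forall i, {linear X i -> Y i},
    str t F (fun i x => g i (f i x)) = l (coords (fun i => f i)).
Proof.
have [n nP] := functional_coords t l.
(* Degree i is row i + N of the table. What [inord] returns outside the window does not matter,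
   since the supertrace is taken over the window. *)
pose nn (i : int) (j : 'I_(fM F)) (m : 'I_(fM G)) : L := n (inord `|(i + N%:Z)%R|%N, j, m).
have H i : linear (fun y : Y i => (sg k i)%:A *:
    (\sum_(e : 'I_(fM F) * 'I_(fM G)) @ff _ _ _ G i e.2 y *: (nn i e.1 e.2 *: @fv _ _ _ F i e.1))).
  move=> a x y; rewrite -scaleA_comm -scalerDr; congr (_ *: _).
  rewrite scaler_sumr -big_split; apply: eq_bigr => e _.
  by rewrite linearD linear_L1 scalerDl -scalerA.
exists (fun i => mklin (H i)) => f; rewrite nP (strE t _ (leq_addr (fN G) (fN F))).
rewrite /zsum big_mkord.
have E i : sg k i * dtrace t F (fun x : X i => mklin (H i) (f i x)) =
   \sum_(e : 'I_(fM F) * 'I_(fM G)) t (@ff _ _ _ G i e.2 (f i (@fv _ _ _ F i e.1)) * nn i e.1 e.2).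
  rewrite /dtrace /= mtraceZ mulrA sg2 mul1r mtrace_sum; apply: eq_bigr => e _.
  have Hq : linear (fun x => @ff _ _ _ G i e.2 (f i x)) by move=> a x y; rewrite !linearP.
  rewrite (mtrace_rank1 t (mklin Hq)); last exact: fE.
  by rewrite /= linearZ_LR linear_L1 sformC.
rewrite (eq_bigr _ (fun (a : 'I_(N.*2.+1)) _ => E (a%:Z - N%:Z))) pair_big /=.
rewrite (reindex (fun e : cidx => (e.1.1, (e.1.2, e.2)))) /=; last first.
  by exists (fun e => (e.1, e.2.1, e.2.2)) => [[[a b] c]|[a [b c]]].
apply: eq_bigr => -[[a j] m] _; rewrite /= ffunE /= /nn /dg /= subrK.
by rewrite absz_nat inord_val.
Qed.
End Coordinates.

(** * Finite dimensionality of morphism spaces and the trace pairing *)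

Section Perfect.
Variables (k : fieldType) (L : falgType k).
Implicit Types X Y Z : pc L.

Definition pframe X : frame X := the (perfect_frame (pcP X)).

(** Chain maps embed by [coords] as a subspace of a finite dimensional space of tables; a basis of
    that subspace spans the homotopy classes. *)
Lemma khom_spanned X Y : exists d (e : 'I_d -> khom X Y),
  forall v, exists c : 'rV[k]_d, v = \sum_j c 0 j *: e j.
Proof.
pose co (f : chain_map X Y) := coords (pframe X) (pframe Y) (fun i => f i).
have coD a f g : co (add_map (scale_map a f) g) = a *: co f + co g.
  exact: (coordsP (pframe X) (pframe Y) a (fun i => f i) (fun i => g i)).
have [||U hU] := @vspace_of_closed k _ (fun c => exists f, co f = c).
- exists (zero_map X Y); apply/ffunP => e; rewrite !ffunE; exact: linear0.
- by move=> a _ _ [f <-] [g <-]; exists (add_map (scale_map a f) g).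
pose b := vbasis U.
have Hf (j : 'I_(\dim U)) : exists f, co f = b`_j.
  by apply/hU/vbasis_mem/mem_nth; rewrite size_tuple.
have [f fP] := boolp.choice Hf.
exists (\dim U), (fun j => cls (f j)); elim/homW => g.
have /coord_vbasis E : co g \in U by apply/hU; exists g.
exists (\row_j coord b j (co g)).
pose gs s := foldr (fun j h => add_map (scale_map (coord b j (co g)) (f j)) h) (zero_map X Y) s.
have gsE s : cls (gs s) = \sum_(j <- s) coord b j (co g) *: cls (f j).
  by elim: s => [|j s IH]; rewrite ?big_nil // big_cons -IH clsZ clsD.
have gsC s : co (gs s) = \sum_(j <- s) coord b j (co g) *: b`_j.
  elim: s => [|j s IH]; rewrite ?big_nil ?big_cons.
    apply/ffunP => e; rewrite !ffunE; exact: linear0.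
  by rewrite -IH -fP coD.
rewrite (eq_bigr (fun j => coord b j (co g) *: cls (f j))); last by move=> j _; rewrite mxE.
rewrite -gsE; apply: clsE; apply: (coords_inj (F := pframe X) (G := pframe Y)).
by rewrite -/(co g) -/(co (gs _)) gsC; apply: E.
Qed.

(* An alias of [khom] that is a vectType, perfect complexes having finite
   dimensional morphism spaces. *)
Definition phom X Y := khom X Y.
HB.instance Definition _ X Y := GRing.Lmodule.on (phom X Y).

Lemma phom_axiom X Y : exists n, inhabited (Vector.axiom n (phom X Y)).
Proof. by have [d [e he]] := khom_spanned X Y; apply: spanned_axiom he. Qed.

HB.instance Definition _ X Y := Lmodule_hasFinDim.Build k (phom X Y)
  (the (projT2 (cid (phom_axiom X Y)))).

Definition hd X Y : nat := \dim {: phom X Y}.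

Variable t : symform L.

Definition tau X (a : khom X X) : k^o := str t (pframe X) (fun i => krep a i).

Lemma tau_cls X (f : chain_map X X) : tau (cls f) = str t (pframe X) (fun i => f i).
Proof.
have := str_null t (pframe X) (repr_cls f).
rewrite (eq_str t (pframe X) (h := fun i x => krep (cls f) i x + (-1)%:A *: f i x)); last first.
  by move=> i x; rewrite scaleNr scale1r scaleN1r.
by rewrite strD strZ mulN1r => /eqP; rewrite subr_eq0 => /eqP.
Qed.

Fact tau_linear X : linear (@tau X).
Proof.
move=> c; elim/homW=> f; elim/homW=> g; rewrite clsZ clsD !tau_cls strD strZ //.
Qed.
HB.instance Definition _ X :=
  GRing.isLinear.Build k _ _ _ (@tau X) (@tau_linear X).

Lemma tauC X Y (b : khom Y X) (a : khom X Y) : tau (b \c a) = tau (a \c b).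
Proof.
elim/homW: a => f; elim/homW: b => g; rewrite !hcompE !tau_cls; exact: (strC t (pframe X) (pframe Y) (fun i => f i) (fun i => g i)).
Qed.

(** A functional l on tables separates f from the null homotopic maps. It is the supertrace pairing
    with some family g, and vanishing on null homotopic maps forces g to be a chain map, which then
    pairs nontrivially with f. *)
Lemma tau_nondeg X Y (a : khom X Y) : a != 0 -> exists b : khom Y X, tau (b \c a) != 0.
Proof.
elim/homW: a => f /eqP f0.
pose co (f : chain_map X Y) := coords (pframe X) (pframe Y) (fun i => f i).
have coD a f' g : co (add_map (scale_map a f') g) = a *: co f' + co g.
  exact: (coordsP (pframe X) (pframe Y) a (fun i => f' i) (fun i => g i)).
have [|||l [lf l0]] := @separating_functional k _
    (fun c => exists f : chain_map X Y, null_homotopic (fun i => f i) /\ co f = c) (co f).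
- exists (zero_map X Y); split; first exact: nh0.
  by apply/ffunP => e; rewrite !ffunE; exact: linear0.
- move=> a _ _ [f1 [n1 <-]] [f2 [n2 <-]]; exists (add_map (scale_map a f1) f2); split=> //.
  by apply: nh_add n2; apply: nh_scale.
- move=> [g [gn gf]]; apply: f0; apply/cls_eq0; apply: nh_ext gn.
  exact: (coords_inj (F := pframe X) (G := pframe Y)).
have [g gP] := functional_str t l.
(* If g d - d g were nonzero in degree i, nondegeneracy of the trace there would give a homotopy
   concentrated in that degree on which l does not vanish. *)
have gc i y : diff X i (g i y) = g (i + 1) (diff Y i y).
  apply/eqP; rewrite eq_sym -subr_eq0; apply/negPn/negP => gy.
  have Hth : linear (fun y => g (i + 1) (diff Y i y) - diff X i (g i y)).
    by move=> a u v; rewrite !linearP /= scalerDr addrACA.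
  have [|c hc] := mtrace_nondeg t (a := mklin Hth) (@fE _ _ _ (pframe Y) i)
                    (@fE _ _ _ (pframe X) (i + 1)).
    by exists y.
  have [s [si s0]] := single_homotopy c.
  have E := gP (hmap s); move: E; rewrite l0; last first.
    by exists (hmap s); split=> //; apply: hmap_null.
  rewrite (str_hmap t (pframe X) (pframe Y)) (zsum_single (i0 := i)); last first.
  - move=> j ji; rewrite /dtrace mtrace0 ?mulr0 // => x.
    by rewrite s0 // !linear0 ?subrr ?addr0.
  - rewrite leqNgt; apply/negP => iN; case/eqP: gy.
    by apply: (fZ (f := pframe X)); lia.
  move/eqP; rewrite mulf_eq0 /sg signr_eq0 /= => /eqP E.
  move/eqP: hc; apply; rewrite -[RHS]E /dtrace.
  rewrite (mtraceC t (mklin Hth) c (@fE _ _ _ (pframe Y) i) (@fE _ _ _ (pframe X) (i + 1))).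
  by apply: eq_bigr => j _; rewrite /= si.
exists (cls (ChainMap gc)); rewrite hcompE.
suff -> : tau (cls (comp_map (ChainMap gc) f)) = l (co f) by [].
by rewrite tau_cls -gP.
Qed.
End Perfect.

(** * Splitting of idempotents and local objects *)

Section KernelModule.
Variables (R : nzRingType) (V W : lmodType R) (g : {linear V -> W}).
Definition kerp : {pred V} := fun x => g x == 0.
Fact kerp_submod : submod_closed kerp.
Proof.
split=> [|a x y]; rewrite !unfold_in ?linear0 // linearP => /eqP -> /eqP ->.
by rewrite scaler0 addr0.
Qed.
HB.instance Definition _ := GRing.isSubmodClosed.Build R V kerp kerp_submod.
(** Kernels as modules in their own right. They serve as images of idempotents (kernels of e - 1),
    as modules of cycles and as the terms of stalk complexes. *)
Record kermod := Kermod { kerval :> V; kervalP : kerval \in kerp }.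
HB.instance Definition _ := [isSub for kerval].
HB.instance Definition _ := [Choice of kermod by <:].
HB.instance Definition _ := [SubChoice_isSubLmodule of kermod by <:].
Lemma kervalE (x : kermod) : g (kerval x) = 0.
Proof. by apply/eqP; exact: (kervalP x). Qed.
Lemma ker_inj : injective kerval. Proof. exact: val_inj. Qed.
Lemma kerval_linear : linear kerval.
Proof. exact: (linearP (val : kermod -> V)). Qed.
Lemma kervalZ a x : kerval (a *: x) = a *: kerval x.
Proof. exact: (linearZ_LR (mklin kerval_linear)). Qed.
End KernelModule.

Section Modules.
Variable R : nzRingType.
Implicit Types P Q : lmodType R.

Lemma retract_fg P Q (i : {linear Q -> P}) (p : {linear P -> Q}) :
  (forall x, p (i x) = x) -> finitely_generated P -> finitely_generated Q.
Proof.
move=> pi [n [v hv]]; exists n, (fun j => p (v j)) => x.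
have [c hc] := hv (i x); exists c; rewrite -[LHS]pi hc linear_sum.
by apply: eq_bigr => j _; rewrite linearZ.
Qed.

Lemma retract_proj P Q (i : {linear Q -> P}) (p : {linear P -> Q}) :
  (forall x, p (i x) = x) -> projective P -> projective Q.
Proof.
move=> pi pr M N g f gs; have [h hP] := pr M N g (f \o p) gs.
by exists (h \o i) => x; rewrite /= hP /= pi.
Qed.

Lemma prod_fg P Q : finitely_generated P -> finitely_generated Q ->
  finitely_generated (P * Q)%type.
Proof.
move=> [n [v hv]] [m [w hw]].
exists (n + m)%N, (fun j => match split j with inl a => (v a, 0) | inr b => (0, w b) end).
move=> [x y]; have [c hc] := hv x; have [d hd] := hw y.
exists (fun j => match split j with inl a => c a | inr b => d b end).
rewrite big_split_ord /=.
rewrite (eq_bigr (fun i => (c i *: v i, 0))); last first.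
  by move=> i _; rewrite (unsplitK (inl i)); congr pair; rewrite /= scaler0.
rewrite [X in _ + X](eq_bigr (fun i => (0, d i *: w i))); last first.
  by move=> i _; rewrite (unsplitK (inr i)); congr pair; rewrite /= scaler0.
have E1 : \sum_i (c i *: v i, 0 : Q) = (x, 0).
  by rewrite hc; elim/big_ind2: _ => // a b a' b' -> ->; congr pair; rewrite /= addr0.
have E2 : \sum_i (0 : P, d i *: w i) = (0, y).
  by rewrite hd; elim/big_ind2: _ => // a b a' b' -> ->; congr pair; rewrite /= addr0.
by rewrite E1 E2; congr pair; rewrite /= ?addr0 ?add0r.
Qed.

Lemma prod_proj P Q : projective P -> projective Q -> projective (P * Q)%type.
Proof.
move=> pP pQ M N g f gs.
have Hl : linear (fun x : P => f (x, 0)).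
  by move=> a x y; rewrite -linearP; congr (f (_, _)); rewrite /= scaler0 addr0.
have Hr : linear (fun x : Q => f (0, x)).
  by move=> a x y; rewrite -linearP; congr (f (_, _)); rewrite /= scaler0 addr0.
have [h1 h1P] := pP M N g (mklin Hl) gs; have [h2 h2P] := pQ M N g (mklin Hr) gs.
have H : linear (fun z : P * Q => h1 z.1 + h2 z.2).
  by move=> a x y; rewrite !linearP scalerDr addrACA.
exists (mklin H) => -[x y]; rewrite /= linearD h1P h2P /= -linearD.
by congr (f (_, _)); rewrite /= ?addr0 ?add0r.
Qed.
End Modules.

Section PerfectClosure.
Variable R : nzRingType.
Implicit Types X Y : complex R.

Lemma perfect_shift n X : perfect X -> perfect (shift n X).
Proof.
move=> [H [N hN]]; split=> [i|]; first exact: (H (i + n)).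
by exists (N + `|n|)%N => i iN; apply: hN; lia.
Qed.

(** Only the underlying graded module matters, so one proof covers direct sums and cocones. *)
Lemma perfect_prod X Y (Z : complex R) :
  (forall i, obj Z i = ((X i * Y i)%type : lmodType R)) ->
  perfect X -> perfect Y -> perfect Z.
Proof.
move=> E [H [N hN]] [K [M hM]]; split=> [i|].
  by rewrite E; have [] := H i; have [] := K i; split; [exact: prod_fg|exact: prod_proj].
exists (N + M)%N => i iN; rewrite E => -[x y].
by rewrite (hN i _ x) ?(hM i _ y) //; lia.
Qed.

Lemma perfect_dsum X Y : perfect X -> perfect Y -> perfect (dsum X Y).
Proof. exact: (@perfect_prod X Y (dsum X Y) (fun i => erefl)). Qed.
End PerfectClosure.

Lemma perfect_cocone (k : fieldType) (L : falgType k) (X Z : complex L) (h : chain_map Z (shift 1 X)) :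
  perfect X -> perfect Z -> perfect (cocone h).
Proof. exact: (@perfect_prod _ X Z (cocone h) (fun i => erefl)). Qed.

Section Split.
Variables (k : fieldType) (L : falgType k).

Section FixedComplex.
Variables (X : complex L) (e : chain_map X X).
Hypothesis eK : forall i x, e i (e i x) = e i x.

Fact fixd_linear i : linear (fun x : X i => e i x - x).
Proof. by move=> a x y; rewrite linearP opprD addrACA scalerBr. Qed.
Definition fixmod i : lmodType L := kermod (mklin (@fixd_linear i)).
Lemma fixvalE i (x : fixmod i) : e i (kerval x) = kerval x.
Proof. by have /eqP := kervalE x; rewrite /= subr_eq0 => /eqP. Qed.

Fact fix_diff_proof i (x : fixmod i) : diff X i (kerval x) \in kerp (mklin (@fixd_linear (i + 1))).
Proof. by rewrite unfold_in /= -cmapP fixvalE subrr. Qed.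
Definition fix_diff i (x : fixmod i) : fixmod (i + 1) := Kermod (fix_diff_proof x).
Fact fix_diff_linear i : linear (@fix_diff i).
Proof.
move=> a x y; apply: ker_inj; rewrite [RHS]kerval_linear /= -linearP.
by congr (diff X i _); apply: kerval_linear.
Qed.
Fact fix_diffK i (x : fixmod i) :
  mklin (@fix_diff_linear (i + 1)) (mklin (@fix_diff_linear i) x) = 0.
Proof. by apply: ker_inj; rewrite /= diffK. Qed.
Definition fixcx : complex L :=
  @Complex _ fixmod (fun i => mklin (@fix_diff_linear i)) fix_diffK.

Definition fix_in : chain_map fixcx X :=
  @ChainMap _ fixcx X (fun i => mklin (@kerval_linear _ _ _ (mklin (@fixd_linear i)))) (fun i x => erefl).

Fact fix_out_proof i (x : X i) : e i x \in kerp (mklin (@fixd_linear i)).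
Proof. by rewrite unfold_in /= eK subrr. Qed.
Fact fix_out_linear i : linear (fun x : X i => Kermod (fix_out_proof x) : fixcx i).
Proof. by move=> a x y; apply: ker_inj; rewrite [RHS]kerval_linear /= linearP. Qed.
Fact fix_outP i (x : X i) :
  diff fixcx i (mklin (@fix_out_linear i) x) = mklin (@fix_out_linear (i + 1)) (diff X i x).
Proof. by apply: ker_inj; rewrite /= cmapP. Qed.
Definition fix_out : chain_map X fixcx := ChainMap fix_outP.

Lemma fix_outK i x : fix_out i (fix_in i x) = x.
Proof. by apply: ker_inj; rewrite /= fixvalE. Qed.

Lemma perfect_fix : perfect X -> perfect fixcx.
Proof.
move=> [H [N hN]]; split=> [i|].
  have [fg pr] := H i; split.
    exact: (retract_fg (i := fix_in i) (p := fix_out i) (fix_outK (i := i))).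
  exact: (retract_proj (i := fix_in i) (p := fix_out i) (fix_outK (i := i))).
by exists N => i iN x; apply: ker_inj; apply: (hN i iN).
Qed.
End FixedComplex.

Lemma split_strict (X : complex L) (e : chain_map X X) :
  (forall i x, e i (e i x) = e i x) -> perfect X ->
  exists A B : complex L, [/\ perfect A, perfect B &
    exists (iA : khom A X) (iB : khom B X) (pA : khom X A) (pB : khom X B),
    [/\ pA \c iA = id_hom A, pB \c iB = id_hom B, pA \c iB = 0, pB \c iA = 0
    & iA \c pA + iB \c pB = id_hom X /\ iA \c pA = cls e]].
Proof.
move=> eK pX; pose e' := add_map (id_map X) (scale_map (-1) e).
have e'E i x : e' i x = x - e i x by rewrite /= scaleNr scale1r scaleN1r.
have e'K i x : e' i (e' i x) = e' i x.
  by rewrite !e'E linearB eK subrr subr0.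
exists (fixcx e), (fixcx e'); split; try exact: perfect_fix.
exists (cls (fix_in e)), (cls (fix_in e')), (cls (fix_out eK)), (cls (fix_out e'K)).
rewrite !hcompE; split.
- apply: clsE => i x; exact: fix_outK.
- apply: clsE => i x; exact: fix_outK.
- apply: (@clsE _ _ _ _ _ (zero_map _ _)) => i x; apply: ker_inj => /=.
  have := fixvalE x; rewrite e'E => /eqP; rewrite -subr_eq0 addrAC subrr add0r oppr_eq0 => /eqP.
  by [].
- apply: (@clsE _ _ _ _ _ (zero_map _ _)) => i x; apply: ker_inj.
  by rewrite -[LHS]/(e' i (kerval x)) e'E fixvalE subrr.
split; last exact: clsE.
rewrite clsD; apply: clsE => i x; rewrite -[LHS]/(e i x + e' i x) e'E.
by rewrite addrC subrK.
Qed.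
End Split.

(** The dependence is on later vectors: for the powers of a map it expresses one power through
    higher ones, the form that Fitting's lemma needs. *)
Lemma nonfree_split (k : fieldType) (V : vectType k) (s : nat -> V) n m :
  ~~ free (map s (iota n m)) ->
  exists a b, s a \in <<map s (iota a.+1 b)>>%VS.
Proof.
elim: m n => [|m IH] n /=; first by rewrite nil_free.
by rewrite free_cons negb_and negbK => /orP[H|/IH //]; exists n, m.
Qed.

Lemma iter_comm (T : Type) (f w : T -> T) : (forall x, f (w x) = w (f x)) ->
  forall n x, iter n f (w x) = w (iter n f x).
Proof. by move=> fw; elim=> //= n IH x; rewrite IH fw. Qed.

(** Iterating f^a = f^(a+1) w gives f^a = f^(a+m) w^m. With m = a this reads f^a e = f^a for e = f^a
    w^a, and e e = e follows because f and w commute. *)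
Lemma fitting_iter (T : Type) (f w : T -> T) a : (forall x, f (w x) = w (f x)) ->
  (forall x, iter a f x = iter a.+1 f (w x)) ->
  let e x := iter a f (iter a w x) in
  (forall x, e (e x) = e x) /\ (forall x, iter a f (e x) = iter a f x).
Proof.
move=> fw E e.
have fwn n m x : iter n f (iter m w x) = iter m w (iter n f x).
  by elim: m x => //= m IH x; rewrite (iter_comm fw) IH.
have H m x : iter a f x = iter (a + m) f (iter m w x).
  elim: m x => [|m IH] x; first by rewrite addn0.
  rewrite IH (addnC a m) iterD E -iterD; congr (iter _ f _).
  by rewrite -addSnnS addnC.
have H2 x : iter a f (e x) = iter a f x.
  by rewrite /e -iterD -H.
by split=> // x; rewrite {1}/e fwn H2 -fwn.
Qed.

Section Fitting.
Variables (k : fieldType) (L : falgType k).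
Implicit Types X Y : pc L.

Definition kpow (X : complex L) (a : khom X X) n : khom X X := iter n (hcomp a) (id_hom X).

Definition fpow (X : complex L) (f : chain_map X X) n : chain_map X X :=
  iter n (comp_map f) (id_map X).
Lemma fpowE (X : complex L) (f : chain_map X X) n i x : fpow f n i x = iter n (f i) x.
Proof. by elim: n x => //= n IH x; rewrite /= IH. Qed.
Lemma kpowE (X : complex L) (f : chain_map X X) n : kpow (cls f) n = cls (fpow f n).
Proof. by elim: n => //= n IH; rewrite -hcompE -IH. Qed.

(** The tables of the powers of f are linearly dependent, so some power is f^(a+1) w with w
    commuting with f. The identity is strict, not up to homotopy; the extra factor f keeps the
    exponent positive. *)
Lemma fitting X (f : chain_map X X) : exists (n : nat) (w : chain_map X X),
  (forall i x, f i (w i x) = w i (f i x)) /\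
  forall i x, iter n.+1 (f i) x = iter n.+2 (f i) (w i x).
Proof.
pose co (f : chain_map X X) := coords (pframe X) (pframe X) (fun i => f i).
have coD a f' g : co (add_map (scale_map a f') g) = a *: co f' + co g.
  exact: (coordsP (pframe X) (pframe X) a (fun i => f' i) (fun i => g i)).
pose s n := co (fpow f n).
have : ~~ free (map s (iota 0 (\dim {: {ffun cidx (pframe X) (pframe X) -> L}}).+1)).
  apply/negP => /eqP E.
  have := dimvS (subvf <<map s (iota 0 (\dim {: {ffun cidx (pframe X) (pframe X) -> L}}).+1)>>).
  by rewrite E size_map size_iota ltnn.
move/nonfree_split => [a [b sa]].
pose P c := exists w : chain_map X X, (forall i x, f i (w i x) = w i (f i x)) /\
  c = co (comp_map (fpow f a.+1) w).
have [||U hU] := @vspace_of_closed k _ P.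
- exists (zero_map X X); split=> [i x|]; first by rewrite /= linear0.
  by apply/ffunP => e; rewrite !ffunE /= !linear0.
- move=> c u v [w [wf ->]] [w' [wf' ->]]; exists (add_map (scale_map c w) w'); split=> [i x|].
    by rewrite /= linearD linearZ wf wf'.
  rewrite -coD; apply: eq_coords => i x.
  by rewrite -[RHS]/(fpow f a.+1 i (c%:A *: w i x + w' i x)) linearP.
have /hU [w [wf E]] : s a \in U.
  apply: subvP sa; apply/span_subvP => _ /mapP [j jab ->]; apply/hU.
  move: jab; rewrite mem_iota => /andP[aj _].
  exists (fpow f (j - a.+1)); split=> [i x|]; first by rewrite !fpowE -iterS -iterSr.
  apply: eq_coords => i x.
  by rewrite /= !fpowE -iterD -iterS -addSn subnKC.
have E' i x : iter a (f i) x = iter a.+1 (f i) (w i x).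
  have := coords_inj (f := fun i => fpow f a i) (g := fun i => comp_map (fpow f a.+1) w i) E x.
  by rewrite /= !fpowE.
exists a, w; split=> // i x; by rewrite iterS E' -iterS.
Qed.

(** The Fitting idempotent of f. If its class is the identity, f is invertible; if it is zero, f is
    nilpotent; if the class of f is idempotent, it is the class of e. *)
Lemma strict_idempotent X (f : chain_map X X) : exists (n : nat) (w e : chain_map X X),
  [/\ forall i x, e i (e i x) = e i x,
      cls e = cls f \c (kpow (cls f) n \c kpow (cls w) n.+1),
      cls e = (kpow (cls f) n \c kpow (cls w) n.+1) \c cls f
    & kpow (cls f) n.+1 \c cls e = kpow (cls f) n.+1].
Proof.
have [n [w [fw E]]] := fitting f.
have H i := fitting_iter (fw i) (E i).
exists n, w, (comp_map (fpow f n.+1) (fpow w n.+1)); split.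
- by move=> i x; have [H1 _] := H i; have := H1 x; rewrite /= !fpowE.
- by rewrite !kpowE !hcompE; apply: clsE.
- rewrite !kpowE !hcompE; apply: clsE => i x /=.
  have wfn m y : iter m (w i) (f i y) = f i (iter m (w i) y).
    by rewrite -(iter_comm (f := w i) (w := f i)) // => z; rewrite fw.
  by rewrite !fpowE -!iterS wfn iterSr.
rewrite !kpowE !hcompE; apply: clsE => i x /=.
by have [_ H2] := H i; have := H2 x; rewrite !fpowE.
Qed.

Lemma kpowS (X : complex L) (a : khom X X) n : kpow a n.+1 = a \c kpow a n.
Proof. by []. Qed.
Lemma kpowSr (X : complex L) (a : khom X X) n : kpow a n.+1 = kpow a n \c a.
Proof.
elim: n => [|n IH]; first by rewrite /kpow /= hcomp1l hcomp1r.
by rewrite kpowS {1}IH hcompA -kpowS.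
Qed.

Lemma idempotent_split X (p : khom X X) : p \c p = p -> exists (A B : pc L)
  (iA : khom A X) (iB : khom B X) (pA : khom X A) (pB : khom X B),
    [/\ pA \c iA = id_hom A, pB \c iB = id_hom B, pA \c iB = 0, pB \c iA = 0
    & iA \c pA + iB \c pB = id_hom X /\ iA \c pA = p].
Proof.
elim/homW: p => f ff; have [n [w [e [eK e1 e2 e3]]]] := strict_idempotent f.
have [A [B [pA pB H]]] := split_strict eK (pcP X).
exists (PC pA), (PC pB).
suff <- : cls e = cls f by exact: H.
have fn m : kpow (cls f) m.+1 = cls f by elim: m => [|m IH]; rewrite kpowS ?hcomp1r // IH.
(* As f f = f, the relation e3 reads f e = f, while e = f (...) gives f e = e. *)
rewrite fn in e3; rewrite -e3 {2}e1 hcompA ff -e1 //.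
Qed.

(* Equivalent to locality of the endomorphism ring when that ring is finite
   dimensional, as it is for perfect complexes. *)
Definition local (X : complex L) := id_hom X <> 0 /\
  forall a : khom X X, kiso a \/ exists n, kpow a n = 0.

Lemma indecomposable_local X : indecomposable X -> local X.
Proof.
move=> [X0 ind]; split=> [/is_zeroE //|]; elim/homW => f.
have [n [w [e [eK e1 e2 e3]]]] := strict_idempotent f.
have [A [B [pA pB [iA [iB [qA [qB [h1 h2 h3 h4 [h5 h6]]]]]]]]] := split_strict eK (pcP X).
have /hisoE/ind : iso X (dsum A B) by apply/bipE; exists iA, iB, qA, qB.
case=> // [/is_zeroE A0|/is_zeroE B0].
  right; exists n.+1; rewrite -e3 -h6 -(hcomp1r iA) A0 hcomp0r hcomp0l; exact: hcomp0r.
left; have E : cls e = id_hom X.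
  by rewrite -h5 h6 -(hcomp1r iB) B0 hcomp0r hcomp0l addr0.
by exists (kpow (cls f) n \c kpow (cls w) n.+1); rewrite -e1 -e2.
Qed.

Lemma local_indecomposable (X : complex L) : local X -> indecomposable X.
Proof.
move=> [X0 loc]; split=> [/is_zeroE //|A B _ _ /hisoE/bipE].
move=> [iA [iB [pA [pB [h1 h2 h3 h4 h5]]]]].
have pp : (iA \c pA) \c (iA \c pA) = iA \c pA.
  by rewrite -hcompA (hcompA pA) h1 hcomp1l.
case: (loc (iA \c pA)) => [[q [q1 q2]]|[n pn]].
  right; apply/is_zeroE.
  have E : iA \c pA = id_hom X by rewrite -(hcomp1l (iA \c pA)) -q1 -hcompA pp.
  by rewrite -h2 -(hcomp1r pB) -E hcompA h4 hcomp0l hcomp0l.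
left; apply/is_zeroE.
have p0 : iA \c pA = 0.
  case: n pn => [|n] pn; first by case: X0.
  have fn m : kpow (iA \c pA) m.+1 = iA \c pA.
    by elim: m => [|m IH]; rewrite kpowS ?hcomp1r // IH.
  by rewrite -(fn n).
have pA0 : pA = 0 by rewrite -(hcomp1l pA) -h1 -hcompA p0 hcomp0r.
by rewrite -h1 pA0 hcomp0l.
Qed.
End Fitting.

Section Local.
Variables (k : fieldType) (L : falgType k).
Implicit Types X Y : complex L.

Lemma kiso_id X : kiso (id_hom X).
Proof. by exists (id_hom X); rewrite hcomp1l. Qed.

Lemma kpow_linv X (a c : khom X X) n : c \c a = id_hom X -> kpow c n \c kpow a n = id_hom X.
Proof.
move=> ca; elim: n => [|n IH]; first by rewrite hcomp1l.
by rewrite kpowSr kpowS -hcompA (hcompA c) ca hcomp1l.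
Qed.

Lemma local_linv X (a c : khom X X) : local X -> c \c a = id_hom X -> kiso a.
Proof.
move=> [X0 loc] ca; case: (loc a) => // -[n an].
by case: X0; rewrite -(kpow_linv n ca) an hcomp0r.
Qed.

Lemma nilpotent_unit X (a : khom X X) n : kpow a n = 0 -> kiso (id_hom X - a).
Proof.
suff [s [s1 s2]] : exists s, s \c (id_hom X - a) = id_hom X - kpow a n /\
    (id_hom X - a) \c s = id_hom X - kpow a n.
  by move=> an; exists s; rewrite s1 s2 an subr0.
elim: n => [|n [s [s1 s2]]].
  by exists 0; rewrite hcomp0l hcomp0r /kpow /= subrr.
exists (s + kpow a n); rewrite hcompDl (hcompDr (id_hom X - a)) s1 s2.
rewrite hcompBr hcompBl hcomp1l hcomp1r -kpowSr -kpowS.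
by rewrite addrA subrK.
Qed.

Lemma local_nonunitD X (a b : khom X X) : local X -> ~ kiso a -> ~ kiso b -> ~ kiso (a + b).
Proof.
move=> loc na nb [u [u1 u2]].
have E : u \c a + u \c b = id_hom X by rewrite -hcompDr.
have ua : ~ kiso (u \c a).
  by move=> [v [v1 v2]]; apply: na; apply: (local_linv loc (c := v \c u)); rewrite -hcompA.
have [//|[n un]] := loc.2 (u \c a).
have := nilpotent_unit un; rewrite -E addrAC subrr add0r => -[v [v1 v2]].
by apply: nb; apply: (local_linv loc (c := v \c u)); rewrite -hcompA.
Qed.

Lemma not_kiso0 X : id_hom X <> 0 -> ~ kiso (0 : khom X X).
Proof. by move=> X0 [u [u1 _]]; apply: X0; rewrite -u1 hcomp0r. Qed.

Lemma local_nonunitZ X (a : khom X X) c : local X -> ~ kiso a -> ~ kiso (c *: a).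
Proof.
move=> loc na [u [u1 u2]]; apply: na; apply: (local_linv loc (c := c *: u)).
by rewrite hcompZl -hcompZr.
Qed.

Lemma local_idem X (p : khom X X) : local X -> p \c p = p -> p = 0 \/ p = id_hom X.
Proof.
move=> [X0 loc] pp; case: (loc p) => [[u [u1 u2]]|[[|n] pn]].
- by right; rewrite -(hcomp1l p) -u1 -hcompA pp.
- by case: X0.
left; have fn m : kpow p m.+1 = p by elim: m => [|m IH]; rewrite kpowS ?hcomp1r // IH.
by rewrite -(fn n).
Qed.

Lemma local_retract X Y (a : khom X Y) (b : khom Y X) :
  local X -> id_hom Y <> 0 -> a \c b = id_hom Y -> b \c a = id_hom X.
Proof.
move=> loc Y0 ab; case: (local_idem loc (p := b \c a)) => // [|ba0].
  by rewrite -hcompA (hcompA a) ab hcomp1l.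
by case: Y0; rewrite -(hcomp1l (id_hom Y)) -ab -hcompA (hcompA b) ba0 hcomp0l hcomp0r.
Qed.

Lemma local_sepi X Y (a : khom X Y) : local X -> id_hom Y <> 0 -> sepi a -> kiso a.
Proof. by move=> loc Y0 [b ab]; exists b; split=> //; apply: local_retract ab. Qed.

Lemma local_smono X Y (b : khom Y X) : local X -> id_hom Y <> 0 -> smono b -> kiso b.
Proof. by move=> loc Y0 [a ab]; exists a; split=> //; apply: local_retract ab. Qed.

Lemma local_iso X Y : iso X Y -> local X -> local Y.
Proof.
move=> [u [v [vu uv]]] [X0 loc]; split=> [Y0|a].
  by apply: X0; apply: iso_zero Y0; exists v, u.
have E n : kpow (v \c a \c u) n = v \c kpow a n \c u.
  elim: n => [|n IH]; first by rewrite /kpow /= hcomp1r vu.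
  by rewrite [LHS]kpowS IH -!hcompA (hcompA u) uv hcomp1l.
have F b : b = u \c (v \c b \c u) \c v.
  by rewrite !hcompA uv hcomp1l -hcompA uv hcomp1r.
case: (loc (v \c a \c u)) => [[w [w1 w2]]|[n an]].
  left; rewrite (F a); apply: kiso_comp; last by exists u.
  by apply: kiso_comp; [exists v | exists w].
by right; exists n; rewrite (F (kpow a n)) -E an hcomp0r hcomp0l.
Qed.

Lemma local_shift n X : local X -> local (shift n X).
Proof.
move=> [X0 loc]; split=> [/unzero_shift //|a].
have [b <-] := Sh_surj a.
have E m : kpow (Sh n b) m = Sh n (kpow b m).
  by elim: m => [|m IH]; rewrite ?Sh_id // kpowS IH -Sh_comp.
case: (loc b) => [[w [w1 w2]]|[m bm]].
  by left; exists (Sh n w); rewrite -!Sh_comp w1 w2 Sh_id.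
by right; exists m; rewrite E bm linear0.
Qed.
End Local.

Lemma dim_inj (k : fieldType) (V W : vectType k) (f : {linear V -> W}) :
  injective f -> (\dim {: V} <= \dim {: W})%N.
Proof.
move=> fi; have <- : \dim (linfun f @: fullv) = \dim {: V}.
  apply: limg_dim_eq; rewrite capfv; apply/eqP/lker0P => x y.
  by rewrite !lfunE; apply: fi.
exact/dimvS/subvf.
Qed.

(** * Dimensions of morphism spaces and functionals on endomorphism rings *)

Section Dimensions.
Variables (k : fieldType) (L : falgType k).
Implicit Types X Y Z W A B : pc L.

Definition psh n X : pc L := PC (perfect_shift n (pcP X)).
Definition psum X Y : pc L := PC (perfect_dsum (pcP X) (pcP Y)).

Lemma hd_shift n X Y : hd (psh n X) (psh n Y) = hd X Y.
Proof.
apply/eqP; rewrite eqn_leq; apply/andP; split; last first.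
  exact: (@dim_inj k (phom X Y) (phom (psh n X) (psh n Y)) (@Sh _ _ n X Y) (@Sh_inj _ _ n X Y)).
have [g gP] := boolp.choice (@Sh_surj _ _ n X Y).
have Hg : linear (g : phom (psh n X) (psh n Y) -> phom X Y).
  by move=> a x y; apply: (@Sh_inj _ _ n X Y); rewrite gP (linearP (@Sh _ _ n X Y)) /= !gP.
apply: (dim_inj (f := mklin Hg)) => x y /= /(congr1 (@Sh _ _ n X Y)); by rewrite !gP.
Qed.

Lemma hd_isol X X' Y : iso X X' -> (hd X Y <= hd X' Y)%N.
Proof.
move=> [a [b [ba ab]]].
apply: (@dim_inj k (phom X Y) (phom X' Y) (@hcompr _ _ X' X Y b)) => x y.
by move=> /= /(congr1 (hcompr a)); rewrite /hcompr -!hcompA ba !hcomp1r.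
Qed.
Lemma hd_isor X Y Y' : iso Y Y' -> (hd X Y <= hd X Y')%N.
Proof.
move=> [a [b [ba ab]]].
apply: (@dim_inj k (phom X Y) (phom X Y') (@hcomp _ _ X Y Y' a)) => x y.
by move=> /= /(congr1 (hcomp b)); rewrite !hcompA ba !hcomp1l.
Qed.
Lemma hd_iso X X' Y Y' : iso X X' -> iso Y Y' -> hd X Y = hd X' Y'.
Proof.
move=> h1 h2; apply/eqP; rewrite eqn_leq.
rewrite (leq_trans (hd_isol _ h1) (hd_isor _ h2)).
by rewrite (leq_trans (hd_isol _ (iso_sym h1)) (hd_isor _ (iso_sym h2))).
Qed.

Lemma hd_bip X Y A B : bip Y A B -> hd X Y = (hd X A + hd X B)%N.
Proof.
move=> [iA [iB [pA [pB [h1 h2 h3 h4 h5]]]]].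
have -> : (hd X A + hd X B)%N = \dim {: (phom X A * phom X B)%type}.
  by rewrite /hd !dimvf.
apply/eqP; rewrite eqn_leq; apply/andP; split.
  have H : linear (fun a : phom X Y => (pA \c a, pB \c a) : (phom X A * phom X B)%type).
    by move=> c x y; rewrite !linearP.
  apply: (dim_inj (f := mklin H)) => x y /= E.
  have /= e1 := congr1 fst E; have /= e2 := congr1 snd E.
  by rewrite -(hcomp1l x) -(hcomp1l y) -h5 !hcompDl -!hcompA e1 e2.
have H : linear (fun a : (phom X A * phom X B)%type => iA \c a.1 + iB \c a.2 : phom X Y).
  by move=> c x y; rewrite /= !linearP scalerDr addrACA.
apply: (dim_inj (f := mklin H)) => -[x1 x2] [y1 y2] /= E; congr pair.
  move/(congr1 (hcomp pA)): E.
  by rewrite !hcompDr !hcompA h1 h3 !hcomp0l !hcomp1l !addr0.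
move/(congr1 (hcomp pB)): E.
by rewrite !hcompDr !hcompA h2 h4 !hcomp0l !hcomp1l !add0r.
Qed.

Lemma hd_eq0 X Y : hd X Y = 0%N <-> forall a : khom X Y, a = 0.
Proof.
split=> [/eqP H a|H].
  have : (a : phom X Y) \in fullv by exact: memvf.
  by move: H; rewrite /hd dimv_eq0 => /eqP ->; rewrite memv0 => /eqP.
apply/eqP; rewrite dimv_eq0 -subv0; apply/subvP => a _.
by rewrite memv0; apply/eqP/H.
Qed.

Lemma hd_id0 X : hd X X = 0%N <-> id_hom X = 0.
Proof.
rewrite hd_eq0; split=> [//|X0 a]; by rewrite -(hcomp1l a) X0 hcomp0l.
Qed.

Lemma hom_dimE X Y n : hom_dim X Y n <-> hd X Y = n.
Proof.
have clsum (m : nat) (b : 'I_m -> chain_map X Y) (c : 'rV[k]_m) (f : chain_map X Y) :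
    null_homotopic (fun i (x : X i) => f i x - \sum_j (c 0 j)%:A *: b j i x) <->
    cls f = \sum_j c 0 j *: cls (b j).
  pose g s := foldr (fun j h => add_map (scale_map (c 0 j) (b j)) h) (zero_map X Y) s.
  have gE s : cls (g s) = \sum_(j <- s) c 0 j *: cls (b j).
    by elim: s => [|j s IH]; rewrite ?big_nil // big_cons -IH clsZ clsD.
  have gC s i x : g s i x = \sum_(j <- s) (c 0 j)%:A *: b j i x.
    by elim: s => [|j s IH]; rewrite ?big_nil ?big_cons //= -IH.
  rewrite -gE; split=> [H|/cls_eqP].
    by apply/cls_eqP; apply: nh_ext H => i x; rewrite gC.
  by apply: nh_ext => i x; rewrite gC.
split=> [[b hb]|hn].
  have Hf : linear (fun c : 'rV[k]_n => \sum_j c 0 j *: cls (b j) : phom X Y).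
    move=> a x y; rewrite scaler_sumr -big_split; apply: eq_bigr => j _.
    by rewrite !mxE scalerDl scalerA.
  have ex (a : phom X Y) : exists c : 'rV[k]_n, a = \sum_j c 0 j *: cls (b j).
    elim/homW: a => f; have [c [/clsum hc _]] := hb f; by exists c.
  have inj : injective (mklin Hf).
    move=> c d /= E; have : exists f, cls f = \sum_j c 0 j *: cls (b j).
      by exists (krep (\sum_j c 0 j *: cls (b j))); rewrite krepK.
    move=> [f fE]; have [e [_ he]] := hb f.
    by rewrite -(he c) ?(he d) //; apply/clsum; rewrite ?fE.
  have [g gP] := boolp.choice ex.
  have Hg : linear g by move=> a x y; apply: inj; rewrite linearP /= -!gP.
  have dn : \dim {: 'rV[k]_n} = n by rewrite dimvf /dim /= mul1n.
  have le1 := dim_inj inj.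
  have le2 : (\dim {: phom X Y} <= \dim {: 'rV[k]_n})%N.
    by apply: (dim_inj (f := mklin Hg)) => x y /= E; rewrite (gP x) (gP y) E.
  by apply/eqP; rewrite eqn_leq; move: le1 le2; rewrite dn /hd => -> ->.
rewrite -hn; pose v := vbasis {: phom X Y}.
exists (fun j => krep (v`_j : khom X Y)) => f.
have vE (c : 'rV[k]_(\dim {: phom X Y})) : \sum_j c 0 j *: cls (krep (v`_j : khom X Y)) = \sum_j c 0 j *: v`_j :> phom X Y.
  by apply: eq_bigr => j _; rewrite krepK.
exists (\row_j coord v j (cls f : phom X Y)); split.
  apply/clsum; rewrite vE [LHS](coord_vbasis (memvf (cls f : phom X Y))).
  by apply: eq_bigr => j _; rewrite mxE.
move=> c /clsum; rewrite vE => ->; apply/rowP => j; rewrite mxE.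
by rewrite coord_sum_free // (basis_free (vbasisP _)).
Qed.

Lemma hd_sym (t : symform L) X Y : hd X Y = hd Y X.
Proof.
suff le (U V : pc L) : (hd U V <= hd V U)%N by apply/eqP; rewrite eqn_leq !le.
have -> : hd V U = \dim {: 'Hom(phom V U, k^o)}.
  by rewrite /hd !dimvf /dim /= muln1.
have H1 (a : phom U V) : linear (fun b : phom V U => tau t (b \c a) : k^o).
  by move=> c x y; rewrite hcompDl hcompZl linearP.
have H2 : linear (fun a : phom U V => linfun (mklin (H1 a))).
  move=> c x y; apply/lfunP => b; rewrite add_lfunE scale_lfunE !lfunE /=.
  by rewrite !linearP.
apply: (dim_inj (f := mklin H2)) => x y /lfunP E; apply/eqP; rewrite -subr_eq0.
apply/negPn/negP => /(tau_nondeg t) [b /eqP]; apply.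
by have := E b; rewrite !lfunE /= linearB linearB /= => ->; rewrite subrr.
Qed.

Lemma tau_represent (t : symform L) X (l : {linear phom X X -> k^o}) :
  exists x : khom X X, forall y, tau t (x \c y) = l y.
Proof.
have H1 (a : phom X X) : linear (fun b : phom X X => tau t (a \c b) : k^o).
  by move=> c x y; rewrite hcompDr hcompZr linearP.
have H2 : linear (fun a : phom X X => linfun (mklin (H1 a))).
  move=> c x y; apply/lfunP => b; rewrite add_lfunE scale_lfunE !lfunE /=.
  by rewrite hcompDl hcompZl linearP.
pose f := linfun (mklin H2).
have fE x y : f x y = tau t (x \c y) by rewrite /f lfunE; apply: (lfunE (mklin (H1 x)) y).
have inj : injective f.
  move=> x y /lfunP E; apply/eqP; rewrite -subr_eq0.
  apply/negPn/negP => /(tau_nondeg t) [b /eqP]; apply.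
  by rewrite tauC hcompBl linearB /= -!fE E subrr.
have fF : limg f = fullv.
  apply/eqP; rewrite eqEdim subvf limg_dim_eq.
    by rewrite !dimvf /dim /= muln1.
  by rewrite capfv; apply/eqP/lker0P.
have : linfun l \in limg f by rewrite fF memvf.
by move=> /memv_imgP [x _ E]; exists x => y; rewrite -fE -E lfunE.
Qed.

(** The nonunits of a local endomorphism ring form a subspace that misses the identity. *)
Lemma nonunit_functional X : local X -> exists l : {linear phom X X -> k^o},
  l (id_hom X) != 0 /\ forall a, ~ kiso a -> l a = 0.
Proof.
move=> loc; apply: (@separating_functional k (phom X X) (fun a => ~ @kiso _ _ X X a)).
- exact: not_kiso0 loc.1.
- move=> c u v nu nv; apply: local_nonunitD => //; exact: local_nonunitZ.
by move=> H; apply: H; exact: kiso_id.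
Qed.
End Dimensions.

(* So a local object has residue field [k]. *)
Lemma nonunit_eigenvalue (k : closedFieldType) (L : falgType k) (X : pc L) (a : khom X X) :
  id_hom X <> 0 -> exists c : k, ~ kiso (a - c *: id_hom X).
Proof.
move=> X0; pose b := vbasis {: phom X X}.
pose M : 'M[k]_(\dim {: phom X X}) := \matrix_(i, j) coord b j (a \c b`_i : phom X X).
have /closed_rootP [c] : size (char_poly M) != 1%N.
  rewrite size_char_poly; apply/eqP => -[/hd_id0]; exact: X0.
rewrite -eigenvalue_root_char => /eigenvalueP [v vM v0].
exists c => -[u [u1 _]]; pose x : phom X X := \sum_i v 0 i *: b`_i.
have ax : a \c x = c *: x.
  rewrite /x linear_sum scaler_sumr.
  transitivity (\sum_i \sum_j (v 0 i * M i j) *: (b`_j : phom X X)).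
    apply: eq_bigr => i _; rewrite /= (@hcompZr _ _ X X X (v 0 i) a b`_i) [X in _ *: X](coord_vbasis (memvf (a \c b`_i : phom X X))).
    by rewrite scaler_sumr; apply: eq_bigr => j _; rewrite mxE scalerA.
  rewrite exchange_big; apply: eq_bigr => j _ /=; rewrite -scaler_suml scalerA; congr (_ *: _).
  by move/rowP/(_ j): vM; rewrite !mxE.
have x0 : x = 0.
  by rewrite -(hcomp1l x) -u1 -hcompA hcompBl hcompZl hcomp1l ax subrr hcomp0r.
case/eqP: v0; apply/rowP => i; rewrite mxE.
by rewrite -(coord_sum_free (fun i => v 0 i) i (basis_free (vbasisP {: phom X X}))) -/b -/x x0 linear0.
Qed.

(** * Auslander-Reiten triangles *)

Section AR.
Variables (k : closedFieldType) (L : falgType k).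
Implicit Types X Y Z W V A B : pc L.

Definition AR Z Y := AR_triangle (shift (-1) Z) Y Z.

Lemma kiso_sepi X Y (a : khom X Y) : kiso a -> sepi a.
Proof. by move=> [b [_ ab]]; exists b. Qed.

Lemma AR_data Z Y : AR Z Y -> local Z /\
  exists (f : khom (psh (-1) Z) Y) (g : khom Y Z) (h : khom Z (psh 1 (psh (-1) Z))),
  [/\ @tri _ _ (psh (-1) Z) Y Z f g h, h <> 0
    & forall W (w : khom W Z), ~ sepi w -> exists v, g \c v = w].
Proof.
move=> [[_ pY pZ _ iZ] [f [g [h [d hn H]]]]]; split; first exact: indecomposable_local.
exists (cls f), (cls g), (cls h); split; first exact: dist_tri.
  by move/cls_eq0.
move=> W; elim/homW => w nw; have [|v hv] := H W w (pcP W); first by move/split_epiE.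
by exists (cls v); rewrite hcompE; apply/cls_eqP.
Qed.

Lemma AR_local Z Y : AR Z Y -> local Z.
Proof. by case/AR_data. Qed.

Lemma AR_iso Z Y Y' : iso Y Y' -> AR Z Y -> AR Z Y'.
Proof.
move=> [b [b' []]]; elim/homW: b => b; elim/homW: b' => b'.
rewrite !hcompE => /cls_eqP b1 /cls_eqP b2.
move=> [[pX pY pZ iX iZ] [f [g [h [d hn H]]]]]; split; first by split=> //; exact: pcP.
have B : homotopy_equivalence b' by exists b.
exists (comp_map b f), (comp_map g b'), h; split=> //.
  case: d => [A [B' [u [a [c [e [[h1 h2 h3] [/cls_eqP e1 /cls_eqP e2 e3]]]]]]]].
  exists A, B', u, a, (comp_map c b'), e; split; split=> //.
  - apply/homotopy_equivalenceE; rewrite -hcompE; apply: kiso_comp; exact/homotopy_equivalenceE.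
  - apply/cls_eqP; rewrite -!hcompE -hcompA (hcompA (cls b')) (hcompE b' b).
    move/cls_eqP: b1 => ->; rewrite -[cls (id_map Y)]/(id_hom Y) hcomp1l !hcompE; exact: e1.
  apply/cls_eqP; rewrite -!hcompE !hcompA; congr (_ \c _); rewrite !hcompE; exact: e2.
move=> W w pW nw; have [v hv] := H W w pW nw; exists (comp_map b v); apply/cls_eqP.
rewrite -!hcompE -hcompA (hcompA (cls b')) (hcompE b' b).
move/cls_eqP: b1 => ->; rewrite -[cls (id_map Y)]/(id_hom Y) hcomp1l hcompE.
exact/cls_eqP.
Qed.

Section Existence.
Variable t : symform L.

(** Represent by x, through [tau], a functional l that kills nonunits but not the identity. For w
    not a split epimorphism every w b is a nonunit, so x w pairs to zero with all b and vanishes.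
    Hence w lifts through the cocone of x, while x is nonzero. *)
Lemma AR_exists Z : local Z -> exists Y, AR Z Y.
Proof.
move=> loc; have [l [l1 l0]] := nonunit_functional loc.
have [x xl] := tau_represent t l.
have kill W (w : khom W Z) : ~ sepi w -> x \c w = 0.
  move=> nw; apply/eqP/negPn/negP => /(tau_nondeg t) [b].
  rewrite tauC -hcompA xl => /eqP; apply; apply: l0 => /kiso_sepi [c wc].
  by apply: nw; exists (b \c c); rewrite hcompA.
have [s [s' [s1 s2]]] : iso Z (shift 1 (shift (-1) Z)) by apply: iso_sym; apply: shiftK.
pose h := krep (s \c x); have hE : cls h = s \c x by rewrite krepK.
have pX : perfect (shift (-1) Z) by apply/perfect_shift/pcP.
exists (PC (perfect_cocone h pX (pcP Z))); split.
  split=> //; [exact: perfect_cocone (pcP Z)|exact: pcP| |].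
    by apply: local_indecomposable; apply: local_shift.
  exact: local_indecomposable.
exists (cocone_in h), (cocone_out h), h; split; first exact: cocone_dist.
  move/cls_eq0; rewrite hE => sx.
  have x0 : x = 0 by rewrite -(hcomp1l x) -s1 -hcompA sx hcomp0r.
  by case/eqP: l1; rewrite -xl x0 hcomp0l linear0.
move=> W w pW nw.
have [|v vP] := tri_ex1 (dist_tri (cocone_dist h)) (a := cls w).
  rewrite hE -hcompA (kill (PC pW)) ?hcomp0r //; move/split_epiE; exact: nw.
by exists (krep v); apply/cls_eqP; rewrite -hcompE krepK.
Qed.
End Existence.

Section Mesh.
Variables (Z Y : pc L) (f : khom (psh (-1) Z) Y) (g : khom Y Z) (h : khom Z (psh 1 (psh (-1) Z))).
Hypotheses (T : @tri _ _ (psh (-1) Z) Y Z f g h) (hn : h <> 0) (lZ : local Z).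
Hypothesis ras : forall W (w : khom W Z), ~ sepi w -> exists v, g \c v = w.

Definition postc W A B (a : khom A B) : 'Hom(phom W A, phom W B) :=
  linfun (@hcomp _ _ W A B a : phom W A -> phom W B).
Lemma postcE W A B (a : khom A B) (x : khom W A) : postc W a x = a \c x.
Proof. exact: (lfunE (@hcomp _ _ W A B a : {linear phom W A -> phom W B})). Qed.

(** h kills every map that is not a split epimorphism, and a split epimorphism from a local W onto Z
    is an isomorphism. If there is one, every endomorphism of W is a scalar plus a nonunit, so the
    image is a line. *)
Lemma rank_connecting W : local W -> \dim (limg (postc W h)) = `[< iso W Z >].
Proof.
move=> lW.
have kill (w : khom W Z) : ~ sepi w -> h \c w = 0.
  by move=> /ras [v <-]; rewrite hcompA (tri_gh T) hcomp0l.
case: (asboolP (iso W Z)) => [[u [u' [u1 u2]]]|nWZ].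
  have -> : limg (postc W h) = <[h \c u : phom W (psh 1 (psh (-1) Z))]>%VS.
    apply/eqP; rewrite eqEsubv; apply/andP; split; last first.
      by rewrite -memvE -postcE memv_img ?memvf.
    apply/subvP => _ /memv_imgP [w _ ->]; rewrite postcE.
    have [c nc] := nonunit_eigenvalue (u' \c w) lW.1.
    suff E : h \c (u \c (u' \c w - c *: id_hom W)) = 0.
      move: E; rewrite !hcompBr hcompZr hcomp1r (hcompA u) u2 hcomp1l hcompZr => /eqP.
      by rewrite subr_eq0 => /eqP ->; rewrite rpredZ // memv_line.
    apply: kill => se; apply: nc.
    have E (b : khom W W) : b = u' \c (u \c b) by rewrite hcompA u1 hcomp1l.
    rewrite (E (u' \c w - _)).
    apply: kiso_comp; first by exists u.
    exact: (local_sepi lW lZ.1 se).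
  rewrite dim_vline; apply/eqP; rewrite eqb1; apply/eqP => hu; apply: hn.
  by rewrite -(hcomp1r h) -u2 hcompA hu hcomp0l.
apply/eqP; rewrite dimv_eq0 -subv0; apply/subvP => _ /memv_imgP [w _ ->].
rewrite postcE memv0; apply/eqP; apply: kill => se; apply: nWZ.
by exists w; exact: (local_sepi lW lZ.1 se).
Qed.

(** Count dimensions along Hom(W, X) -> Hom(W, Y) -> Hom(W, Z) with X = Z[-1]. The cokernel on the
    right has the rank of h on Hom(W, Z); the kernel on the left is, after a shift, the image of h
    on Hom(W[1], Z). *)
Lemma mesh_tri W : local W ->
  (hd W Y + `[< iso W Z >] + `[< iso (psh 1 W) Z >] = hd W (psh (-1) Z) + hd W Z)%N.
Proof.
move=> lW; have lW1 : local (psh 1 W) by exact: local_shift.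
rewrite -(rank_connecting lW) -(rank_connecting lW1).
have E1 : lker (postc W g) = limg (postc W f).
  apply/eqP; rewrite eqEsubv; apply/andP; split; apply/subvP => x.
    rewrite memv_ker postcE => /eqP /(tri_ex2 T) [y ->].
    by rewrite -postcE memv_img ?memvf.
  move=> /memv_imgP [y _ ->]; rewrite memv_ker !postcE hcompA (tri_fg T).
  by apply/eqP; exact: hcomp0l.
have E2 : lker (postc W h) = limg (postc W g).
  apply/eqP; rewrite eqEsubv; apply/andP; split; apply/subvP => x.
    rewrite memv_ker postcE => /eqP /(tri_ex1 T) [y ->].
    by rewrite -postcE memv_img ?memvf.
  move=> /memv_imgP [y _ ->]; rewrite memv_ker !postcE hcompA (tri_gh T).
  by apply/eqP; exact: hcomp0l.
pose S : 'Hom(phom W (psh (-1) Z), phom (psh 1 W) (psh 1 (psh (-1) Z))) :=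
  linfun (@Sh _ _ 1 W (psh (-1) Z) : {linear phom W (psh (-1) Z) -> phom (psh 1 W) (psh 1 (psh (-1) Z))}).
have SE x : S x = Sh 1 x by rewrite /S lfunE.
have E3 : \dim (lker (postc W f)) = \dim (limg (postc (psh 1 W) h)).
  have <- : (S @: lker (postc W f))%VS = limg (postc (psh 1 W) h).
    apply/eqP; rewrite eqEsubv; apply/andP; split; apply/subvP => _ /memv_imgP [x xk ->].
      move: xk; rewrite memv_ker postcE SE => /eqP /(tri_ex3 T) [y ->].
      by rewrite -(@postcE (psh 1 W) _ _ h y) memv_img ?memvf.
    rewrite postcE; have [y yE] := Sh_surj (h \c x).
    rewrite -yE -SE memv_img // memv_ker postcE; apply/eqP.
    apply: (@Sh_inj _ _ 1); rewrite Sh_comp yE hcompA (tri_hf T) linear0; exact: hcomp0l.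
  symmetry; apply: limg_dim_eq; apply/eqP; rewrite -subv0; apply/subvP => x.
  rewrite memv_cap memv0 [x \in lker S]memv_ker SE => /andP[_ /eqP H].
  by apply/eqP/(@Sh_inj _ _ 1); rewrite H linear0.
have := limg_ker_dim (postc W g) fullv; have := limg_ker_dim (postc W h) fullv.
have := limg_ker_dim (postc W f) fullv; rewrite !capfv E1 E2 E3 /hd => <- <- <-.
by rewrite addnC !addnA.
Qed.

(** If s does not factor through f, then s[1] h is nonzero and pairs with some b, so h (b s[1]) is
    nonzero. As h kills all maps that are not split epimorphisms, b s[1] is one, hence invertible,
    and s is a split monomorphism. *)
Lemma left_almost_split (t : symform L) V (s : khom (psh (-1) Z) V) :
  ~ smono s -> exists v, s = v \c f.
Proof.
move=> ns; apply: (tri_coex3 T); apply/eqP/negPn/negP => H.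
pose s1 : khom (psh 1 (psh (-1) Z)) (psh 1 V) := Sh 1 s.
have [b hb] := tau_nondeg t (X := Z) (Y := psh 1 V) (a := s1 \c h) H.
have hb' : tau t (h \c (b \c s1)) != 0 by rewrite tauC -hcompA.
case: (pselect (sepi (b \c s1))) => [se|/ras[v vE]]; last first.
  by case/eqP: hb'; rewrite -vE hcompA (tri_gh T) hcomp0l linear0.
have lX : local (psh 1 (psh (-1) Z)) by do 2!apply: local_shift.
have [c [c1 _]] := local_sepi lX lZ.1 se.
apply: ns; have [r rE] := @Sh_surj _ _ 1 V (psh (-1) Z) (c \c b).
by exists r; apply: (@Sh_inj _ _ 1); rewrite Sh_comp rE -hcompA [LHS]c1 Sh_id.
Qed.

Lemma AR_f_not_smono : ~ smono f.
Proof.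
move=> [r rf]; apply: hn.
by rewrite -(hcomp1l h) -Sh_id -rf Sh_comp -hcompA (tri_hf T) hcomp0r.
Qed.

Lemma AR_g_not_sepi : ~ sepi g.
Proof. by move=> [s gs]; apply: hn; rewrite -(hcomp1r h) -gs hcompA (tri_gh T) hcomp0l. Qed.

(* The source of an irreducible map into a summand [V] of the middle term is
   itself a summand of the middle term belonging to [V]. *)
Lemma AR_summand_tri (t : symform L) V A (E : pc L) (g' : khom E V) : local V -> bip Y V A ->
  ~ sepi g' -> (forall W (w : khom W V), ~ sepi w -> exists v, g' \c v = w) ->
  exists B, bip E (psh (-1) Z) B.
Proof.
move=> lV [i [iA [p [pA [h1 h2 h3 h4 h5]]]]] ng' ras'.
have lX : local (psh (-1) Z) by apply: local_shift.
have npf : ~ sepi (p \c f).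
  move=> /(local_sepi lX lV.1) [c [c1 _]]; apply: AR_f_not_smono.
  by exists (c \c p); rewrite -hcompA.
have [s gs] := ras' _ _ npf.
have [r rs] : smono s.
  (* Otherwise s = v f, so p - g' v kills f and equals some q g. Then the identity p i of V is g' v
     i + q g i, a sum of two nonunits. *)
  apply: contrapT => ns; have [v vE] := left_almost_split t ns.
  have H : (p - g' \c v) \c f = 0 by rewrite hcompBl -hcompA -vE gs subrr.
  have [q qE] := tri_coex1 T H.
  have n1 : ~ kiso (g' \c v \c i).
    by move=> [c [_ c2]]; apply: ng'; exists (v \c i \c c); rewrite !hcompA.
  have n2 : ~ kiso (q \c g \c i).
    move=> [c [c1 _]]; apply: AR_g_not_sepi.
    have [d [_ d2]] : kiso (g \c i).
      apply: (local_smono lZ lV.1); exists (c \c q).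
      by rewrite -(hcompA c q) (hcompA q).
    by exists (i \c d); rewrite hcompA.
  apply: (local_nonunitD lV n1 n2).
  rewrite -qE -hcompDl addrC subrK h1; exact: kiso_id.
have [|A' [B [jA [jB [qA [qB [e1 e2 e3 e4 [e5 e6]]]]]]]] := @idempotent_split _ _ E (s \c r).
  by rewrite -hcompA (hcompA r) rs hcomp1l.
exists B; apply: (@bip_isol _ _ _ A'); last by exists jA, jB, qA, qB.
exists (r \c jA), (qA \c s); split.
  by rewrite -hcompA (hcompA s) -e6 -hcompA e1 hcomp1r e1.
by rewrite -hcompA (hcompA jA) e6 -hcompA rs hcomp1r.
Qed.
End Mesh.

Lemma mesh Z Y W : AR Z Y -> local W ->
  (hd W Y + `[< iso W Z >] + `[< iso (psh 1 W) Z >] = hd W (psh (-1) Z) + hd W Z)%N.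
Proof. by move=> /AR_data [lZ [f [g [h [T hn ras]]]]]; apply: (mesh_tri T). Qed.

Lemma AR_summand (t : symform L) Z Y V A Y' : AR Z Y -> bip Y V A -> AR V Y' ->
  exists B, bip Y' (psh (-1) Z) B.
Proof.
move=> /AR_data [lZ [f [g [h [T hn ras]]]]] bY /AR_data [lV [f' [g' [h' [T' hn' ras']]]]].
exact: (AR_summand_tri T hn lZ ras t lV bY (AR_g_not_sepi T' hn') ras').
Qed.

(** The map g'[-1] has for V[-1] the lifting property that g' has for V, so [AR_summand_tri] applies
    to it; the resulting summand is shifted back. *)
Lemma AR_summand_shift (t : symform L) Z Y V A Y' : AR Z Y -> bip Y (psh (-1) V) A -> AR V Y' ->
  exists B, bip Y' Z B.
Proof.
move=> /AR_data [lZ [f [g [h [T hn ras]]]]] bY /AR_data [lV [f' [g' [h' [T' hn' ras']]]]].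
have ng : ~ sepi (Sh (-1) g').
  move=> [c]; have [b <-] := Sh_surj c; rewrite -Sh_comp -Sh_id => /Sh_inj gb.
  by apply: (AR_g_not_sepi T' hn'); exists b.
have lV1 : local (psh (-1) V) by apply: local_shift.
have [|B bB] := @AR_summand_tri _ _ _ _ _ T hn lZ ras t (psh (-1) V) A (psh (-1) Y') _ lV1 bY ng.
  move=> W w nw; have [th [th' [t1 t2]]] : iso (psh (-1) (psh 1 W)) W by apply: shiftK.
  have [w' w'E] := Sh_surj (w \c th).
  have [|v vE] := ras' _ w'.
    move=> [c cE]; apply: nw; exists (th \c Sh (-1) c).
    by rewrite hcompA -w'E -Sh_comp cE Sh_id.
  exists (Sh (-1) v \c th'); rewrite hcompA -Sh_comp vE w'E -hcompA t2.
  exact: hcomp1r.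
exists (psh 1 B).
have K X : iso (psh 1 (psh (-1) X)) X by apply: shiftK.
apply: (bip_isol (K Z)); apply: (bip_isoX (K Y')); exact: bip_shift.
Qed.

(** By duality some b h is a nonzero scalar, and so is h b. Hence h is invertible, f and g vanish,
    and exactness leaves nothing in the middle. *)
Lemma AR_simple (t : symform L) Z Y : AR Z Y -> hd Z Z = 1%N -> id_hom Y = 0.
Proof.
move=> /AR_data [lZ [f [g [h [T hn _]]]]] hZ.
have K : iso Z (psh 1 (psh (-1) Z)) by apply/iso_sym/shiftK.
have scal X (a : khom X X) : hd X X = 1%N -> id_hom X <> 0 -> exists c : k, a = c *: id_hom X.
  move=> hX X0; have /vlineP [c cE] : (a : phom X X) \in <[id_hom X : phom X X]>%VS.
    have -> : <[id_hom X : phom X X]>%VS = fullv; last exact: memvf.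
    apply/eqP; rewrite eqEdim subvf dim_vline -[\dim _]/(hd X X) hX lt0b.
    exact/eqP.
  by exists c.
have [b hb] := tau_nondeg t (X := Z) (Y := psh 1 (psh (-1) Z)) (introN eqP hn).
have [c cE] := scal _ (b \c h) hZ lZ.1.
have c0 : c != 0.
  by apply/eqP => c0; case/eqP: hb; rewrite cE c0 scale0r linear0.
have g0 : g = 0.
  have : b \c h \c g = 0 by rewrite -hcompA (tri_gh T) hcomp0r.
  by rewrite cE hcompZl hcomp1l => /eqP; rewrite scaler_eq0 (negbTE c0) => /eqP.
have lX1 := local_iso K lZ.
have [d dE] := scal (psh 1 (psh (-1) Z)) (h \c b) (etrans (esym (hd_iso K K)) hZ) lX1.1.
have d0 : d != 0.
  by apply/eqP => d0; case/eqP: hb; rewrite tauC dE d0 scale0r linear0.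
have f0 : f = 0.
  apply: (@Sh_inj _ _ 1); rewrite linear0.
  have : Sh 1 f \c h \c b = 0 by rewrite (tri_hf T) hcomp0l.
  by rewrite -hcompA dE hcompZr hcomp1r => /eqP; rewrite scaler_eq0 (negbTE d0) => /eqP.
have [|x ->] := tri_ex2 T (a := id_hom Y); first by rewrite g0 hcomp0l.
by rewrite f0 hcomp0l.
Qed.
End AR.

(** * Dimensions in all degrees and their sum *)

Section GradedDimensions.
Variables (k : closedFieldType) (L : falgType k).
Implicit Types X Y Z W V A B : pc L.

Definition hdi X Y (i : int) : nat := hd X (psh i Y).

Lemma psh0 X : iso (psh 0 X) X. Proof. exact: shift0. Qed.
Lemma psh_add i j X : iso (psh i (psh j X)) (psh (i + j) X). Proof. exact: shift_shift. Qed.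
Lemma psh_iso i X Y : iso X Y -> iso (psh i X) (psh i Y). Proof. exact: iso_shift. Qed.

Lemma hdi_iso X X' Y Y' i : iso X X' -> iso Y Y' -> hdi X Y i = hdi X' Y' i.
Proof. by move=> h1 h2; apply: hd_iso => //; apply: psh_iso. Qed.

Lemma hdi_shiftr X Y i j : hdi X (psh j Y) i = hdi X Y (i + j).
Proof. by apply: hd_iso; [exact: iso_refl | exact: psh_add]. Qed.

Lemma hdi_shiftl X Y i j : hdi (psh j X) Y i = hdi X Y (i - j).
Proof.
rewrite /hdi -(hd_shift j X); apply: hd_iso; first exact: iso_refl.
by apply: iso_sym; apply: iso_trans (psh_add _ _ _) _; rewrite addrC subrK; apply: iso_refl.
Qed.

Lemma hdi0 X Y : hdi X Y 0 = hd X Y.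
Proof. by apply: hd_iso; [exact: iso_refl | exact: psh0]. Qed.

Lemma hdi_bip X Y A B i : bip Y A B -> hdi X Y i = (hdi X A i + hdi X B i)%N.
Proof. by move=> H; apply: hd_bip; exact: bip_shift. Qed.

Lemma hdi_sym (t : symform L) X Y i : hdi X Y i = hdi Y X (- i).
Proof. by rewrite /hdi (hd_sym t) -hdi0 hdi_shiftl sub0r. Qed.

Definition bnd X Y := (fN (pframe X) + fN (pframe Y))%N.
Lemma hdi_bnd X Y i : (bnd X Y < `|i|)%N -> hdi X Y i = 0%N.
Proof.
move=> iN; apply/hd_eq0; elim/homW => f; apply: (@clsE _ _ _ _ _ (zero_map _ _)) => j x.
have [jN|jN] := leqP `|j|%N (fN (pframe X)).
  by apply: (fZ (f := pframe Y)); move: iN; rewrite /bnd; lia.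
by rewrite [x](fZ (f := pframe X)) // linear0.
Qed.

Lemma shift_iso_swap X Y i : iso X (psh i Y) -> iso (psh (- i) X) Y.
Proof.
move=> /(psh_iso (- i)) H; apply: iso_trans H _; apply: iso_trans (psh_add _ _ _) _.
by rewrite addNr; apply: psh0.
Qed.

(** A period would repeat the nonzero space Hom(X, X) in arbitrarily high degrees, against
    boundedness. *)
Lemma nonperiodic X i : id_hom X <> 0 -> iso X (psh i X) -> i = 0.
Proof.
move=> X0 Xi; apply/eqP/negPn/negP => i0.
have Xn (n : nat) : iso X (psh (i * n%:Z) X).
  elim: n => [|n IH]; first by rewrite mulr0; apply/iso_sym/psh0.
  apply: iso_trans Xi _; apply: iso_trans (psh_iso i IH) _.
  by apply: iso_trans (psh_add _ _ _) _; rewrite -addn1 PoszD mulrDr mulr1 addrC; apply: iso_refl.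
have : hdi X X (i * (bnd X X).+1%:Z) = hd X X.
  by apply: hd_iso; [exact: iso_refl|apply/iso_sym/Xn].
rewrite hdi_bnd; first by move/esym/hd_id0.
rewrite abszM absz_nat; apply: leq_pmull; lia.
Qed.

Lemma mesh_hdi Z Y W i : AR Z Y -> local W ->
  (hdi W Y i + `[< iso W (psh i Z) >] + `[< iso W (psh (i - 1) Z) >]
   = hdi W Z (i - 1) + hdi W Z i)%N.
Proof.
move=> ar lW; have lW' : local (psh (- i) W) by apply: local_shift.
have swap X j : iso (psh (- j) W) X <-> iso W (psh j X).
  split=> [/(psh_iso j) H|/shift_iso_swap //].
  apply: iso_trans H; apply: iso_sym; apply: iso_trans (psh_add _ _ _) _.
  by rewrite subrr; apply: psh0.
have := mesh ar lW'; rewrite -!hdi0 !hdi_shiftl hdi_shiftr !sub0r !opprK => <-.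
congr (_ + nat_of_bool _ + nat_of_bool _)%N; apply: asbool_equiv_eq.
  exact: iff_sym (swap _ _).
apply: iff_trans (iff_sym (swap _ _)) _; rewrite opprB.
by split; apply: iso_trans; [apply: psh_add | apply/iso_sym/psh_add].
Qed.

(* The sum of [hdi X Y i] over all [i], since [hdi X Y] vanishes outside [-bnd, bnd]. *)
Definition U X Y : nat := zsum (V := nat) (bnd X Y) (hdi X Y).

Lemma UE X Y M : (bnd X Y <= M)%N -> U X Y = zsum (V := nat) M (hdi X Y).
Proof. by move=> le; rewrite /U (zsum_wide _ le) // => i /hdi_bnd. Qed.

Lemma U_iso X Y Y' : iso Y Y' -> U X Y = U X Y'.
Proof.
move=> H; rewrite (@UE X Y _ (leq_addr (bnd X Y') (bnd X Y))).
rewrite (@UE X Y' _ (leq_addl (bnd X Y) (bnd X Y'))).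
by apply: zsum_eq => i _; apply: hdi_iso => //; apply: iso_refl.
Qed.

Lemma U_bip X Y A B : bip Y A B -> U X Y = (U X A + U X B)%N.
Proof.
move=> H; pose M := (bnd X Y + bnd X A + bnd X B)%N.
rewrite (UE (M := M)) ?(@UE X A M) ?(@UE X B M) /M; try lia.
by rewrite -[RHS]zsum_split; apply: zsum_eq => i _; apply: hdi_bip.
Qed.

Lemma U_shift1 X Y : U X (psh 1 Y) = U X Y.
Proof.
pose M := (bnd X Y + bnd X (psh 1 Y))%N.
rewrite (UE (M := M.+1)) ?(@UE X Y M) /M; try lia.
rewrite -[RHS]zsum_shift; first by apply: zsum_eq => i _; rewrite hdi_shiftr.
by move=> i iM; apply: hdi_bnd; lia.
Qed.

Lemma U_shift X Y i : U X (psh i Y) = U X Y.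
Proof.
have S j : U X (psh (j + 1) Y) = U X (psh j Y).
  by rewrite -(U_shift1 X (psh j Y)) addrC; apply/U_iso/iso_sym/psh_add.
have P (n : nat) j : U X (psh (j + n%:Z) Y) = U X (psh j Y).
  by elim: n => [|n IH]; rewrite ?addr0 // -addn1 PoszD addrA S.
rewrite -[RHS](U_iso X (psh0 Y)).
case: (ltrP 0 i) => i0.
  by rewrite -[X in psh X Y]add0r -(gtz0_abs i0) P.
have -> : (0 : int) = i + `|i|%N%:Z by lia.
by rewrite P.
Qed.

Lemma U_self X Y i : iso X (psh i Y) -> U X Y = U X X.
Proof. by move=> H; rewrite -(U_shift X Y i); apply/U_iso/iso_sym. Qed.

Definition same X Y : bool := `[< exists i, iso X (psh i Y) >].

(** At most one shift of Z is isomorphic to W, as W has no period; its degree lies in the window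
    because End W is nonzero. *)
Lemma sum_iso_indicator W Z M : local W -> (bnd W W + bnd W Z <= M)%N ->
  zsum (V := nat) M (fun i => `[< iso W (psh i Z) >] : nat) = same W Z.
Proof.
move=> lW le; rewrite /same; case: asboolP => [[i Wi]|nW]; last first.
  by apply: zsum0 => i _; case: asboolP => // H; case: nW; exists i.
rewrite (zsum_single (i0 := i)).
- by case: asboolP.
- rewrite leqNgt; apply/negP => iM; have : hdi W Z i = 0%N by apply: hdi_bnd; lia.
  rewrite /hdi -(hd_iso (iso_refl W) Wi) => /hd_id0; exact: lW.1.
move=> j ji; case: asboolP => // Wj; case/eqP: ji.
have : iso W (psh (j - i) W).
  apply: iso_trans Wj _; apply: iso_sym; apply: iso_trans (psh_iso (j - i) Wi) _.
  by apply: iso_trans (psh_add _ _ _) _; rewrite subrK; apply: iso_refl.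
by move/(nonperiodic lW.1)/eqP; rewrite subr_eq0 => /eqP.
Qed.

Lemma U_mesh Z Y W : AR Z Y -> local W -> (U W Y + (same W Z).*2 = (U W Z).*2)%N.
Proof.
move=> ar lW; pose M := (bnd W Y + bnd W Z + bnd W W)%N.
have leY : (bnd W Y <= M.+1)%N by rewrite /M; lia.
have leZ : (bnd W Z <= M.+1)%N by rewrite /M; lia.
have i0 i : (M < `|i|)%N -> `[< iso W (psh i Z) >] = false.
  move=> iM; apply/asboolP => Wi.
  have : hdi W Z i = 0%N by apply: hdi_bnd; move: iM; rewrite /M; lia.
  rewrite /hdi -(hd_iso (iso_refl W) Wi) => /hd_id0; exact: lW.1.
have E : zsum (V := nat) M.+1 (fun i => hdi W Y i + `[< iso W (psh i Z) >] + `[< iso W (psh (i - 1) Z) >])%N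
  = zsum (V := nat) M.+1 (fun i => hdi W Z (i - 1) + hdi W Z i)%N.
  by apply: zsum_eq => i _; apply: mesh_hdi.
have down (F : int -> nat) : (forall i, (M < `|i|)%N -> F i = 0%N) ->
    zsum (V := nat) M.+1 (fun i => F (i - 1)) = zsum (V := nat) M F.
  move=> F0; rewrite /zsum doubleS [LHS]big_nat_recl // [X in (_ + X)%R]big_nat_recl //.
  rewrite [X in (X + _)%R]F0; last lia.
  rewrite [X in (_ + (X + _))%R]F0; last lia.
  by rewrite !add0r; apply: eq_bigr => a _; congr F; lia.
move: E; rewrite (zsum_split (V := nat)) (zsum_split (V := nat)) [RHS](zsum_split (V := nat)).
rewrite (down (hdi W Z)); last by move=> i iM; apply: hdi_bnd; move: iM; rewrite /M; lia.
rewrite (down (fun i => `[< iso W (psh i Z) >] : nat)); last by move=> i /i0 ->.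
rewrite !sum_iso_indicator //; [|rewrite /M; lia|rewrite /M; lia].
rewrite -(UE leY) -(UE leZ) -(UE (M := M)); last by rewrite /M; lia.
rewrite -!addnn /GRing.add /=; lia.
Qed.
End GradedDimensions.

(** After one strict descent a concave sequence keeps descending by at least 1 per step and would
    become negative. *)
Lemma concave_mono (u : nat -> nat) :
  (forall n, u n + u n.+2 <= (u n.+1).*2)%N -> forall n, (u n <= u n.+1)%N.
Proof.
move=> H n; rewrite leqNgt; apply/negP => lt.
have D j : (u (n + j).+1 + 1 <= u (n + j))%N.
  elim: j => [|j IH]; first by rewrite addn0 addn1.
  by move: (H (n + j)%N) IH; rewrite (addnS n j); lia.
have E j : (u (n + j) + j <= u n)%N.
  elim: j => [|j IH]; first by rewrite !addn0.
  by move: (D j) IH; rewrite (addnS n j); lia.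
move: (E (u n).+1); lia.
Qed.

(** * Dimensions along a component *)

(* [H m n i] stands for dim Hom(B_m, B_n[i]). *)
Section MeshNumerics.
Variable H : nat -> nat -> int -> nat.
Hypothesis H_sym : forall m n i, H m n i = H n m (- i).
Hypothesis H_mesh0 : forall m i,
  (H m 1 (i - 1) + ((m == 0%N) && (i == 0)) + ((m == 0%N) && (i == 1%R)) = H m 0 (i - 1) + H m 0 i)%N.
Hypothesis H_mesh : forall m n i,
  (H m n i + H m n.+2 (i - 1) + ((m == n.+1) && (i == 0)) + ((m == n.+1) && (i == 1%R))
    = H m n.+1 (i - 1) + H m n.+1 i)%N.
Hypothesis H00 : (2 <= H 0 0 0)%N.

(* What Hom(B_0, B_0[i]) contains besides the two classes present in degree 0. *)
Definition excess (i : int) : nat := (H 0 0 i - (i == 0).*2)%N.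
(** Sum of c over the interval [i, i + n]; as a function of n and i it solves the mesh recursion
    without defects ([wsum_mesh]). *)
Definition wsum (c : int -> nat) n (i : int) : nat := (\sum_(t < n.+1) c (i + t%:Z)%R)%N.

Lemma wsum0 c i : wsum c 0 i = c i.
Proof. by rewrite /wsum big_ord_recl big_ord0 addr0 addn0. Qed.
Lemma wsumS c n i : wsum c n.+1 i = (wsum c n i + c (i + n.+1%:Z)%R)%N.
Proof. by rewrite /wsum big_ord_recr. Qed.
Lemma wsum_mesh c n i : (wsum c n i + wsum c n.+2 (i - 1) = wsum c n.+1 (i - 1) + wsum c n.+1 i)%N.
Proof.
rewrite (wsumS c n.+1) (wsumS c n i) (_ : i - 1 + n.+2%:Z = i + n.+1%:Z); last lia.
by rewrite addnCA.
Qed.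

Lemma excessE i : H 0 0 i = (excess i + (i == 0).*2)%N.
Proof. by rewrite /excess subnK //; case: eqP => // ->. Qed.

Lemma excess_even i : excess (- i) = excess i.
Proof. by rewrite /excess -H_sym oppr_eq0. Qed.

(** For m = 0 the only defects are those of the triangle ending at the rim. They separate the two
    classes counted at i = 0 when n = 0 into one at 0 and one at -n. *)
Lemma H0E n i : H 0 n i = (wsum excess n i + (i == 0) + (i == - n%:Z))%N.
Proof.
suff [] : (forall i, H 0 n i = (wsum excess n i + (i == 0) + (i == - n%:Z))%N) /\
          (forall i, H 0 n.+1 i = (wsum excess n.+1 i + (i == 0) + (i == - n.+1%:Z))%N) by [].
elim: n {i} => [|n [IH1 IH2]]; split=> // i.
- by rewrite excessE wsum0 oppr0; lia.
- have := H_mesh0 0 (i + 1); rewrite addrK !excessE => E.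
  have e1 : (i + 1 == 0) = (i == -1) by lia.
  have e2 : (i + 1 == 1) = (i == 0) by lia.
  move: E; rewrite wsumS wsum0 e1 e2 [i + 1%:Z]/(i + 1) [- 1%:Z]/(-1) /= ; lia.
have := H_mesh 0 n (i + 1); rewrite addrK IH1 !IH2 /= !addn0 => E.
have := wsum_mesh excess n (i + 1); rewrite addrK => E2.
have e1 : (i + 1 == 0) = (i == -1) by lia.
have e2 : (i + 1 == - n%:Z) = (i == - n.+1%:Z) by lia.
have e3 : (i + 1 == - n.+1%:Z) = (i == - n.+2%:Z) by lia.
move: E E2; rewrite e1 e2 e3; lia.
Qed.

Definition rowsum m (i : int) : nat := (\sum_(s < m.+1) excess (i - s%:Z)%R)%N.

(** The column n = 0 is known from [H0E] by symmetry, and stopping at n = m avoids the defect at m =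
    n + 1. The two intervals are the window sums of the indicators of 0 and m. *)
Lemma HE m n i : (n <= m)%N -> (0 < m)%N ->
  H m n i = (wsum (rowsum m) n i + (- n%:Z <= i <= 0)%R + (m%:Z - n%:Z <= i <= m%:Z)%R)%N.
Proof.
move=> + m0.
have base j : H m 0 j = (wsum (rowsum m) 0 j + (- 0%:Z <= j <= 0)%R + (m%:Z - 0%:Z <= j <= m%:Z)%R)%N.
  rewrite H_sym H0E wsum0.
  have -> : wsum excess m (- j) = rowsum m j.
    by apply: eq_bigr => s _; rewrite -excess_even opprD opprK.
  lia.
suff [] : ((n <= m)%N -> forall i, H m n i = (wsum (rowsum m) n i + (- n%:Z <= i <= 0)%R + (m%:Z - n%:Z <= i <= m%:Z)%R)%N) /\
   ((n < m)%N -> forall i, H m n.+1 i = (wsum (rowsum m) n.+1 i + (- n.+1%:Z <= i <= 0)%R + (m%:Z - n.+1%:Z <= i <= m%:Z)%R)%N).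
  by move=> h _ /h.
elim: n {i} => [|n [IH1 IH2]]; split=> // nm i.
  have := H_mesh0 m (i + 1); rewrite addrK !base (gtn_eqF m0) /= !addn0.
  rewrite !wsum0 wsumS wsum0 -[i + 1%:Z]/(i + 1); lia.
have mn : (m == n.+1) = false by lia.
have := H_mesh m n (i + 1); rewrite addrK IH1 ?IH2 ?mn /= ?addn0; try lia.
have := wsum_mesh (rowsum m) n (i + 1); rewrite addrK; lia.
Qed.

(** For n = m the intervals of [HE] are [-m, 0] and [0, m]; both contain 0, whence the 2. *)
Lemma diagE m : H m m 0 = (wsum (rowsum m) m 0 + 2)%N.
Proof.
case: m => [|m]; last by rewrite HE //; lia.
rewrite H0E !wsum0 /rowsum big_ord_recl big_ord0 oppr0 eqxx addn0 -!addnA; congr (excess _ + _)%N.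
Qed.

Lemma diag_excess m : H m m 0 = 2 <-> forall i, (`|i| <= m)%N -> excess i = 0%N.
Proof.
rewrite diagE; split=> [E i im|E].
  have {}E : wsum (rowsum m) m 0 = 0%N by lia.
  move/eqP: E; rewrite /wsum sum_nat_eq0 => /forallP E.
  have F (s t : nat) : (s <= m)%N -> (t <= m)%N -> excess (t%:Z - s%:Z) = 0%N.
    move=> sm tm; have := E (inord t); rewrite /= inordK // add0r /rowsum sum_nat_eq0.
    by move=> /forallP /(_ (inord s)) /=; rewrite inordK // => /eqP.
  case: (lerP 0 i) => i0.
    by rewrite -(subr0 i) -(gez0_abs i0); apply: F; lia.
  by rewrite (_ : i = 0%N%:Z - `|i|%N%:Z); [apply: F; lia | lia].
rewrite [wsum _ _ _]big1 // => t _; rewrite [rowsum _ _]big1 // => s _.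
by apply: E; have := ltn_ord t; have := ltn_ord s; lia.
Qed.

(** The interval [0, m] in [HE] contains 1 as soon as m > 0. *)
Lemma diag_ext m : (0 < m)%N -> (0 < H m m 1)%N.
Proof. by move=> m0; rewrite HE //; lia. Qed.

Lemma diag_le m r : (r <= m)%N -> H m m 0 = 2 -> H r r 0 = 2.
Proof.
by move=> rm /diag_excess E; apply/diag_excess => i ir; apply: E; apply: leq_trans ir rm.
Qed.
End MeshNumerics.

(** * The mesh recursion on an actual component *)

Section Component.
Variables (k : closedFieldType) (L : falgType k) (t : symform L).
Implicit Types X Y Z W V A : pc L.

Definition component (B : nat -> pc L) := AR (B 0%N) (psh (-1) (B 1%N)) /\
  forall n, AR (B n.+1) (psum (B n) (psh (-1) (B n.+2))).

Lemma ZAoo_component_pc (B : nat -> complex L) : ZAoo_component B ->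
  exists B' : nat -> pc L, component B' /\ forall n, pcx (B' n) = B n.
Proof. by move=> [p _ a0 aS]; exists (fun n => PC (p n)); split; first split. Qed.

Lemma component_ZAoo (B : nat -> pc L) : component B -> ZAoo_component (fun n => pcx (B n)).
Proof.
move=> [a0 aS]; split=> // n; first exact: pcP.
by apply: local_indecomposable; case: n => [|n]; [apply: AR_local a0 | apply: AR_local (aS n)].
Qed.

Section Fixed.
Variable B : nat -> pc L.
Hypothesis cB : component B.

Lemma component_local n : local (B n).
Proof. by case: n => [|n]; [apply: AR_local cB.1 | apply: AR_local (cB.2 n)]. Qed.

Lemma psum_bip X Y : bip (psum X Y) X Y.
Proof. exact: bip_dsum. Qed.

Lemma component_U W n : local W ->
  (U W (B n) + U W (B n.+2) + (same W (B n.+1)).*2 = (U W (B n.+1)).*2)%N.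
Proof.
move=> lW; have := U_mesh (cB.2 n) lW.
by rewrite (U_bip W (psum_bip _ _)) U_shift.
Qed.

Lemma component_mono W n m : local W -> (n <= m)%N -> (U W (B n) <= U W (B m))%N.
Proof.
move=> lW; elim: m => [|m IH]; first by rewrite leqn0 => /eqP ->.
rewrite leq_eqVlt => /orP[/eqP -> //|/IH le]; apply: leq_trans le _.
by apply: (concave_mono (u := fun n => U W (B n))) => j; have := component_U j lW; lia.
Qed.

(** If shifts of W occurred at n < m, then U would agree at both, and by monotonicity U at m - 1 and
    at m + 1 would be at least U at m. The mesh relation at m, with its defect 2, forbids this. *)
Lemma component_same W n m : local W -> same W (B n) -> same W (B m) -> n = m.
Proof.
move=> lW; wlog nm : n m / (n <= m)%N.
  by move=> H s1 s2; case: (leqP n m) => [/H->//|/ltnW/H->].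
move=> sn sm; apply/eqP; rewrite eqn_leq nm /= leqNgt; apply/negP => lt.
have eU j : same W (B j) -> U W (B j) = U W W by move=> /asboolP [i] /U_self.
case: m nm lt sm => // m nm lt sm.
have := component_U m lW; have := component_mono lW (leqnSn m.+1).
have := @component_mono W n m lW lt; rewrite sm (eU n sn) (eU m.+1 sm); lia.
Qed.

Lemma component_iso m n i : `[< iso (B m) (psh i (B n)) >] = (m == n) && (i == 0).
Proof.
apply/asboolP/andP => [mi|[/eqP <- /eqP ->]]; last exact/iso_sym/psh0.
have lm := component_local m.
have e : m = n.
  apply: (component_same lm); apply/asboolP; last by exists i.
  by exists 0; apply/iso_sym/psh0.
by rewrite -e eqxx in mi *; split=> //; apply/eqP/(nonperiodic lm.1).
Qed.

Let H m n i := hdi (B m) (B n) i.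

Lemma component_sym m n i : H m n i = H n m (- i).
Proof. exact: hdi_sym. Qed.

Lemma component_mesh0 m i :
  (H m 1 (i - 1) + ((m == 0%N) && (i == 0)) + ((m == 0%N) && (i == 1%R)) = H m 0 (i - 1) + H m 0 i)%N.
Proof.
have := mesh_hdi i cB.1 (component_local m); rewrite hdi_shiftr !component_iso.
by rewrite subr_eq0.
Qed.

Lemma component_mesh m n i :
  (H m n i + H m n.+2 (i - 1) + ((m == n.+1) && (i == 0)) + ((m == n.+1) && (i == 1%R))
    = H m n.+1 (i - 1) + H m n.+1 i)%N.
Proof.
have := mesh_hdi i (cB.2 n) (component_local m).
by rewrite (hdi_bip _ _ (psum_bip _ _)) hdi_shiftr !component_iso subr_eq0.
Qed.

(** With End B_0 = k the middle term B_1[-1] would be zero, but B_1 is local. *)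
Lemma component_end0 : (2 <= H 0 0 0)%N.
Proof.
rewrite /H hdi0; have l0 := component_local 0; have l1 := component_local 1.
case E : (hd (B 0%N) (B 0%N)) => [|[|//]]; first by move/hd_id0: E; case: l0.
by move: (AR_simple t cB.1 E) => /unzero_shift; case: l1.
Qed.

Lemma component_hd_le m r : (r <= m)%N -> hd (B m) (B m) = 2 -> hd (B r) (B r) = 2.
Proof.
rewrite -!hdi0.
exact: (@diag_le H component_sym component_mesh0 component_mesh component_end0).
Qed.

Lemma component_hd_rim m : hd (B m) (B m) = 2 <->
  hd (B 0%N) (B 0%N) = 2 /\ forall i, i != 0 -> (`|i| <= m)%N -> hdi (B 0%N) (B 0%N) i = 0%N.
Proof.
have e i : hdi (B 0%N) (B 0%N) i = (excess H i + (i == 0).*2)%N := excessE component_end0 i.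
rewrite -!hdi0.
rewrite (@diag_excess H component_sym component_mesh0 component_mesh component_end0 m).
split=> [E|[E0 E] i im].
  split; first by rewrite e E.
  by move=> i i0 im; rewrite e E // (negbTE i0).
have [->|i0] := eqVneq i 0; first by move: E0; rewrite e eqxx; lia.
by move: (E i i0 im); rewrite e (negbTE i0); lia.
Qed.

Lemma component_ext m : (0 < m)%N -> (0 < hdi (B m) (B m) 1)%N.
Proof.
exact: (@diag_ext H component_sym component_mesh0 component_mesh component_end0).
Qed.
End Fixed.
End Component.

(** * Existence of the component *)

Section Ray.
Variables (k : closedFieldType) (L : falgType k) (t : symform L).
Implicit Types X Y Z W V A B C P Q R E : pc L.

Lemma bip_assoc X A B V R : bip X A B -> bip A V R -> bip X V (psum R B).
Proof.
move=> [iA [iB [pA [pB [h1 h2 h3 h4 h5]]]]] [iV [iR [pV [pR [g1 g2 g3 g4 g5]]]]].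
have [jR [jB [qR [qB [e1 e2 e3 e4 e5]]]]] := psum_bip R B.
have z1 : pV \c pA \c iB = 0 by rewrite -hcompA h3 hcomp0r.
have z2 : pR \c pA \c iB = 0 by rewrite -hcompA h3 hcomp0r.
have AA Y (b : khom A Y) V' (a : khom V' A) : b \c pA \c (iA \c a) = b \c a.
  by rewrite -hcompA (hcompA pA) h1 hcomp1l.
exists (iA \c iV), (iA \c iR \c qR + iB \c qB), (pV \c pA), (jR \c pR \c pA + jB \c pB).
split.
- by rewrite AA.
- rewrite !hcompDl !hcompDr -!hcompA !(hcompA pA) h1 h3 !(hcompA pB) h2 h4.
  by rewrite !hcomp0l !hcomp0r !hcomp1l addr0 add0r !(hcompA pR) g2 !hcomp1l.
- rewrite hcompDr -!hcompA !(hcompA pA) h1 h3 !hcomp1l !hcomp0l !hcomp0r addr0.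
  by rewrite hcompA g3 hcomp0l.
- rewrite hcompDl -!hcompA !(hcompA pA) h1 !(hcompA pB) h4 !hcomp1l !hcomp0l !hcomp0r addr0.
  by rewrite g4 hcomp0r.
rewrite !hcompDl !hcompDr -!hcompA !(hcompA qR) !(hcompA qB) e1 e2 e3 e4.
rewrite !hcomp0l !hcomp0r !hcomp1l addr0 add0r addrA !(hcompA iV) !(hcompA iR).
by rewrite -hcompDr -hcompDl g5 hcomp1l.
Qed.

Lemma bip_nonzero X A B : bip X A B -> id_hom X <> 0 -> id_hom A <> 0 \/ id_hom B <> 0.
Proof.
move=> [iA [iB [pA [pB [h1 h2 h3 h4 h5]]]]] X0.
case: (pselect (id_hom A = 0)) => [A0|]; last by left.
right=> B0; apply: X0; rewrite -h5 -(hcomp1r iA) A0 -(hcomp1r iB) B0.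
by rewrite !hcomp0r !hcomp0l addr0.
Qed.

(** Takes the place of Krull-Schmidt: a property inherited by one of any two complementary summands
    reaches a local one, because dim End drops whenever X decomposes properly. *)
Lemma local_summand_of (Pr : pc L -> Prop) :
  (forall X, Pr X -> id_hom X <> 0) ->
  (forall X A B, bip X A B -> Pr X -> Pr A \/ Pr B) ->
  forall X, Pr X -> exists V R, [/\ local V, bip X V R & Pr V].
Proof.
move=> P0 PD X; have [n] := ubnP (hd X X); elim: n X => // n IH X lt PX.
case: (pselect (indecomposable X)) => [/indecomposable_local lX|nX].
  have [|A [B [iA [iB [pA [pB [h1 h2 h3 h4 [h5 h6]]]]]]]] := @idempotent_split _ _ X (id_hom X).
    exact: hcomp1l.
  have bX : bip X A B by exists iA, iB, pA, pB.
  exists X, B; split=> //; apply: bip_isol bX; exists iA, pA; split=> //.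
have X0 := P0 X PX.
have [A [B [bX A0 B0]]] : exists A B, [/\ bip X A B, id_hom A <> 0 & id_hom B <> 0].
  apply: contrapT => N; apply: nX; split; first by move/is_zeroE.
  move=> A B pA pB /hisoE/bipE bX; case: (pselect (is_zero A)) => [|A0]; first by left.
  right; apply: contrapT => B0; apply: N; exists (PC pA), (PC pB); split=> //.
    by move/is_zeroE.
  by move/is_zeroE.
have EX : hd X X = (hd A A + hd A B + (hd B A + hd B B))%N.
  by rewrite (hd_bip X bX) !(hd_sym t X) !(hd_bip _ bX).
have a0 : (0 < hd A A)%N by rewrite lt0n; apply/eqP => /hd_id0.
have b0 : (0 < hd B B)%N by rewrite lt0n; apply/eqP => /hd_id0.
have bX' := bip_sym bX.
case: (PD _ _ _ bX PX) => [PA|PB].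
  have [|V [R [lV bV PV]]] := IH A _ PA; first lia.
  by exists V, (psum R B); split=> //; apply: bip_assoc bX bV.
have [|V [R [lV bV PV]]] := IH B _ PB; first lia.
by exists V, (psum R A); split=> //; apply: bip_assoc bX' bV.
Qed.

Lemma local_summand X : id_hom X <> 0 -> exists V R, local V /\ bip X V R.
Proof.
move=> X0; have [//|Y A B bY Y0|V [R [lV bV _]]] :=
  local_summand_of (Pr := fun X => id_hom X <> 0) _ _ X0; first exact: bip_nonzero bY Y0.
by exists V, R.
Qed.

Lemma local_summand_hdi C X i : hdi C X i <> 0%N ->
  exists V R, [/\ local V, bip X V R & hdi C V i <> 0%N].
Proof.
apply: (local_summand_of (Pr := fun X => hdi C X i <> 0%N)) => [Y H Y0|Y A B bY].
  apply: H; apply/hd_eq0 => a; rewrite -(hcomp1l a).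
  by rewrite -[id_hom _]/(id_hom (shift i Y)) (zero_shift i Y0) hcomp0l.
rewrite (hdi_bip C i bY); case: (eqVneq (hdi C A i) 0%N) => [->|/eqP]; last by left.
by right.
Qed.

Section Base.
Variable C : pc L.
Hypothesis lC : local C.
Notation u := (U C).

Lemma AR_bound Z E : AR Z E -> (u E <= (u Z).*2)%N.
Proof. by move=> ar; have := U_mesh ar lC; lia. Qed.

(* [Z[-1]] is a summand of the middle term of the triangle ending in [V]. *)
Lemma summand_bound Z E V A : AR Z E -> bip E V A -> local V -> (u Z <= (u V).*2)%N.
Proof.
move=> ar bE lV; have [E' ar'] := AR_exists t lV.
have [B bB] := AR_summand t ar bE ar'.
have := AR_bound ar'; rewrite (U_bip C bB) U_shift; lia.
Qed.

Hypothesis C2 : (2 <= hd C C)%N.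

Definition top (d : int) X := hdi C X d <> 0%N /\ forall i, d < i -> hdi C X i = 0%N.

Lemma top_exists : exists d, top d C.
Proof.
pose N := bnd C C; pose Q (n : nat) := hdi C C (n%:Z - N%:Z) != 0%N.
have ex : exists n, Q n.
  by exists N; rewrite /Q subrr hdi0; move: C2; lia.
have bd n : Q n -> (n <= N + N)%N.
  by move=> /eqP H; rewrite leqNgt; apply/negP => lt; apply: H; apply: hdi_bnd; rewrite -/N; lia.
case: (ex_maxnP ex bd) => n /eqP Qn nmax.
exists (n%:Z - N%:Z); split=> // i ni; apply/eqP/negPn/negP => Hi.
have : Q `|(i + N%:Z)%R|%N by rewrite /Q (_ : _%:Z - _ = i) //; lia.
by move/nmax; lia.
Qed.

(** In degree d + 1 the mesh relation reduces to dim Hom(C, Z[d]) minus a defect of at most 1. The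
    defect occurs only if C is Z[d], and then the dimension is dim End C >= 2; this is where that
    bound is needed. *)
Lemma top_mesh d Z E : AR Z E -> top d Z ->
  hdi C E (d + 1) <> 0%N /\ forall i, d + 1 < i -> hdi C E i = 0%N.
Proof.
move=> ar [H0 H1].
have big i : iso C (psh i Z) -> (2 <= hdi C Z i)%N.
  by move=> Ci; rewrite /hdi -(hd_iso (iso_refl C) Ci).
split=> [|i di]; last first.
  have := mesh_hdi i ar lC; rewrite (H1 (i - 1)) ?(H1 i); lia.
have := mesh_hdi (d + 1) ar lC; rewrite addrK (H1 (d + 1)); last lia.
case: asboolP => [/big|_]; first by rewrite (H1 (d + 1)); lia.
case: asboolP => [/big|_]; lia.
Qed.

Variable d : int.
(** Two consecutive vertices of the ray, the state of its recursive construction: P is kept so that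
    the next step can move away from it. *)
Definition good (P Q : pc L) := [/\ local P, local Q, top d P, top d Q &
  exists E A, AR P E /\ bip E (psh (-1) Q) A].

Lemma top_next Z E A : AR Z E -> top d Z -> (exists B, bip E B A) -> hdi C A (d + 1) <> 0%N ->
  exists Q R, [/\ local Q, top d Q & bip A (psh (-1) Q) R].
Proof.
move=> ar tZ [B bE] hA; have [_ Et] := top_mesh ar tZ.
have [V [R [lV bV hV]]] := local_summand_hdi hA.
exists (psh 1 V), R; split; first exact: local_shift.
  split=> [|i di]; rewrite hdi_shiftr //.
  have : hdi C E (i + 1) = 0%N by apply: Et; lia.
  by rewrite (hdi_bip C _ bE) (hdi_bip C _ bV); lia.
by apply: bip_isol bV; apply: iso_sym; apply: shiftK.
Qed.

Lemma good_first : top d C -> exists E Q R, [/\ AR C E, bip E (psh (-1) Q) R & good C Q].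
Proof.
move=> tC; have [E ar] := AR_exists t lC; have [hE _] := top_mesh ar tC.
have [|A [B [iA [iB [pA [pB [h1 h2 h3 h4 [h5 h6]]]]]]]] := @idempotent_split _ _ E (id_hom E).
  exact: hcomp1l.
have bE : bip E E B.
  by apply: (@bip_isol _ _ _ A); [exists iA, pA | exists iA, iB, pA, pB].
have [|Q [R [lQ tQ bQ]]] := top_next ar tC _ hE; first by exists B; apply: bip_sym.
by exists E, Q, R; split=> //; split=> //; exists E, R.
Qed.

(** P is a summand of the middle term ending in Q but has no Hom from C in degree d + 1. The nonzero
    class of that degree therefore lies in the complement A, and the ray does not turn back. *)
Lemma good_next P Q : good P Q -> exists Q', good Q Q' /\
  exists E A R, [/\ AR Q E, bip E P A & bip A (psh (-1) Q') R].
Proof.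
move=> [lP lQ tP tQ [F [D [arP bP]]]].
have [E ar] := AR_exists t lQ; have [hE _] := top_mesh ar tQ.
have [A bE] := AR_summand_shift t arP bP ar.
have hA : hdi C A (d + 1) <> 0%N.
  move=> A0; apply: hE; rewrite (hdi_bip C _ bE) A0 addn0; apply: tP.2; lia.
have [|Q' [R [lQ' tQ' bA]]] := top_next ar tQ _ hA; first by exists P.
exists Q'; split; last by exists E, A, R.
split=> //; exists E, (psum R P); split=> //.
by apply: bip_assoc bA; apply: bip_sym.
Qed.

Lemma ray_exists : top d C -> exists B : nat -> pc L,
  [/\ B 0%N = C, (forall n, top d (B n)), exists E R, AR C E /\ bip E (psh (-1) (B 1%N)) R
   & forall n, exists E A R,
      [/\ AR (B n.+1) E, bip E (B n) A & bip A (psh (-1) (B n.+2)) R]].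
Proof.
move=> tC; have [E [Q [R [ar bE gd]]]] := good_first tC.
have step (s : {pq : pc L * pc L | good pq.1 pq.2}) :
    exists s' : {pq : pc L * pc L | good pq.1 pq.2},
      (sval s').1 = (sval s).2 /\ exists E A R,
      [/\ AR (sval s).2 E, bip E (sval s).1 A & bip A (psh (-1) (sval s').2) R].
  case: s => -[P' Q'] /= g; have [Q'' [g' H]] := good_next g.
  by exists (exist (fun pq : pc L * pc L => good pq.1 pq.2) (Q', Q'') g').
have [f fP] := boolp.choice step.
pose s0 := exist (fun pq : pc L * pc L => good pq.1 pq.2) (C, Q) gd.
pose B n := (sval (iter n f s0)).1.
have B2 n : B n.+1 = (sval (iter n f s0)).2 by rewrite /B iterS (fP _).1.
exists B; split=> //.
- by move=> n; rewrite /B; case: (iter n f s0) => -[P' Q'] /= [].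
- by exists E, R; rewrite B2.
move=> n; have [_ [E' [A' [R' H]]]] := fP (iter n f s0).
by exists E', A', R'; rewrite !B2.
Qed.
End Base.

(* The values of [u] along the ray are concave and positive, hence
   nondecreasing, and leave no room for further summands away from [C]. *)
Lemma ray_clean C : local C -> (2 <= hd C C)%N -> exists (B : nat -> pc L) E R,
  [/\ B 0%N = C, AR C E, bip E (psh (-1) (B 1%N)) R, (U C R < U C C)%N
   & forall n, AR (B n.+1) (psum (B n) (psh (-1) (B n.+2)))].
Proof.
move=> lC C2; have [d tC] := top_exists C2.
have [B [B0 Bt [E [R [ar bE]]] step]] := ray_exists lC C2 tC.
(* The 2 is the summed defect of the mesh relation at Z = W = C. *)
have E0 : (U C (B 1%N) + U C R + 2 = (U C C).*2)%N.
  have := U_mesh ar lC; rewrite (U_bip C bE) U_shift.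
  have -> : same C C = true by apply/asboolP; exists 0; apply/iso_sym/psh0.
  lia.
have ES n : exists E A R', [/\ AR (B n.+1) E, bip E (B n) A, bip A (psh (-1) (B n.+2)) R'
    & (U C (B n) + U C (B n.+2) + U C R' <= (U C (B n.+1)).*2)%N].
  have [E' [A' [R' [ar' bE' bA']]]] := step n; exists E', A', R'; split=> //.
  by have := AR_bound lC ar'; rewrite (U_bip C bE') (U_bip C bA') U_shift; lia.
have mono := concave_mono (u := fun n => U C (B n)).
have {}mono : forall n, (U C (B n) <= U C (B n.+1))%N.
  by apply: mono => n; have [E' [A' [R' [_ _ _ H]]]] := ES n; lia.
exists B, E, R; split=> //; first by have := mono 0%N; rewrite B0; lia.
(* The increments of a concave sequence do not exceed the first one, which E0 bounds by u(C) - 2. *)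
have slope n : (U C (B n.+1) + 2 <= U C (B n) + U C C)%N.
  elim: n => [|n IH]; first by rewrite B0; lia.
  by have [E' [A' [R' [_ _ _ H]]]] := ES n; lia.
have above n : (U C C <= U C (B n))%N.
  by elim: n => [|n IH]; [rewrite B0 | apply: leq_trans IH (mono n)].
move=> n; have [E' [A' [R' [ar' bE' bA' H]]]] := ES n.
(* By concavity and monotonicity u(R') <= u(B_(n+1)) - u(B_n), whereas a local summand V of R' has 2
   u(V) >= u(B_(n+1)). Then u(B_(n+1)) >= 2 u(B_n), against the bound on the increment and u(C) <=
   u(B_n). *)
have R0 : id_hom R' = 0.
  apply: contrapT => /local_summand [V [R'' [lV bV]]].
  have bEV : bip E' V (psum R'' (psum (psh (-1) (B n.+2)) (B n))).
    apply: bip_assoc bV; exact: (bip_assoc (bip_sym bE') (bip_sym bA')).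
  have := summand_bound lC ar' bEV lV; have := U_bip C bV.
  have := mono n.+1; have := slope n; have := above n; lia.
apply: AR_iso ar'; apply/bipE; apply: bip_sym; apply: bip_isol (bip_sym bE').
exact: bip_zero bA' R0.
Qed.

(* Descent towards the rim: while the remaining summand [R] is nonzero it is
   indecomposable, and [U C] is smaller on it. *)
Lemma component_of_ray n (B : nat -> pc L) E R C : local C -> (2 <= hd C C)%N ->
  (U C (B 0%N) <= n)%N -> AR (B 0%N) E -> bip E (psh (-1) (B 1%N)) R ->
  (U C R < U C (B 0%N))%N ->
  (forall n, AR (B n.+1) (psum (B n) (psh (-1) (B n.+2)))) ->
  exists (B' : nat -> pc L) r, component B' /\ forall j, B' (r + j)%N = B j.
Proof.
move=> lC C2; elim: n B E R => [|n IH] B E R le ar bE lt AS; first lia.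
case: (pselect (id_hom R = 0)) => [R0|/local_summand [V [R2 [lV bV]]]].
  exists B, 0%N; split=> //; split=> //; apply: AR_iso ar.
  exact: bip_zero bE R0.
have bEV : bip E V (psum R2 (psh (-1) (B 1%N))) := bip_assoc (bip_sym bE) bV.
have V1 := summand_bound lC ar bEV lV; have RV := U_bip C bV.
(* Each local summand of R has at least half of u(B_0); two of them would make u(R) at least
   u(B_0). *)
have R20 : id_hom R2 = 0.
  apply: contrapT => /local_summand [V2 [R3 [lV2 bV2]]].
  have bRV2 := bip_assoc (bip_sym bV) bV2.
  have V21 := summand_bound lC ar (bip_assoc (bip_sym bE) bRV2) lV2.
  by have := U_bip C bV2; lia.
have RV' := bip_zero bV R20.
have arV : AR (B 0%N) (psum V (psh (-1) (B 1%N))).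
  apply: AR_iso ar; apply/bipE; exact: (bip_isol RV' (bip_sym bE)).
have [EV arEV] := AR_exists t lV.
have [R' bR'] := AR_summand t ar bEV arEV.
pose B' j := if j is j'.+1 then B j' else V.
(* B_0[-1] is a summand of the middle term ending in V, so u(B_0) + u(R') <= 2 u(V), while u(V) <=
   u(R) < u(B_0). Thus the hypotheses hold again for the ray extended by V. *)
have UR : (U C R' < U C V)%N.
  by have := AR_bound lC arEV; rewrite (U_bip C bR') U_shift; lia.
have [|||||B2 [r [cB2 B2E]]] := IH B' EV R' => //.
- by rewrite /=; lia.
- by case.
exists B2, r.+1; split=> // j; by rewrite addSnnS B2E.
Qed.

Lemma component_exists C : local C -> (2 <= hd C C)%N ->
  exists (B : nat -> pc L) r, component B /\ B r = C.
Proof.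
move=> lC C2; have [B [E [R [B0 ar bE lt AS]]]] := ray_clean lC C2.
rewrite -B0 in ar lt.
have [|B' [r [cB' B'E]]] := component_of_ray lC C2 (leqnn _) ar bE _ AS.
  by rewrite B0 in lt *.
by exists B', r; split=> //; rewrite -B0 -B'E addn0.
Qed.
End Ray.

(** * Objects with one-dimensional endomorphism space *)

Section Contraction.
Variables (k : fieldType) (L : falgType k).

Lemma update_homotopy (X Y : complex L) (s : forall i : int, {linear X (i + 1) -> Y i})
    j (c : {linear X (j + 1) -> Y j}) :
  exists s' : forall i : int, {linear X (i + 1) -> Y i},
    s' j = c /\ forall i, i != j -> s' i = s i.
Proof.
exists (fun i => match pselect (j = i) with
  | left e => ecast l {linear X (l + 1) -> Y l} e c | right _ => s i end).
split=> [|i ij]; case: pselect => // e; first by rewrite (eq_irrelevance e erefl).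
by case/eqP: ij.
Qed.

(** A contraction built downwards from degree N: x - s d x is a cycle, hence a boundary, and
    projectivity lifts the map x |-> x - s d x through the differential. After 2N + 2 steps only
    zero modules remain below. *)
Lemma acyclic_zero (X : complex L) : perfect X ->
  (forall (j : int) (z : X (j + 1)), diff X (j + 1) z = 0 -> exists y, diff X j y = z) ->
  id_hom X = 0.
Proof.
move=> [fp [N hN]] ac.
have H n : exists s : forall i : int, {linear X (i + 1) -> X i}, forall j, N%:Z - n%:Z <= j ->
    forall x : X (j + 1), x = diff X j (s j x) + s (j + 1) (diff X (j + 1) x).
  elim: n => [|n [s hs]].
    have H0 i : linear (fun _ : X (i + 1) => 0 : X i).
      by move=> a x y; rewrite scaler0 addr0.
    exists (fun i => mklin (H0 i)) => j jN x; rewrite /= linear0 addr0.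
    by apply: hN; lia.
  pose j : int := N%:Z - n.+1%:Z.
  pose K : lmodType L := kermod (diff X (j + 1)).
  have jn : N%:Z - n%:Z <= j + 1 by rewrite /j; lia.
  have gP (y : X j) : diff X j y \in kerp (diff X (j + 1)).
    by rewrite unfold_in diffK.
  have gl : linear (fun y : X j => Kermod (gP y) : K).
    by move=> a x y; apply: ker_inj; rewrite [RHS]kerval_linear /= linearP.
  have fP (x : X (j + 1)) : x - s (j + 1) (diff X (j + 1) x) \in kerp (diff X (j + 1)).
    rewrite unfold_in linearB; apply/eqP.
    have := hs (j + 1) jn (diff X (j + 1) x); rewrite diffK linear0 addr0 => <-.
    exact: subrr.
  have fl : linear (fun x : X (j + 1) => Kermod (fP x) : K).
    move=> a x y; apply: ker_inj; rewrite [RHS]kerval_linear /= !linearP.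
    by rewrite scalerDr addrACA.
  have [|c hc] := (fp (j + 1)).2 _ _ (mklin gl) (mklin fl).
    move=> [z hz]; have [y hy] := ac j z (eqP hz).
    by exists y; apply: ker_inj.
  have [s' [s'j s'E]] := update_homotopy s c; exists s' => l jl x.
  have l1 : s' (l + 1) = s (l + 1) by apply: s'E; move: jl; rewrite -/j; lia.
  rewrite l1; have [lj|lj] := eqVneq l j; last first.
    by rewrite s'E //; apply: hs; move: jl lj; rewrite /j; lia.
  move: x {l1}; rewrite lj s'j => x.
  have /(congr1 (@kerval _ _ _ _)) /= -> := hc x.
  by rewrite subrK.
have [s hs] := H (N.*2.+2).
apply/cls_eq0; exists s => i x /=.
case: (lerP (N%:Z - N.*2.+2%:Z) i) => iN; first exact: hs.
have z (y : X (i + 1)) : y = 0 by apply: hN; lia.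
by rewrite (z (_ + _)); apply: z.
Qed.
End Contraction.

(** * The regular module as a stalk complex *)

Section Stalk.
Variables (k : fieldType) (L : falgType k) (i : int).

Fact stalk_test_linear j : linear (fun x : L^o => if j == i then 0 else x : L^o).
Proof. by move=> a x y; case: ifP => //; rewrite scaler0 addr0. Qed.
Definition stalk_mod j : lmodType L := kermod (mklin (@stalk_test_linear j)).
Fact stalk_zero_linear j : linear (fun _ : stalk_mod j => 0 : stalk_mod (j + 1)).
Proof. by move=> a x y; rewrite scaler0 addr0. Qed.

(* In degree [i] this is the kernel of the zero map of L, elsewhere the kernel of
   its identity, so that no case distinction on types is needed. *)
Definition stalk : complex L :=
  @Complex _ stalk_mod (fun j => mklin (@stalk_zero_linear j)) (fun j x => erefl).

Lemma stalk_val j (x : stalk j) : j != i -> kerval x = 0.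
Proof.
by move=> ji; move: (kerval x) (kervalE x) => v /=; rewrite (negbTE ji).
Qed.

Lemma stalkN j (x : stalk j) : j != i -> x = 0.
Proof. by move=> ji; apply: ker_inj; apply: stalk_val. Qed.

Fact stalk_one_proof (x : L^o) : x \in kerp (mklin (@stalk_test_linear i)).
Proof. by rewrite unfold_in /= eqxx. Qed.
Definition stalk_elt (x : L^o) : stalk i := Kermod (stalk_one_proof x).

Lemma regular_fg : finitely_generated L^o.
Proof. by exists 1%N, (fun _ => 1) => x; exists (fun _ => x); rewrite big_ord1 [RHS]mulr1. Qed.
Lemma regular_proj : projective L^o.
Proof.
move=> M N g f gs; have [y hy] := gs (f 1).
have H : linear (fun x : L^o => x *: y) by move=> a u v; rewrite scalerDl scalerA.
exists (mklin H) => x; rewrite /= linearZ hy -linearZ; congr (f _); exact: mulr1.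
Qed.

Lemma perfect_stalk : perfect stalk.
Proof.
split=> [j|]; last first.
  by exists `|i|%N => j ji x; apply: stalkN; apply/eqP; lia.
have pP (x : L^o) : (if j == i then x else 0) \in kerp (mklin (@stalk_test_linear j)).
  by rewrite unfold_in /=; case: (j == i); rewrite eqxx.
have pl : linear (fun x : L^o => Kermod (pP x) : stalk j).
  move=> a x y; apply: ker_inj; rewrite [RHS]kerval_linear /=.
  by case: ifP => // _; rewrite scaler0 addr0.
have pK x : mklin pl (mklin (@kerval_linear _ _ _ (mklin (@stalk_test_linear j))) x) = x.
  apply: ker_inj; rewrite [LHS]/=.
  by move: (kerval x) (kervalE x) => v /=; case: (j == i).
by split; [exact: (retract_fg pK regular_fg) | exact: (retract_proj pK regular_proj)].
Qed.

Lemma stalk_map (X : complex L) (z : X i) : diff X i z = 0 ->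
  exists f : chain_map stalk X, f i (stalk_elt 1) = z.
Proof.
move=> dz; pose zz j : X j := match pselect (i = j) with
  | left e => transport e z | right _ => 0 end.
have dzz j : diff X j (zz j) = 0.
  rewrite /zz; case: pselect => [e|_]; last exact: linear0.
  by case: j / e.
have H j : linear (fun x : stalk j => kerval x *: zz j).
  by move=> a x y; rewrite kerval_linear scalerDl -scalerA.
have HP j (x : stalk j) : diff X j (mklin (H j) x) = mklin (H (j + 1)) (diff stalk j x).
  rewrite /= linearZ_LR /= dzz scaler0; exact: (esym (scale0r _)).
exists (ChainMap HP); rewrite /= scale1r /zz; case: pselect => // e.
exact: tp_id.
Qed.

(* The endomorphism ring of the stalk is the opposite of L. *)
Definition ev (a : khom stalk stalk) : L := kerval (krep a i (stalk_elt 1)).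

Lemma stalk_null (f : forall j, stalk j -> stalk j) : null_homotopic f -> forall j x, f j x = 0.
Proof.
move=> [s hs]; apply: (@deg_shift 1) => j x; rewrite hs.
by rewrite [diff _ _ _]/= linear0 addr0.
Qed.

Lemma ev_cls (f : chain_map stalk stalk) : ev (cls f) = kerval (f i (stalk_elt 1)).
Proof.
rewrite /ev; suff -> : krep (cls f) i (stalk_elt 1) = f i (stalk_elt 1) by [].
apply/eqP; rewrite -subr_eq0; apply/eqP; exact: (stalk_null (repr_cls f)).
Qed.

Lemma stalk_eltE (f : chain_map stalk stalk) (x : L^o) :
  kerval (f i (stalk_elt x)) = x * kerval (f i (stalk_elt 1)).
Proof.
have -> : stalk_elt x = x *: stalk_elt 1.
  apply: ker_inj; rewrite [RHS]kervalZ; exact: (esym (mulr1 (x : L))).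
by rewrite linearZ_LR kervalZ.
Qed.

Lemma ev_comp a b : ev (b \c a) = ev a * ev b.
Proof.
elim/homW: a => f; elim/homW: b => g; rewrite hcompE !ev_cls /=.
rewrite -stalk_eltE; congr (kerval (g i _)); exact: ker_inj.
Qed.

Lemma ev_eq0 a : ev a = 0 -> a = 0.
Proof.
elim/homW: a => f; rewrite ev_cls => E; apply: (@clsE _ _ _ _ _ (zero_map _ _)) => j x.
have [ji|ji] := eqVneq j i; last by rewrite [x]stalkN // linear0.
move: x; rewrite ji => x; rewrite (_ : x = stalk_elt (kerval x)); last exact: ker_inj.
by apply: ker_inj; rewrite stalk_eltE E mulr0.
Qed.

Lemma evZ c a : ev (c *: a) = c *: ev a.
Proof.
elim/homW: a => f; rewrite clsZ !ev_cls.
rewrite -[LHS]/(kerval (c%:A *: f i (stalk_elt 1))) kervalZ; exact: mulr_algl.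
Qed.

Lemma ev_surj (b : L) : exists a, ev a = b.
Proof.
have HP j (x : stalk j) : (kerval x * b : L^o) \in kerp (mklin (@stalk_test_linear j)).
  rewrite unfold_in /=; move: (kerval x) (kervalE x) => v /=.
  by case: (j == i) => // ->; rewrite mul0r.
have H j : linear (fun x : stalk j => Kermod (HP j x) : stalk j).
  move=> a x y; apply: ker_inj; rewrite [RHS]kerval_linear.
  rewrite -[LHS]/((kerval (a *: x + y) : L) * b) kerval_linear mulrDl.
  by congr (_ + _); apply: esym; apply: mulrA.
have HC j (x : stalk j) : diff stalk j (mklin (H j) x) = mklin (H (j + 1)) (diff stalk j x).
  by rewrite [RHS]linear0.
exists (cls (ChainMap HC)); rewrite ev_cls /=; exact: mul1r.
Qed.
End Stalk.

(** * Casimir elements and semisimple blocks *)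

Section Block.
Variables (k : fieldType) (L : falgType k) (t : symform L).

Lemma sformZ c w : t (c *: w) = c * t w.
Proof. exact: (linearZ_LR t). Qed.

(** The u i represent the coordinate functionals of a basis v, which is the first expansion; the
    second follows by pairing both sides with an arbitrary y and nondegeneracy of t. *)
Lemma dual_bases : exists n (u v : 'I_n -> L),
  (forall z, z = \sum_i t (z * u i) *: v i) /\ (forall z, z = \sum_i t (v i * z) *: u i).
Proof.
pose b := vbasis {: L}.
have Hc (i : 'I_(\dim {: L})) : exists a, forall y, coord b i y = t (y * a).
  have [a aE] := sformP t (coord b i : {linear L -> k^o}); by exists a.
have [u uE] := boolp.choice Hc.
have E z : z = \sum_i t (z * u i) *: b`_i.
  by rewrite {1}(coord_vbasis (memvf z)); apply: eq_bigr => i _; rewrite -uE.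
exists (\dim {: L}), u, (fun i => b`_i); split=> // z.
apply/eqP; rewrite -subr_eq0; apply/negPn/negP => /(sformN t) [y].
rewrite sformC => /eqP; apply; rewrite mulrBr linearB /= mulr_sumr linear_sum /=.
rewrite {1}(E y) mulr_suml linear_sum /=; apply/eqP; rewrite subr_eq0; apply/eqP.
by apply: eq_bigr => i _; rewrite -scalerAl -scalerAr !sformZ mulrC.
Qed.

(* The Casimir element [\sum_i u i (x) v i] of a pair of dual bases commutes with L. *)
Lemma casimir n (u v : 'I_n -> L) (q : {linear L -> L}) a :
  (forall z, z = \sum_i t (z * u i) *: v i) -> (forall z, z = \sum_i t (v i * z) *: u i) ->
  \sum_i a * u i * q (v i) = \sum_i u i * q (v i * a).
Proof.
move=> E1 E2.
transitivity (\sum_i \sum_j t (v j * (a * u i)) *: (u j * q (v i))).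
  apply: eq_bigr => i _; rewrite {1}(E2 (a * u i)) mulr_suml.
  by apply: eq_bigr => j _; rewrite scalerAl.
rewrite exchange_big; apply: eq_bigr => j _ /=.
rewrite [in RHS](E1 (v j * a)) linear_sum mulr_sumr; apply: eq_bigr => i _.
by rewrite linearZ_LR /= scalerAr mulrA.
Qed.

(** Casimir sums provide both the central idempotent e and, as in Maschke's theorem, an L-linear
    projection onto any left ideal of the block, whose kernel within the block is the complement. *)
Lemma semisimple_summand (x : L) : x != 0 -> x * x = x ->
  (forall b, exists c, x * b * x = c *: x) -> has_semisimple_summand L.
Proof.
move=> x0 xx xb; have [n [u [v [E1 E2]]]] := dual_bases.
have txb b c : x * b * x = c *: x -> t (x * b) = c * t x.
  by move=> cE; rewrite -[in LHS]xx -mulrA sformC cE sformZ.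
have tx0 : t x != 0.
  apply/eqP => tx; have [b] := sformN t x0.
  by have [c /txb ->] := xb b; rewrite tx mulr0 eqxx.
have xbE b : x * b * x = (t (x * b) / t x) *: x.
  by have [c cE] := xb b; rewrite cE (txb b c cE) mulfK.
(* The factor t(x) cancels the division by t(x) in [xbE], so that x e = x. *)
pose e : L := (t x : k) *: \sum_i u i * (x * v i).
have mulx_lin : linear (fun y : L => x * y) by move=> c y z; rewrite mulrDr scalerAr.
have central (a : L) : e * a = a * e.
  rewrite /e -scalerAl -scalerAr mulr_suml mulr_sumr; congr (_ *: _).
  have := casimir (mklin mulx_lin) a E1 E2; rewrite /= => E.
  transitivity (\sum_i u i * (x * (v i * a))); first by apply: eq_bigr => i _; rewrite !mulrA.
  by rewrite -E; apply: eq_bigr => i _; rewrite [RHS]mulrA.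
have xe : x * e = x.
  rewrite /e -scalerAr mulr_sumr.
  rewrite (eq_bigr (fun i => (t x)^-1 *: (x * (t (x * u i) *: v i)))); last first.
    by move=> i _; rewrite !mulrA xbE -scalerAl -scalerAr scalerA mulrC.
  by rewrite -scaler_sumr scalerA divff // scale1r -mulr_sumr -E1 xx.
have ee : e * e = e.
  rewrite {1}/e -scalerAl mulr_suml; congr (_ *: _); apply: eq_bigr => i _.
  by rewrite -mulrA -mulrA -central !mulrA -[u i * x * e]mulrA xe.
have Ze (c : k) : c *: e * e = c *: e by rewrite -scalerAl ee.
have LeE (w : L) : (w \in (fullv * <[e]>)%VS) = (w * e == w).
  apply/idP/eqP => [wL|<-]; last by apply: memv_mul; rewrite ?memvf ?memv_line.
  have [||W hW] := @vspace_of_closed k L (fun w => w * e = w); first exact: mul0r.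
    by move=> c a b ha hb; rewrite mulrDl -scalerAl ha hb.
  have sub : (fullv * <[e]> <= W)%VS.
    by apply/prodvP => a b _ /vlineP [c ->]; apply/hW; rewrite -mulrA; congr (_ * _); exact: Ze.
  by apply/hW/(subvP sub).
exists e; split=> //.
  by apply/eqP => e0; case/eqP: x0; rewrite -xe e0 mulr0.
move=> U lU UL.
(* A k-linear projection onto U averaged over the dual bases; on U the average is multiplication by
   e, that is, the identity. *)
have Pl : linear (fun y : L => t x *: \sum_i u i * (x * projv U (v i * y))).
  move=> c y z; rewrite scalerA mulrC -scalerA -scalerDr; congr (_ *: _).
  rewrite scaler_sumr -big_split; apply: eq_bigr => i _.
  by rewrite mulrDr -scalerAr linearP mulrDr mulrDr -!scalerAr.
pose P := linfun (mklin Pl).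
have PE y : P y = t x *: \sum_i u i * (x * projv U (v i * y)).
  exact: (lfunE (mklin Pl) y).
have PU y : P y \in U.
  by rewrite PE rpredZ // rpred_sum // => i _; apply/lU/lU/memv_proj.
have Pid y : y \in U -> P y = y.
  move=> yU; have ye : e * y = y.
    by rewrite central; apply/eqP; rewrite -LeE; apply: subvP yU.
  rewrite PE -[RHS]ye /e -scalerAl mulr_suml; congr (_ *: _); apply: eq_bigr => i _.
  by rewrite projv_id ?mulrA //; apply: lU.
have Pa a y : P (a * y) = a * P y.
  have ql : linear (fun z : L => x * projv U (z * y)).
    by move=> c z w; rewrite mulrDl -scalerAl linearP mulrDr -scalerAr.
  rewrite !PE -scalerAr; congr (_ *: _); rewrite mulr_sumr.
  have := casimir (mklin ql) a E1 E2; rewrite /= => E.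
  transitivity (\sum_i u i * (x * projv U (v i * a * y))).
    by apply: eq_bigr => i _; rewrite (mulrA (v i)).
  by rewrite -E; apply: eq_bigr => i _; rewrite [RHS]mulrA.
exists (lker P :&: (fullv * <[e]>))%VS; split.
- move=> a w; rewrite !memv_cap !memv_ker !LeE Pa => /andP[/eqP -> /eqP we].
  by rewrite mulr0 eqxx -mulrA we eqxx.
- apply/eqP; rewrite eqEsubv subv_add UL capvSr /=; apply/subvP => w wL.
  rewrite -(subrK (P w) w) addrC memv_add // memv_cap memv_ker linearB /= (Pid (P w)) //.
  by rewrite subrr eqxx /= rpredB // (subvP UL).
apply/eqP; rewrite -subv0; apply/subvP => w; rewrite !memv_cap memv_ker memv0.
by move=> /and3P[wU /eqP Pw _]; rewrite -(Pid w wU) Pw.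
Qed.
End Block.

Lemma semisimple_of_end1 (k : fieldType) (L : falgType k) (t : symform L) (A : pc L) :
  hd A A = 1%N -> has_semisimple_summand L.
Proof.
move=> hA; have A0 : id_hom A <> 0 by move/hd_id0; rewrite hA.
have scal (a : khom A A) : exists c : k, a = c *: id_hom A.
  have /vlineP [c cE] : (a : phom A A) \in <[id_hom A : phom A A]>%VS.
    have -> : <[id_hom A : phom A A]>%VS = fullv; last exact: memvf.
    apply/eqP; rewrite eqEdim subvf dim_vline -[\dim _]/(hd A A) hA lt0b; exact/eqP.
  by exists c.
have [j [z [dz nz]]] : exists (j : int) (z : A (j + 1)),
    diff A (j + 1) z = 0 /\ ~ exists y, diff A j y = z.
  apply: contrapT => N; apply: A0; apply: acyclic_zero (pcP A) _ => j z dz.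
  by apply: contrapT => nz; apply: N; exists j, z.
have [f0 f0E] := stalk_map dz.
pose S : pc L := PC (perfect_stalk L (j + 1)).
have fn : cls f0 != 0 :> khom S A.
  apply/eqP => /cls_eq0 [s hs]; apply: nz.
  exists (s j (stalk_elt (j + 1) (1 : L))); rewrite -f0E hs.
  by rewrite [diff (stalk _ _) _ _]/= linear0 addr0.
have [b hb] := tau_nondeg t (X := S) (Y := A) fn.
(* f b is a scalar c, nonzero since its trace is that of b f; so c^-1 b is a section of f. *)
have [c cE] := scal (cls f0 \c b).
have c0 : c != 0.
  by apply/eqP => c0; case/eqP: hb; rewrite tauC cE c0 scale0r linear0.
pose f : khom S A := cls f0.
have [s fs] : exists s : khom A S, f \c s = id_hom A.
  by exists (c^-1 *: b); rewrite hcompZr cE scalerA mulVf // scale1r.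
pose x := ev (s \c f).
apply: (semisimple_summand t (x := x)).
- apply/eqP => /ev_eq0 sf; apply: A0.
  by rewrite -(hcomp1l (id_hom A)) -fs -hcompA (hcompA s) sf hcomp0l hcomp0r.
- by rewrite -ev_comp -hcompA (hcompA f) fs hcomp1l.
(* [ev] reverses products, so x y x is the value of s (f r s) f, where f r s is a scalar
   endomorphism of A. *)
move=> y; have [r rE] := ev_surj (j + 1) y.
have [d dE] := scal (f \c (r \c s)); exists d.
rewrite -rE -!ev_comp -evZ; congr ev.
by rewrite -!hcompA (hcompA r) (hcompA f) dE hcompZl hcomp1l hcompZr.
Qed.

(** * Two-dimensional endomorphism spaces and the distance from the rim *)

Lemma hd_component (k : fieldType) (L : falgType k) (C : pc L) (B : nat -> complex L)
  (B' : nat -> pc L) m i : (forall n, pcx (B' n) = B n) -> hiso C (shift i (B m)) ->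
  hd C C = hd (B' m) (B' m).
Proof.
move=> BE /hisoE; rewrite -BE => CB.
by rewrite (@hd_iso _ _ C (psh i (B' m)) C (psh i (B' m)) CB CB) hd_shift.
Qed.

(** In a decomposition, dim End A + 2 dim Hom(A, B) + dim End B = 2. The value dim End A = 1 would
    give a semisimple summand, so A or B has no endomorphisms. *)
Lemma indecomposable_of_end2 (k : fieldType) (L : falgType k) (t : symform L) (X : pc L) :
  ~ has_semisimple_summand L -> hd X X = 2%N -> indecomposable X.
Proof.
move=> nss X2; split; first by move=> /is_zeroE /hd_id0; rewrite X2.
move=> A B pA pB /hisoE/bipE bX.
have E : hd X X = (hd (PC pA) (PC pA) + hd (PC pA) (PC pB) +
                   (hd (PC pB) (PC pA) + hd (PC pB) (PC pB)))%N.
  by rewrite (hd_bip (A := PC pA) (B := PC pB) X bX) !(hd_sym t X)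
    !(hd_bip (A := PC pA) (B := PC pB) _ bX).
case EA : (hd (PC pA) (PC pA)) => [|[|a]].
- by left; apply/is_zeroE; apply/(hd_id0 (PC pA)).
- by case: nss; apply: semisimple_of_end1 t (PC pA) EA.
by right; apply/is_zeroE; apply/(hd_id0 (PC pB)); lia.
Qed.

Theorem theorem6p2 (k : closedFieldType) (L : falgType k)
    (symL : symmetric_algebra L) :
  [/\ forall C D : complex L,
        perfect C -> indecomposable C -> hom_dim C C 2 ->
        perfect D -> between_rim_and C D -> hom_dim D D 2,
      forall m : nat,
        (exists C : complex L,
           [/\ perfect C, indecomposable C, hom_dim C C 2
             & distance_from_rim C m]) <->
        (exists C0 : complex L,
           [/\ perfect C0, indecomposable C0, hom_dim C0 C0 2
             & forall i : int, i != 0 -> - m%:Z <= i <= m%:Z ->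
                 hom_dim C0 (shift i C0) 0])
    & ~ has_semisimple_summand L -> forall m : nat,
        (exists C : complex L,
           [/\ perfect C, indecomposable C, hom_dim C C 2
             & distance_from_rim C m]) <->
        (exists C0 : complex L,
           [/\ perfect C0, hom_dim C0 C0 2
             & forall i : int, i != 0 -> - m%:Z <= i <= m%:Z ->
                 hom_dim C0 (shift i C0) 0])].
Proof.
have [t] := symform_exists symL.
have main m : (exists C : complex L,
       [/\ perfect C, indecomposable C, hom_dim C C 2 & distance_from_rim C m]) <->
    (exists C0 : complex L,
       [/\ perfect C0, indecomposable C0, hom_dim C0 C0 2
         & forall i : int, i != 0 -> - m%:Z <= i <= m%:Z -> hom_dim C0 (shift i C0) 0]).
  split=> [[C [pC iC /(hom_dimE (PC pC) (PC pC)) C2 [B [j [zB CB]]]]]|[C [pC iC C2 C0]]].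
    have [B' [cB BE]] := ZAoo_component_pc zB.
    have /(component_hd_rim t cB) [B2 B0] : hd (B' m) (B' m) = 2%N.
      by rewrite -(hd_component (C := PC pC) BE CB).
    exists (B' 0%N); split; first exact: pcP.
    - exact/local_indecomposable/component_local.
    - exact/hom_dimE.
    move=> i i0 im; apply/(hom_dimE (B' 0%N) (psh i (B' 0%N))); apply: B0 => //; lia.
  have {}C2 : hd (PC pC) (PC pC) = 2%N by apply/hom_dimE.
  have lC : local (PC pC) by apply: indecomposable_local.
  have [|B [r [cB BC]]] := component_exists t lC; first by rewrite C2.
  have {}C0 i : i != 0 -> (`|i| <= m)%N -> hdi (B r) (B r) i = 0%N.
    by move=> i0 im; rewrite BC; apply/hom_dimE; apply: C0 => //; lia.
  (* The given object is B_r with r unknown. If r = 0, the vanishing passes to B_m by the criterion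
     on the rim. If r > 0, Hom(B_r, B_r[1]) is nonzero, which leaves only m = 0, where one descends
     from B_r to the rim. *)
  have Bm : hd (B m) (B m) = 2%N.
    case: r BC C0 => [BC C0|r BC C0].
      by apply/(component_hd_rim t cB); rewrite {1 2}BC.
    case: m C0 => [|m] C0; first by apply: (component_hd_le t cB (leq0n r.+1)); rewrite BC.
    by have := component_ext t cB (ltn0Sn r); rewrite C0.
  exists (B m); split; first exact: pcP.
  - exact/local_indecomposable/component_local.
  - exact/hom_dimE.
  exists (fun n => B n), 0; split; first exact: component_ZAoo.
  exact/hisoE/iso_sym/psh0.
split=> // [C D pC iC /(hom_dimE (PC pC) (PC pC)) C2 pD|nss m].
  move=> [B [m [r [i [j [zB CB rm DB]]]]]].
  have [B' [cB BE]] := ZAoo_component_pc zB.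
  apply/(hom_dimE (PC pD) (PC pD)); rewrite (hd_component (C := PC pD) BE DB).
  by apply: (component_hd_le t cB rm); rewrite -(hd_component (C := PC pC) BE CB).
rewrite main; split=> [[C0 [pC iC C2 H]]|[C0 [pC C2 H]]]; exists C0; split=> //.
by apply: (indecomposable_of_end2 t (X := PC pC) nss); apply/hom_dimE.
Qed.
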